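(* Let $N\ge 1$ be an integer and let $\mathcal{A}\in \mathrm{Tr}(a,b,c)$ be a triangular arrangement obtained by deleting a complementary triangular arrangement $\mathcal{A}^c$ (consisting of inner lines) from the full monomial arrangement $\mathcal{A}_3^3(N)$. Let $T_{\mathrm{rem}}$ be the set of inner triple points of $\mathcal{A}^c$. The following hold: (1) If $T_{\mathrm{rem}}=\emptyset$, then $\mathcal{T}_{\mathcal{A}}$ is free. Furthermore: (2) If $2N-a-b-c+2\le 0$, then $T_{\mathrm{rem}}=\emptyset$ if and only if $\mathcal{T}_{\mathcal{A}}$ is free. (3) If $c\ge a+b-1$, then $\mathcal{T}_{\mathcal{A}}$ is free if and only if $|T_{\mathrm{rem}}|=(N-c+1)(N-a-b+2)$. Moreover, in this situation (i.e. $c\ge a+b-1$ and $\mathcal{T}_{\mathcal{A}}$ free), every removed line of the third family (every line of $\mathcal{A}^c$ through $C$) contains exactly $N-a-b+2$ points of $T_{\mathrm{rem}}$.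
   Context: We work in $\mathbb{P}^2$ over $\mathbb{C}$. A line arrangement $\mathcal{A}=\{l_1,\dots,l_n\}$ is a finite set of distinct lines in $\mathbb{P}^2$; let $f=\prod f_i$ be its defining equation. The sheaf $\mathcal{T}_{\mathcal{A}}$ (a rank 2 vector bundle) is defined by $$0\to \mathcal{T}_{\mathcal{A}}\to \mathcal{O}_{\mathbb{P}^2}^3\xrightarrow{\nabla f}\mathcal{J}_f(n-1)\to 0,$$ where $\mathcal{J}_f$ is the ideal sheaf generated by $\nabla f=(\partial_x f,\partial_y f,\partial_z f)$. The arrangement (or $\mathcal{T}_{\mathcal{A}}$) is free with exponents $(\alpha,\beta)$ if $\mathcal{T}_{\mathcal{A}}\cong \mathcal{O}_{\mathbb{P}^2}(-\alpha)\oplus\mathcal{O}_{\mathbb{P}^2}(-\beta)$. For three non-aligned points $A,B,C$ and $0\le a\le b\le c$, $\mathrm{Tr}(a,b,c)$ denotes the set of arrangements every line of which passes through $A$, $B$ or $C$, containing the three side lines $(AB),(AC),(BC)$, and having $a+1$ lines through $A$, $b+1$ through $B$, $c+1$ through $C$ (side lines included in these counts); such an arrangement has $a+b+c$ lines. Lines of the arrangement other than the sides are called inner lines. The full monomial arrangement $\mathcal{A}_3^3(N)$ is defined by $xyz(x^N-y^N)(y^N-z^N)(x^N-z^N)=0$; its triangle has as vertices the three coordinate points, which here are the points $A,B,C$ labelled in some order. The arrangement $\mathcal{A}$ is obtained from $\mathcal{A}_3^3(N)$ by removing a set $\mathcal{A}^c$ of inner lines: $N-a+1$ inner lines through $A$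 (first family), $N-b+1$ through $B$ (second family), $N-c+1$ through $C$ (third family), the three sides being kept. $\mathcal{A}^c$ is called the complementary arrangement of $\mathcal{A}$. Its inner triple points are the points lying on one line of $\mathcal{A}^c$ through $A$, one line of $\mathcal{A}^c$ through $B$ and one line of $\mathcal{A}^c$ through $C$. *)

(* Defs.v *)
From HB Require Import structures.
From mathcomp Require Import all_boot all_order all_algebra.
From mathcomp Require Import finmap boolp classical_sets functions cardinality.
From mathcomp Require Import reals complex mpoly.

Set Implicit Arguments.
Unset Strict Implicit.
Unset Printing Implicit Defensive.

Import Order.TTheory GRing.Theory Num.Theory.

Local Open Scope classical_set_scope.
Local Open Scope ring_scope.

(* The projective plane P^2 over K and its lines: linear subspaces of K^3 of
   dimension 1 and 2. *)
Definition P2point (K : closedFieldType) : choiceType :=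
  {p : {vspace 'rV[K]_3} | \dim p == 1%N}.

Definition P2line (K : closedFieldType) : choiceType :=
  {l : {vspace 'rV[K]_3} | \dim l == 2%N}.

Definition incident (K : closedFieldType) (p : P2point K) (l : P2line K) :
    bool :=
  (val p <= val l)%VS.

(* Coherent sheaves on P^2, in the language of classical varieties.  An open
   subset of P^2 is represented by the cone over it with the origin removed, a
   section of O(k) by the function on this cone that is locally a quotient of
   forms whose degrees differ by k.  Sections are extended by 0 outside the
   cone, so that two sections are equal iff they are equal as functions. *)

Definition cone_open (K : closedFieldType) (U : set 'rV[K]_3) : Prop :=
  exists S : set {mpoly K[3]},
    (forall g, S g -> exists d : nat, g \is d.-homog) /\
    U = [set v : 'rV[K]_3 | v != 0 /\ exists2 g, S g & g.@[v 0] != 0].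

Definition section_O (K : closedFieldType) (k : int) (U : set 'rV[K]_3)
    (s : 'rV[K]_3 -> K) : Prop :=
  (forall v, ~ U v -> s v = 0) /\
  (forall v, U v -> exists V : set 'rV[K]_3,
     [/\ cone_open V, V v, V `<=` U &
      exists (d e : nat) (g h : {mpoly K[3]}),
        [/\ g \is d.-homog, h \is e.-homog, d%:Z = e%:Z + k &
         forall w, V w -> h.@[w 0] != 0 /\ s w = g.@[w 0] / h.@[w 0]]]).

(* A sheaf of O-modules whose sections over U are vector-valued functions. *)
Definition fsheaf (K : closedFieldType) (m : nat) : Type :=
  set 'rV[K]_3 -> set ('rV[K]_3 -> 'rV[K]_m).

(* O(k_0) (+) ... (+) O(k_(m-1)) *)
Definition sum_O (K : closedFieldType) (m : nat) (k : 'I_m -> int) :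
    fsheaf K m :=
  fun U => [set s | forall i, section_O (k i) U (fun v => s v 0 i)].

(* The kernel of grad f : O^3 -> O(n-1), with n the degree of f. *)
Definition T_sheaf (K : closedFieldType) (f : {mpoly K[3]}) : fsheaf K 3 :=
  fun U => [set s | @sum_O K 3 (fun=> 0) U s /\
    forall v, U v -> \sum_(i < 3) s v 0 i * (f^`M(i)).@[v 0] = 0].

(* Isomorphism of sheaves of O-modules: a family phi_U of O(U)-linear
   bijections compatible with restrictions. *)
Definition sheaf_iso (K : closedFieldType) (m n : nat)
    (F : fsheaf K m) (G : fsheaf K n) : Prop :=
  exists phi : set 'rV[K]_3 -> ('rV[K]_3 -> 'rV[K]_m) -> 'rV[K]_3 -> 'rV[K]_n,
    (forall U, cone_open U -> set_bij (F U) (G U) (phi U)) /\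
    (forall U, cone_open U -> forall (r : 'rV[K]_3 -> K) s t,
       section_O 0 U r -> F U s -> F U t ->
       phi U (fun v => r v *: s v + t v) =
       (fun v => r v *: phi U s v + phi U t v)) /\
    (forall U V, cone_open U -> cone_open V -> V `<=` U -> forall s, F U s ->
       phi V (patch (fun=> 0) V s) = patch (fun=> 0) V (phi U s)).

Definition free_with_exponents (K : closedFieldType) (F : fsheaf K 3)
    (alpha beta : int) : Prop :=
  sheaf_iso F
    (@sum_O K 2 (fun i : 'I_2 => if i == 0 then - alpha else - beta)).

Definition free_sheaf (K : closedFieldType) (F : fsheaf K 3) : Prop :=
  exists alpha beta : int, free_with_exponents F alpha beta.

Definition equation_of_line (K : closedFieldType) (l : P2line K)
    (g : {mpoly K[3]}) : Prop :=
  [/\ g \is 1.-homog, g != 0 &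
     forall v : 'rV[K]_3, v \in val l -> g.@[v 0] = 0].

(* f is determined by arr up to a nonzero scalar, and T_sheaf f does not depend
   on this scalar. *)
Definition defining_equation (K : closedFieldType) (arr : {fset P2line K})
    (f : {mpoly K[3]}) : Prop :=
  exists2 g : P2line K -> {mpoly K[3]},
    forall l, l \in arr -> equation_of_line l (g l) &
    f = \prod_(l <- arr) g l.

Definition aligned (K : closedFieldType) (A B C : P2point K) : Prop :=
  exists l : P2line K, [/\ incident A l, incident B l & incident C l].

Definition is_side (K : closedFieldType) (A B C : P2point K) (l : P2line K) :
    bool :=
  [|| val l == (val A + val B)%VS, val l == (val A + val C)%VS
    | val l == (val B + val C)%VS].

Definition Tr (K : closedFieldType) (A B C : P2point K) (a b c : nat) :
    set {fset P2line K} :=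
  [set arr : {fset P2line K} |
    ~ aligned A B C /\
    (a <= b <= c)%N /\
    (forall l, l \in arr -> [|| incident A l, incident B l | incident C l]) /\
    (forall l, is_side A B C l -> l \in arr) /\
    [/\ #|` [fset l in arr | incident A l]%fset| = a.+1,
        #|` [fset l in arr | incident B l]%fset| = b.+1 &
        #|` [fset l in arr | incident C l]%fset| = c.+1]].

Lemma coord_point_subproof (K : closedFieldType) (i : 'I_3) :
  \dim (<[delta_mx 0%R i : 'rV[K]_3]>%VS) == 1%N.
Proof.
suff ei0 : delta_mx 0 i != 0 :> 'rV[K]_3 by rewrite dim_vline ei0.
by apply/eqP => /matrixP/(_ 0 i)/eqP; rewrite !mxE !eqxx oner_eq0.
Qed.

Definition coord_point (K : closedFieldType) (i : 'I_3) : P2point K :=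
  exist _ <[delta_mx 0%R i : 'rV[K]_3]>%VS (coord_point_subproof K i).

Definition monomial_poly (K : closedFieldType) (N : nat) : {mpoly K[3]} :=
  let x : {mpoly K[3]} := 'X_(0 : 'I_3) in
  let y : {mpoly K[3]} := 'X_(1 : 'I_3) in
  let z : {mpoly K[3]} := 'X_(2%:R : 'I_3) in
  x * y * z * (x ^+ N - y ^+ N) * (y ^+ N - z ^+ N) * (x ^+ N - z ^+ N).

(* The full monomial arrangement: the lines in the zero locus of its equation. *)
Definition full_monomial (K : closedFieldType) (N : nat) : set (P2line K) :=
  [set l : P2line K | forall v : 'rV[K]_3,
     v \in val l -> (monomial_poly K N).@[v 0] = 0].

Definition obtained_by_deleting (K : closedFieldType) (A B C : P2point K)
    (N : nat) (Ac arr : {fset P2line K}) : Prop :=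
  [/\ [set` Ac] `<=` @full_monomial K N,
      forall l, l \in Ac -> ~~ is_side A B C l &
      [set` arr] = @full_monomial K N `\` [set` Ac]].

Definition inner_triple_points (K : closedFieldType) (A B C : P2point K)
    (Ac : {fset P2line K}) : set (P2point K) :=
  [set p | exists l1 l2 l3 : P2line K,
    [/\ l1 \in Ac, incident A l1 & incident p l1] /\
    [/\ l2 \in Ac, incident B l2 & incident p l2] /\
    [/\ l3 \in Ac, incident C l3 & incident p l3]].

(* Number of elements of a finite set (0 if the set is infinite). *)
Definition finite_card (T : choiceType) (X : set T) : nat := #|` fset_set X|.

(* Main.v *)
(* A derivation tangent to the triangle has the form P x d/dx + Q y d/dy +
   R z d/dz, and it is tangent to the inner lines iff R - Q, P - R and Q - P
   are multiples of the products fA, fB, fC of the inner linear forms through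
   A, B, C.  Modulo the Euler field, T_A is thus the syzygy module of
   (fA, fB, fC).  The products (p, q, r) of the removed forms give a syzygy,
   since fA p + fB q + fC r = (y^N - z^N) + (z^N - x^N) + (x^N - y^N) = 0, and
   this syzygy vanishes exactly at the removed triple points.
   If there is no such point, fC vanishes on the grid of lines p = q = 0, hence
   belongs to the ideal (p, q); then (fA, fB, fC) = (p, q, r) x t for some t,
   and by Hilbert-Burch (p, q, r) and t form a basis.
   Conversely, write (p, q, r) in a basis of degrees alpha, beta.  Its two
   coordinates vanish at any removed triple point, and both are nonzero because
   p and q are coprime, so alpha, beta <= N; but alpha + beta >= a + b + c - 1.
   If c >= a + b - 1, comparing the Koszul syzygy (fB, - fA, 0) with a basis
   shows that freeness means fC in (fA, fB), i.e., that every point of a kept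
   line through A and a kept line through B lies on a kept line through C.
   Each removed line through C contains N - a - b + 2 removed triple points plus
   one for each such kept grid point on it.
   Bases of the module correspond to splittings of the sheaf because a section
   of O(k) over all of P^2 is a form of degree k. *)
Require Import Defs.
From HB Require Import structures.
From mathcomp Require Import all_boot all_order all_algebra.
From mathcomp Require Import finmap boolp classical_sets functions cardinality.
From mathcomp Require Import reals complex mpoly.
From mathcomp Require Import separable cyclotomic ring zify.

Set Implicit Arguments.
Unset Strict Implicit.
Unset Printing Implicit Defensive.

Import Order.TTheory GRing.Theory Num.Theory.

Local Open Scope classical_set_scope.
Local Open Scope ring_scope.

(** * Substitutions and nonvanishing points *)

(** All lines of the full arrangement are [X_i = z X_j], with (i, j) = (B, C), (C, A), (A, B) for
    the families through A, B, C: [z] is an N-th root of unity on an inner line, and [z = 0] yields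
    one side per family. Inner lines with parameters x, y, z are concurrent iff [x y z = 1]; hence
    inner lines through A and B always meet on exactly one inner line through C, kept or removed,
    and the counts take place in a cyclic group. The bound on alpha + beta comes from the 2 x 2
    minors of a basis: they are proportional to (fA, fB, fC), so by coprimality fC divides its
    minor, and degrees are compared. The main obstacle is that an isomorphism of sheaves acts on
    sections of degree 0, whereas a basis consists of derivations of degrees alpha and beta. A
    derivation s of degree d is therefore followed through the fractions s / x_i^d over the sets x_i
    != 0, whose images are glued again after multiplication by x_i^d. Degrees are integers and only
    0 is homogeneous in negative degree, so a coordinate of too small a degree vanishes without a
    case distinction. *)

Lemma mpoly_rmorph_ext (n : nat) (R : comNzRingType) (S : comNzRingType)
    (f g : {rmorphism {mpoly R[n]} -> S}) :
  (forall c, f c%:MP = g c%:MP) -> (forall i, f 'X_i = g 'X_i) -> f =1 g.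
Proof.
move=> fgC fgX p; rewrite (mpolyE p) !rmorph_sum; apply: eq_bigr => m _.
rewrite -mul_mpolyC !rmorphM fgC; congr (_ * _).
rewrite mpolyXE_id !rmorph_prod; apply: eq_bigr => i _.
by rewrite !rmorphXn fgX.
Qed.

Section Subst.
Variables (n : nat) (K : idomainType).
Implicit Types (p q : {mpoly K[n]}) (i j : 'I_n).

Definition msubst i q p : {mpoly K[n]} :=
  p \mPo [tuple if j == i then q else 'X_j | j < n].

HB.instance Definition _ i q := GRing.RMorphism.copy (msubst i q)
  (comp_mpoly [tuple if j == i then q else 'X_j | j < n]).

Lemma msubstC i q c : msubst i q c%:MP = c%:MP.
Proof. exact: comp_mpolyC. Qed.

Lemma msubstZ i q c p : msubst i q (c *: p) = c *: msubst i q p.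
Proof. exact: comp_mpolyZ. Qed.

Lemma msubstX i q j : msubst i q 'X_j = if j == i then q else 'X_j.
Proof. by rewrite /msubst comp_mpolyXU -tnth_nth tnth_mktuple. Qed.

Lemma msubst_dvd i q p : exists k : {mpoly K[n]}, p = msubst i q p + ('X_i - q) * k.
Proof.
elim/mpolyind: p => [|c m p _ _ [k kE]].
  by exists 0; rewrite raddf0 mulr0 addr0.
suff [l lE] : exists l : {mpoly K[n]}, 'X_[m] = msubst i q 'X_[m] + ('X_i - q) * l.
  exists (c *: l + k); rewrite raddfD /= msubstZ {1}kE {1}lE.
  by rewrite -!mul_mpolyC; ring.
rewrite mpolyXE_id rmorph_prod /=.
apply: (big_rec2 (fun x y => exists l : {mpoly K[n]}, x = y + ('X_i - q) * l)).
  by exists 0; rewrite mulr0 addr0.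
move=> j x y _ [l ->]; rewrite rmorphXn /=.
suff [l' ->] : exists l' : {mpoly K[n]}, 'X_j ^+ m j = msubst i q 'X_j ^+ m j + ('X_i - q) * l'.
  exists (l' * (y + ('X_i - q) * l) + msubst i q 'X_j ^+ m j * l); ring.
elim: (m j) => [|e [l' l'E]]; first by exists 0; rewrite !expr0 mulr0 addr0.
rewrite !exprS {1}l'E msubstX; case: eqVneq => [->|_].
  by exists (q ^+ e + 'X_i * l'); ring.
by exists ('X_j * l'); ring.
Qed.

End Subst.

Section Point.
Variable K : closedFieldType.

Lemma closed_field_notin (s : seq K) : exists x, x \notin s.
Proof.
have nz : \prod_(z <- s) ('X - z%:P) != 0 :> {poly K}.
  by rewrite monic_neq0 // monic_prod_XsubC.
by case/closed_nonrootP: nz => x; rewrite root_prod_XsubC; exists x.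
Qed.

(** Each bad value [x] splits off a factor ['X_i - x] and leaves a quotient of smaller degree, so
    only finitely many values are bad. *)
Lemma msubst_neq0_ae (n : nat) (i : 'I_n) (p : {mpoly K[n]}) : p != 0 ->
  exists s : seq K, forall x, x \notin s -> msubst i x%:MP p != 0.
Proof.
have [k] := ubnP (msize p); elim: k p => // k IHk p lepk p0.
have [[x px0]|h] := EM (exists x, msubst i x%:MP p = 0); last first.
  by exists [::] => x _; apply/eqP => h'; apply: h; exists x.
have [q] := msubst_dvd i x%:MP p; rewrite px0 add0r => pE.
have q0 : q != 0 by apply: contraNneq p0 => q0; rewrite pE q0 mulr0.
have Xx0 : 'X_i - x%:MP != 0 :> {mpoly K[n]}.
  by apply: contraNneq p0 => X0; rewrite pE X0 mul0r.
have sX : (1 < msize ('X_i - x%:MP : {mpoly K[n]}))%N.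
  rewrite ltnNge; apply/negP => /msize1_polyC /mpolyP/(_ U_(i)%MM).
  rewrite mcoeffB mcoeffX !mcoeffC eqxx.
  by rewrite (mnm1_eq0 i) !mulr0 subr0 => /eqP; rewrite oner_eq0.
have /IHk/(_ q0)[s sP] : (msize q < k)%N.
  move: lepk; rewrite ltnS pE msizeM //.
  move: sX; case: (msize _) => [//|[//|e]] _; rewrite addSn /=.
  by apply: leq_trans; rewrite addSn ltnS leq_addl.
exists (x :: s) => y; rewrite inE negb_or => /andP[yx /sP qy].
rewrite pE rmorphM mulf_neq0 // rmorphB /= msubstX eqxx msubstC -mpolyCB.
by rewrite mpolyC_eq0 subr_eq0.
Qed.

Lemma mpoly_nonroot (n : nat) (p : {mpoly K[n]}) :
  p != 0 -> exists v : 'I_n -> K, p.@[v] != 0.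
Proof.
move=> p0.
(* Substituting constants for all variables, one after the other, is evaluation; at each stage
   finitely many values are to be avoided. *)
suff [v hv] : exists v : 'I_n -> K,
    foldr (fun i r => msubst i (v i)%:MP r) p (enum 'I_n) != 0.
  exists v; apply: contraNneq hv => pv0.
  suff cE s : {subset enum 'I_n <= s} ->
      foldr (fun i r => msubst i (v i)%:MP r) p s = p.@[v]%:MP.
    by rewrite cE // pv0 mpolyC0.
  move=> sP; have : forall i, i \in s by move=> i; apply: sP; rewrite mem_enum.
  move=> {}sP.
  have [F [FE FC]] : exists F : {rmorphism {mpoly K[n]} -> {mpoly K[n]}},
      (forall r, F r = foldr (fun i r => msubst i (v i)%:MP r) r s) /\
      ((forall c, F c%:MP = c%:MP) /\
       forall i, F 'X_i = if i \in s then (v i)%:MP else 'X_i).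
    elim: s {sP} => [|i s [F [FE [FC FX]]]]; first by exists idfun.
    exists (msubst i (v i)%:MP \o F) => /=; split=> [r|]; first by rewrite FE.
    split=> [c|j]; first by rewrite FC msubstC.
    rewrite FX in_cons; case: (j \in s); rewrite ?msubstC ?orbT // orbF msubstX.
    by case: eqP => [->|].
  rewrite -FE -[RHS]/((@mpolyC n K \o meval v) p).
  apply: mpoly_rmorph_ext => [c|i] /=; first by rewrite FC.1 mevalC.
  by rewrite FC.2 sP mevalXU.
elim: (enum 'I_n) (enum_uniq 'I_n) => [_|i s IHs /= /andP[is_ /IHs[v hv]]].
  by exists (fun=> 0).
have [b bP] := msubst_neq0_ae i hv; have [x xb] := closed_field_notin b.
exists (fun j => if j == i then x else v j); rewrite eqxx.
have -> : foldr (fun j r => msubst j (if j == i then x else v j)%:MP r) p s =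
          foldr (fun j r => msubst j (v j)%:MP r) p s.
  elim: s is_ {IHs hv bP} => [//|j s IHs] js.
  have ji : (j == i) = false.
    by apply: contraNF js => /eqP ->; exact: mem_head.
  have is' : i \notin s by apply: contra js; rewrite inE => ->; rewrite orbT.
  rewrite -[LHS]/(msubst j (if j == i then x else v j)%:MP (foldr _ p s)).
  by rewrite (IHs is') ji.
exact: bP.
Qed.

Lemma mpoly_nonroot_rV (n : nat) (p : {mpoly K[n]}) :
  p != 0 -> exists v : 'rV[K]_n, p.@[v 0] != 0.
Proof.
move=> /mpoly_nonroot[v pv]; exists (\row_i v i).
by rewrite (meval_eq (v2 := v)) // => i; rewrite mxE.
Qed.

End Point.

(** * Homogeneous polynomials and linear factors *)

Section IntegerDegree.
Variables (n : nat) (K : idomainType).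
Implicit Types (p q : {mpoly K[n]}) (k l : int).

(* Homogeneity in an integer degree: only 0 has negative degree. *)
Definition dhomz k p : Prop := p = 0 \/ exists2 e : nat, k = e%:Z & p \is e.-homog.

Lemma dhomz0 k : dhomz k 0. Proof. by left. Qed.

Lemma dhomz_homog (e : nat) p : p \is e.-homog -> dhomz e%:Z p.
Proof. by right; exists e. Qed.

Lemma homog_dhomz (e : nat) p : dhomz e%:Z p -> p \is e.-homog.
Proof. by case=> [->|[d [->]]//]; exact: dhomog0. Qed.

Lemma dhomz_ge0 k p : dhomz k p -> p != 0 -> 0 <= k.
Proof. by case=> [->|[e -> _]//]; rewrite eqxx. Qed.

Lemma dhomzD k p q : dhomz k p -> dhomz k q -> dhomz k (p + q).
Proof.
case=> [->|[e -> hp]]; first by rewrite add0r.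
by case=> [->|[_ [<-] hq]]; right; exists e; rewrite ?addr0 ?dhomogD.
Qed.

Lemma dhomzN k p : dhomz k p -> dhomz k (- p).
Proof.
by case=> [->|[e -> hp]]; [left; rewrite oppr0|right; exists e; rewrite ?dhomogN].
Qed.

Lemma dhomzZ k c p : dhomz k p -> dhomz k (c *: p).
Proof.
by case=> [->|[e -> hp]]; [left; rewrite scaler0|right; exists e; rewrite ?dhomogZ].
Qed.

Lemma dhomzM k l p q : dhomz k p -> dhomz l q -> dhomz (k + l) (p * q).
Proof.
case=> [->|[e -> hp]]; first by left; rewrite mul0r.
case=> [->|[d -> hq]]; first by left; rewrite mulr0.
by right; exists (e + d)%N; rewrite ?PoszD ?dhomogM.
Qed.

Definition piz k p : {mpoly K[n]} := if k is Posz e then pihomog mdeg e p else 0.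

Lemma pizD k p q : piz k (p + q) = piz k p + piz k q.
Proof. by case: k => e /=; rewrite ?addr0 // pihomogD. Qed.

Lemma piz0 k : piz k 0 = 0.
Proof. by case: k => e //=; rewrite pihomog0. Qed.

Lemma piz_sum k (I : Type) (r : seq I) (F : I -> {mpoly K[n]}) :
  piz k (\sum_(i <- r) F i) = \sum_(i <- r) piz k (F i).
Proof. by apply: big_morph; [exact: pizD|exact: piz0]. Qed.

Lemma piz_dhomz k p : dhomz k (piz k p).
Proof. by case: k => e /=; [right; exists e; rewrite // pihomogP|left]. Qed.

Lemma piz_homog k l p : dhomz k p -> piz l p = if l == k then p else 0.
Proof.
case=> [->|[e -> hp]]; first by rewrite piz0 if_same.
case: l => d //=; rewrite eqz_nat; case: eqVneq => [->|ne].
  by rewrite pihomog_dE.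
by rewrite (pihomog_ne0 _ hp) // eq_sym.
Qed.

Lemma piz_id k p : dhomz k p -> piz k p = p.
Proof. by move=> /(piz_homog k); rewrite eqxx. Qed.

(** Taking components commutes with multiplication by a form, up to a shift of the degree. Applied
    to an identity between forms, this replaces arbitrary coefficients by homogeneous ones. *)
Lemma pizM k l p q : dhomz l q -> piz k (p * q) = piz (k - l) p * q.
Proof.
move=> hq; have pE := @pihomog_partitionE _ _ mdeg _ p (leqnn _).
rewrite {1 2}pE.
rewrite mulr_suml !piz_sum mulr_suml; apply: eq_bigr => d _.
have hd : dhomz d%:Z (pihomog mdeg d p) by apply: dhomz_homog; exact: pihomogP.
rewrite (piz_homog _ (dhomzM hd hq)) (piz_homog _ hd) subr_eq.
by case: ifP; rewrite ?mul0r.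
Qed.

Lemma dhomz_divr k l p q : q != 0 -> dhomz l q -> dhomz k (p * q) ->
  dhomz (k - l) p.
Proof.
move=> q0 hq hpq; suff -> : p = piz (k - l) p by exact: piz_dhomz.
by apply: (mulIf q0); rewrite -pizM // piz_id.
Qed.

Lemma dhomz_divl k l p q : p != 0 -> dhomz l p -> dhomz k (p * q) ->
  dhomz (k - l) q.
Proof. by rewrite mulrC; exact: dhomz_divr. Qed.

End IntegerDegree.

Section LinearFactor.
Variables (n : nat) (K : idomainType).
Implicit Types (p q : {mpoly K[n]}) (i j : 'I_n) (z : K).

(** Equation of [X_i = z X_j]. In three variables and for distinct [i], [j], the value [z = 0] gives
    a side of the coordinate triangle, any other value an inner line through the third coordinate
    point. *)
Definition lf i j z : {mpoly K[n]} := 'X_i - z *: 'X_j.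

Definition mdvd p q : Prop := exists k : {mpoly K[n]}, q = p * k.

Lemma mdvd_mulr p q r : mdvd p q -> mdvd p (q * r).
Proof. by case=> k ->; exists (k * r); rewrite mulrA. Qed.

Lemma mdvdD p q r : mdvd p q -> mdvd p r -> mdvd p (q + r).
Proof. by move=> [k ->] [l ->]; exists (k + l); rewrite mulrDr. Qed.

Lemma mdvdN p q : mdvd p q -> mdvd p (- q).
Proof. by move=> [k ->]; exists (- k); rewrite mulrN. Qed.

Lemma dhomog_X i : 'X_i \is [in K[n], 1.-homog].
Proof. by rewrite dhomogX /= mdeg1. Qed.

Lemma lf_homog i j z : lf i j z \is 1.-homog.
Proof. by rewrite rpredB ?rpredZ ?dhomog_X. Qed.

Lemma lf_neq0 i j z : i != j -> lf i j z != 0.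
Proof.
move=> ij; apply/eqP => /(congr1 (mcoeff U_(i)%MM)).
rewrite mcoeffB mcoeffZ !mcoeffX eqxx mcoeff0 (_ : (_ == _) = false).
  by rewrite mulr0 subr0 => /eqP; rewrite oner_eq0.
by rewrite eq_mnm1 eq_sym (negbTE ij).
Qed.

Lemma lf_dvdP i j z p : i != j ->
  mdvd (lf i j z) p <-> msubst i (z *: 'X_j) p = 0.
Proof.
move=> ij; split=> [[k ->]|p0].
  rewrite rmorphM rmorphB /= msubstZ !msubstX eqxx eq_sym (negbTE ij).
  by rewrite subrr mul0r.
by have [k] := msubst_dvd i (z *: 'X_j) p; rewrite p0 add0r; exists k.
Qed.

(** The multiples of the form are the kernel of a substitution with values in a domain. *)
Lemma lf_prime i j z p q : i != j ->
  mdvd (lf i j z) (p * q) -> mdvd (lf i j z) p \/ mdvd (lf i j z) q.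
Proof.
move=> ij; rewrite !lf_dvdP // rmorphM => /eqP; rewrite mulf_eq0.
by case/orP => /eqP ->; [left|right].
Qed.

Lemma lf_dvdX i j k z : i != j -> k != i -> ~ mdvd (lf i j z) 'X_k.
Proof.
move=> ij ki; rewrite lf_dvdP // msubstX (negbTE ki) => /mpolyP/(_ U_(k)%MM).
by rewrite mcoeffX eqxx mcoeff0 => /eqP; rewrite oner_eq0.
Qed.

(** Divisibility means proportionality. Besides equal forms there are two coincidences: ['X_i]
    written twice with constant 0, and the same line written with its two variables exchanged and
    the constant inverted. *)
Lemma lf_dvd_lf i j k l z t : i != j -> k != l ->
  mdvd (lf i j z) (lf k l t) ->
  (i = k /\ ((j = l /\ z = t) \/ (z = 0 /\ t = 0))) \/
  [/\ i = l, j = k, z != 0 & z * t = 1].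
Proof.
move=> ij kl; rewrite lf_dvdP // rmorphB /= msubstZ !msubstX.
have XE a b : ('X_a : {mpoly K[n]})@_U_(b) = (a == b)%:R.
  by rewrite mcoeffX eq_mnm1.
case: (eqVneq k i) => [ki|ki].
  subst k; rewrite eq_sym (negbTE kl) => /mpolyP E; left; split=> //.
  case: (eqVneq j l) => [jl|jl].
    subst l; left; split=> //; move: (E U_(j)%MM).
    by rewrite mcoeffB !mcoeffZ XE eqxx !mulr1 mcoeff0 => /subr0_eq.
  right; split; [move: (E U_(j)%MM)|move: (E U_(l)%MM)];
  rewrite mcoeffB !mcoeffZ !XE eqxx mcoeff0 1?[l == j]eq_sym (negbTE jl).
    by rewrite mulr1 mulr0 subr0.
  by rewrite mulr0 mulr1 sub0r => /eqP; rewrite oppr_eq0 => /eqP.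
case: (eqVneq l i) => [li /mpolyP E|li /mpolyP E]; last first.
  move: (E U_(k)%MM); rewrite mcoeffB mcoeffZ !XE eqxx eq_sym (negbTE kl).
  by rewrite mulr0 subr0 mcoeff0 => /eqP; rewrite oner_eq0.
subst l; right; move: (E U_(k)%MM).
rewrite mcoeffB !mcoeffZ !XE eqxx mcoeff0; case: (eqVneq j k) => [jk|jk].
  rewrite mulr1 => /subr0_eq zt; split=> //; last by rewrite mulrC -zt.
  by apply/eqP => z0; move/eqP: zt; rewrite z0 mulr0 oner_eq0.
by rewrite !mulr0 subr0 => /eqP; rewrite oner_eq0.
Qed.

End LinearFactor.

(** * Products of linear factors and their syzygies *)

Section LinearProducts.
Variables (n : nat) (K : idomainType).
Implicit Types (p q : {mpoly K[n]}) (i j : 'I_n) (z : K) (r : seq K).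

Definition lprod i j r : {mpoly K[n]} := \prod_(z <- r) lf i j z.

(** Coprimality as a cancellation rule; for a product of linear forms it follows by cancelling one
    prime factor at a time. *)
Definition mcop p q : Prop := forall h k, p * h = q * k -> mdvd p k.

Lemma lprod_cons i j z r : lprod i j (z :: r) = lf i j z * lprod i j r.
Proof. exact: big_cons. Qed.

Lemma lprod_homog i j r : lprod i j r \is (size r).-homog.
Proof.
elim: r => [|z r IHr]; first by rewrite /lprod big_nil dhomog1.
by rewrite lprod_cons -[size _]add1n dhomogM ?lf_homog.
Qed.

Lemma lprod_neq0 i j r : i != j -> lprod i j r != 0.
Proof.
move=> ij; elim: r => [|z r IHr]; first by rewrite /lprod big_nil oner_neq0.
by rewrite lprod_cons mulf_neq0 ?lf_neq0.
Qed.

Lemma lf_dvd_lprod i j z r : z \in r -> mdvd (lf i j z) (lprod i j r).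
Proof. by move=> zr; rewrite /lprod (big_rem z) //=; apply: mdvd_mulr; exists 1; rewrite mulr1. Qed.

Lemma lf_ndvd_lprod i j k l z r : i != j ->
  (forall t, t \in r -> ~ mdvd (lf i j z) (lf k l t)) ->
  ~ mdvd (lf i j z) (lprod k l r).
Proof.
move=> ij; elim: r => [_|t r IHr h].
  by rewrite /lprod big_nil lf_dvdP // rmorph1 => /eqP; rewrite oner_eq0.
rewrite lprod_cons => /lf_prime -/(_ ij)[]; first by apply: h; rewrite mem_head.
by apply: IHr => t' t'r; apply: h; rewrite in_cons t'r orbT.
Qed.

Lemma lprod_cop i j r q : i != j ->
  (forall z, z \in r -> ~ mdvd (lf i j z) q) -> mcop (lprod i j r) q.
Proof.
move=> ij; elim: r => [_ h k _|z r IHr hq h k].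
  by exists k; rewrite /lprod big_nil mul1r.
rewrite lprod_cons -mulrA => E.
have /lf_prime -/(_ ij)[/hq|[k' k'E]] : mdvd (lf i j z) (q * k) by eexists; rewrite -E.
  by rewrite mem_head => /(_ isT).
move: E; rewrite k'E [q * _]mulrCA => /(mulfI (lf_neq0 z ij)) /IHr[|m ->].
  by move=> t tr; apply: hq; rewrite in_cons tr orbT.
by exists m; rewrite mulrA.
Qed.

Lemma lprod_dvd i j r p : i != j -> uniq r ->
  (forall z, z \in r -> mdvd (lf i j z) p) -> mdvd (lprod i j r) p.
Proof.
move=> ij; elim: r p => [p _ _|z r IHr p /= /andP[zr ur] h].
  by exists p; rewrite /lprod big_nil mul1r.
have [q qE] := h z (mem_head _ _); have [t tr|k kE] := IHr q ur.
  have := h t; rewrite in_cons tr orbT qE => /(_ isT) /lf_prime -/(_ ij)[|//].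
  case/(lf_dvd_lf ij ij) => [[_ [[_ tz]|[t0 z0]]]|[ijE _ _ _]].
  - by rewrite -tz tr in zr.
  - by rewrite z0 -t0 tr in zr.
  - by rewrite ijE eqxx in ij.
by exists k; rewrite lprod_cons -mulrA -kE.
Qed.

Lemma lprod_cop_lprod i j k l r s : i != j -> k != l -> i != k ->
  (i != l) || (j != k) -> mcop (lprod i j r) (lprod k l s).
Proof.
move=> ij kl ik ilk; apply: lprod_cop => // z _; apply: lf_ndvd_lprod => // t _.
case/(lf_dvd_lf ij kl) => [[ikE _]|[ilE jkE _ _]].
  by rewrite ikE eqxx in ik.
by rewrite ilE jkE !eqxx in ilk.
Qed.

End LinearProducts.

(** * Syzygies of a cross product of two vectors of polynomials *)

Section HilbertBurch.
Variables (n : nat) (K : idomainType).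
Implicit Types (p q r m l k s t u w : {mpoly K[n]}).

(** The vectors [w], [s] and [t] are all orthogonal to [s x t = (fA, fB, fC)], so [w x t] and
    [s x w] are proportional to it. Coprimality of [fA] and [fB] makes the two factors polynomials;
    by Cramer's rule they are the coordinates of [w]. *)
Lemma hilbert_burch fA fB fC s1 s2 s3 t1 t2 t3 w1 w2 w3 : 
  fA = s2 * t3 - s3 * t2 -> fB = s3 * t1 - s1 * t3 -> fC = s1 * t2 - s2 * t1 ->
  fA != 0 -> mcop fA fB -> w1 * fA + w2 * fB + w3 * fC = 0 ->
  exists k l : {mpoly K[n]},
    [/\ w1 = k * s1 + l * t1, w2 = k * s2 + l * t2 & w3 = k * s3 + l * t3].
Proof.
move=> EA EB EC A0 cop w0.
have [k kE] : mdvd fA (w2 * t3 - w3 * t2).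
  apply: (cop (w3 * t1 - w1 * t3)); apply/eqP; rewrite -subr_eq0; apply/eqP.
  transitivity (- t3 * (w1 * fA + w2 * fB + w3 * fC)); last by rewrite w0 mulr0.
  by rewrite EA EB EC; ring.
have [l lE] : mdvd fA (s2 * w3 - s3 * w2).
  apply: (cop (s3 * w1 - s1 * w3)); apply/eqP; rewrite -subr_eq0; apply/eqP.
  transitivity (s3 * (w1 * fA + w2 * fB + w3 * fC)); last by rewrite w0 mulr0.
  by rewrite EA EB EC; ring.
exists k, l; split; apply: (mulfI A0); rewrite mulrDr !mulrA -kE -lE.
- apply/eqP; rewrite -subr_eq0; apply/eqP.
  transitivity (w1 * fA + w2 * fB + w3 * fC); last by rewrite w0.
  by rewrite EA EB EC; ring.
- by rewrite EA; ring.
- by rewrite EA; ring.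
Qed.

(** Inserting [fC] into the syzygy gives [p (fA + r m) + q (fB + r k) = 0]. Coprimality then
    provides the last entry of the vector [t = (- k, m, l)], for which
    [(fA, fB, fC) = (p, q, r) x t]. *)
Lemma syzygy_cofactor fA fB fC p q r m k : p != 0 -> mcop p q ->
  p * fA + q * fB + r * fC = 0 -> fC = p * m + q * k ->
  exists t1 t2 t3 : {mpoly K[n]},
    [/\ fA = q * t3 - r * t2, fB = r * t1 - p * t3 & fC = p * t2 - q * t1].
Proof.
move=> p0 cop E EC.
have [l lE] : mdvd p (- (fB + r * k)).
  apply: (cop (fA + r * m)); apply/eqP; rewrite -subr_eq0; apply/eqP.
  by rewrite -E EC; ring.
exists (- k), m, l; split; last by rewrite EC; ring.
  apply: (mulfI p0); rewrite mulrBr mulrCA -lE; apply/eqP.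
  by rewrite -subr_eq0; apply/eqP; rewrite -E EC; ring.
by rewrite -lE; ring.
Qed.

End HilbertBurch.

Section UniqTriple.
Variables (T : eqType) (a b c : T).
Hypothesis uabc : uniq [:: a; b; c].

Lemma uniq3_12 : a != b.
Proof. by move: uabc; rewrite /= !inE negb_or => /andP[/andP[]]. Qed.

Lemma uniq3_23 : b != c.
Proof. by move: uabc; rewrite /= !inE andbT => /andP[_]. Qed.

Lemma uniq3_31 : c != a.
Proof. by move: uabc; rewrite /= !inE negb_or [a == c]eq_sym => /andP[/andP[]]. Qed.

End UniqTriple.

(** * Polynomials vanishing on a grid of points *)

Section Grid.
Variables (K : idomainType) (n : nat) (A B C : 'I_n).
Hypothesis uABC : uniq [:: A; B; C].

Let AB : A != B := uniq3_12 uABC.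
Let BC : B != C := uniq3_23 uABC.
Let CA : C != A := uniq3_31 uABC.

(* Restriction to the line of K^n on which 'X_B = zA 'X_C and 'X_C = zB 'X_A. *)
Definition grid_eval zA zB (p : {mpoly K[n]}) : {mpoly K[n]} :=
  msubst C (zB *: 'X_A) (msubst B (zA *: 'X_C) p).

HB.instance Definition _ zA zB := GRing.RMorphism.copy (grid_eval zA zB)
  (msubst C (zB *: 'X_A) \o msubst B (zA *: 'X_C)).

Lemma grid_eval_lfBC zA zB z :
  grid_eval zA zB (lf B C z) = ((zA - z) * zB) *: 'X_A.
Proof.
rewrite /grid_eval rmorphB /= msubstZ !msubstX eqxx [C == B]eq_sym (negbTE BC).
by rewrite rmorphB /= !msubstZ !msubstX eqxx -scalerBl scalerA.
Qed.

Lemma grid_eval_lfCA zA zB z : grid_eval zA zB (lf C A z) = (zB - z) *: 'X_A.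
Proof.
rewrite /grid_eval rmorphB /= msubstZ !msubstX [C == B]eq_sym (negbTE BC) (negbTE AB).
by rewrite rmorphB /= !msubstZ !msubstX eqxx [A == C]eq_sym (negbTE CA) scalerBl.
Qed.

Lemma grid_eval_lfAB zA zB z :
  grid_eval zA zB (lf A B z) = (1 - z * zA * zB) *: 'X_A.
Proof.
rewrite /grid_eval rmorphB /= msubstZ !msubstX eqxx (negbTE AB).
rewrite rmorphB /= !msubstZ !msubstX eqxx [A == C]eq_sym (negbTE CA).
by rewrite scalerBl scale1r !scalerA.
Qed.

Lemma grid_eval_lprodBC0 zA zB r : zA \in r -> grid_eval zA zB (lprod B C r) = 0.
Proof.
move=> /(lf_dvd_lprod B C)[k ->].
by rewrite rmorphM /= grid_eval_lfBC subrr mul0r scale0r mul0r.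
Qed.

Lemma grid_eval_lprodCA0 zA zB r : zB \in r -> grid_eval zA zB (lprod C A r) = 0.
Proof.
by move=> /(lf_dvd_lprod C A)[k ->]; rewrite rmorphM /= grid_eval_lfCA subrr scale0r mul0r.
Qed.

Lemma scaleX_eq0 c : (c *: 'X_A == 0 :> {mpoly K[n]}) = (c == 0).
Proof.
apply/eqP/eqP => [/mpolyP/(_ U_(A)%MM)|->]; last by rewrite scale0r.
by rewrite mcoeffZ mcoeffXU eqxx mulr1 mcoeff0.
Qed.

Lemma grid_eval_lprodBC_eq0 zA zB r : zB != 0 ->
  (grid_eval zA zB (lprod B C r) == 0) = (zA \in r).
Proof.
move=> zB0; rewrite /lprod rmorph_prod /=.
elim: r => [|z r IHr]; first by rewrite big_nil oner_eq0.
rewrite big_cons mulf_eq0 IHr inE grid_eval_lfBC scaleX_eq0.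
by rewrite mulf_eq0 (negbTE zB0) orbF subr_eq0.
Qed.

(** The grid point is [(1, zA zB, zB)] in the coordinates A, B, C, so [z * zA * zB = 1] is the
    condition for three lines, one of each family, to be concurrent. *)
Lemma grid_eval_lprodAB_eq0 zA zB r :
  (grid_eval zA zB (lprod A B r) == 0) = has (fun z => z * zA * zB == 1) r.
Proof.
rewrite /lprod rmorph_prod /=.
elim: r => [|z r IHr]; first by rewrite big_nil oner_eq0.
by rewrite big_cons mulf_eq0 IHr /= grid_eval_lfAB scaleX_eq0 subr_eq0 eq_sym.
Qed.

(** Induction on the lines through the first vertex. The restriction of [p] to the line
    [X_B = z X_C] vanishes at its grid points, hence is a multiple of [lprod C A rB]; what remains
    is divisible by the equation of that line, and the quotient vanishes on the rest of the grid
    because [zA != z] and [zB != 0] there. *)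
Lemma grid_ideal rA rB p : uniq rA -> uniq rB -> 0 \notin rB ->
  (forall zA zB, zA \in rA -> zB \in rB -> grid_eval zA zB p = 0) ->
  exists u v, p = u * lprod B C rA + v * lprod C A rB.
Proof.
move=> urA urB rB0; elim: rA urA p => [_ p _|z r IHr /= /andP[zr ur] p hp].
  by exists p, 0; rewrite /lprod big_nil mulr1 mul0r addr0.
have [k kE] := msubst_dvd B (z *: 'X_C) p.
have [m mE] : mdvd (lprod C A rB) (msubst B (z *: 'X_C) p).
  apply: lprod_dvd => // zB zBr; apply/(lf_dvdP _ _ CA).
  by apply: hp; rewrite ?mem_head.
have [zA zB zAr zBr|u [v kE']] := IHr ur k.
  have := hp zA zB; rewrite in_cons zAr orbT => /(_ isT zBr).
  rewrite kE mE rmorphD !rmorphM /= grid_eval_lprodCA0 // mul0r add0r.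
  rewrite grid_eval_lfBC => /eqP; rewrite mulf_eq0 scaleX_eq0 mulf_eq0 subr_eq0.
  case/orP => [/orP[/eqP zAz|/eqP zB0]|/eqP //]; first by rewrite -zAz zAr in zr.
  by rewrite -zB0 zBr in rB0.
exists u, (m + lf B C z * v); rewrite kE mE kE' lprod_cons -/(lf B C z); ring.
Qed.

End Grid.

(** * Derivations killing a triangular arrangement *)

Section Derivations.
Variables (n : nat) (K : idomainType).
Implicit Types (p q : {mpoly K[n]}) (i j : 'I_n) (s t : 'I_n -> {mpoly K[n]}).

Definition deriv_along s p : {mpoly K[n]} := \sum_i s i * p^`M(i).

Lemma deriv_alongM s p q :
  deriv_along s (p * q) = deriv_along s p * q + p * deriv_along s q.
Proof.
rewrite /deriv_along mulr_suml mulr_sumr -big_split; apply: eq_bigr => i _ /=.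
by rewrite mderivM; ring.
Qed.

Lemma deriv_along_comb s t p q f :
  deriv_along (fun i => p * s i + q * t i) f =
  p * deriv_along s f + q * deriv_along t f.
Proof.
rewrite !mulr_sumr -big_split; apply: eq_bigr => i _ /=; ring.
Qed.

Lemma mderivXU (k l : 'I_n) : ('X_k)^`M(l) = (k == l)%:R :> {mpoly K[n]}.
Proof.
rewrite mderivX mnm1E; case: eqP => [->|_]; last by rewrite scale0r.
rewrite scale1r (_ : U_(l) - U_(l) = 0)%MM ?mpolyX0 //.
by apply/mnmP => h; rewrite mnmBE subnn mnm0E.
Qed.

Lemma deriv_along_lf s i j z : deriv_along s (lf i j z) = s i - z *: s j.
Proof.
rewrite /deriv_along (eq_bigr (fun k => s k * (i == k)%:R - z *: (s k * (j == k)%:R))); last first.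
  by move=> k _; rewrite mderivB mderivZ !mderivXU mulrBr scalerAr.
have pick k : \sum_l s l * (k == l)%:R = s k.
  rewrite (bigD1 k) //= eqxx mulr1 big1 ?addr0 // => l lk.
  by rewrite eq_sym (negbTE lk) mulr0.
by rewrite sumrB -scaler_sumr !pick.
Qed.

(** By Leibniz, modulo a simple factor the derivative of the product is the derivative of that
    factor times its cofactor, which is prime to it. *)
Lemma lf_dvd_deriv s i j r z q : i != j -> uniq r -> z \in r ->
  ~ mdvd (lf i j z) q -> deriv_along s (lprod i j r * q) = 0 ->
  mdvd (lf i j z) (s i - z *: s j).
Proof.
move=> ij ur zr zq; rewrite /lprod (big_rem z) //= -mulrA deriv_alongM.
rewrite deriv_along_lf => /eqP; rewrite addr_eq0 => /eqP E.
have : mdvd (lf i j z) ((s i - z *: s j) * (\prod_(y <- rem z r) lf i j y * q)).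
  by rewrite E -mulrN; eexists.
case/(lf_prime ij) => // /(lf_prime ij)[|//].
rewrite -/(lprod i j (rem z r)) => h; exfalso; move: h.
apply: lf_ndvd_lprod => // t.
rewrite mem_rem_uniq // inE => /andP[tz _] /(lf_dvd_lf ij ij)[[_ [[_ zt]|[z0 t0]]]|].
- by rewrite zt eqxx in tz.
- by rewrite z0 t0 eqxx in tz.
- by case=> ijE; rewrite ijE eqxx in ij.
Qed.

Lemma mdvdZ i j y z p : i != j -> y != 0 ->
  mdvd (lf i j z) (y *: p) -> mdvd (lf i j z) p.
Proof.
move=> ij y0; rewrite !lf_dvdP // msubstZ -mul_mpolyC => /eqP.
by rewrite mulf_eq0 mpolyC_eq0 (negbTE y0) => /eqP.
Qed.

Lemma lf_dvd_diff i j z p q : i != j -> z != 0 ->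
  mdvd (lf i j z) ('X_i * p - z *: ('X_j * q)) -> mdvd (lf i j z) (q - p).
Proof.
move=> ij z0 h.
have : mdvd (lf i j z) ('X_j * (z *: (p - q))).
  have -> : 'X_j * (z *: (p - q)) =
      - (lf i j z * p) + ('X_i * p - z *: ('X_j * q)).
    by rewrite /lf -!mul_mpolyC; ring.
  by apply: mdvdD => //; apply: mdvdN; exists p.
case/(lf_prime ij) => [/lf_dvdX[]//|]; first by rewrite eq_sym.
by move=> /(mdvdZ ij z0) /mdvdN; rewrite opprB.
Qed.

(** The scalar [z] in the divisibility condition lets it cover the sides [z = 0] together with the
    inner lines. *)
Lemma deriv_lf_log d i j z s (P : 'I_n -> {mpoly K[n]}) : i != j ->
  (forall i, s i = 'X_i * P i) -> dhomz d (P i) -> dhomz d (P j) ->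
  mdvd (lf i j z) (z *: (P j - P i)) ->
  exists2 g, dhomz d g & deriv_along s (lf i j z) = lf i j z * g.
Proof.
move=> ij sE Pi Pj [m mE]; exists (P i - 'X_j * m); last first.
  rewrite deriv_along_lf !sE mulrBr mulrCA -mE /lf -!mul_mpolyC; ring.
apply: dhomzD => //; apply: dhomzN; rewrite -[d](subrKC 1).
apply: dhomzM; first by apply: dhomz_homog; rewrite dhomog_X.
apply: (dhomz_divl (lf_neq0 z ij)); first exact/dhomz_homog/lf_homog.
by rewrite -mE; apply/dhomzZ/dhomzD => //; apply: dhomzN.
Qed.

Lemma deriv_logM d s p q :
  (exists2 g, dhomz d g & deriv_along s p = p * g) ->
  (exists2 g, dhomz d g & deriv_along s q = q * g) ->
  exists2 g, dhomz d g & deriv_along s (p * q) = p * q * g.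
Proof.
move=> [g hg pE] [h hh qE]; exists (g + h); first exact: dhomzD.
by rewrite deriv_alongM pE qE; ring.
Qed.

Lemma deriv_lprod_log d s i j r :
  (forall z, z \in r -> exists2 g, dhomz d g & deriv_along s (lf i j z) = lf i j z * g) ->
  exists2 g, dhomz d g & deriv_along s (lprod i j r) = lprod i j r * g.
Proof.
elim: r => [_|z r IHr h].
  exists 0; first exact: dhomz0.
  rewrite mulr0 /lprod big_nil; apply: big1 => k _.
  by rewrite -mpolyC1 mderivC mulr0.
rewrite lprod_cons; apply: deriv_logM; first by apply: h; rewrite mem_head.
by apply: IHr => y yr; apply: h; rewrite in_cons yr orbT.
Qed.

Lemma euler_lprod i j r :
  deriv_along (fun k => 'X_k) (lprod i j r) = (size r)%:R *: lprod i j r.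
Proof.
elim: r => [|z r IHr].
  rewrite /lprod big_nil scale0r; apply: big1 => k _.
  by rewrite -mpolyC1 mderivC mulr0.
rewrite lprod_cons deriv_alongM IHr deriv_along_lf -/(lf i j z) /= -add1n natrD.
by rewrite scalerDl scale1r -scalerAr.
Qed.

End Derivations.

(** * Correspondence between derivations and syzygies of the inner products *)

Section TriangleSyzygies.
Variables (K : fieldType) (A B C : 'I_3) (rA rB rC : seq K).
Hypothesis uABC : uniq [:: A; B; C].
Hypothesis char0 : forall m, m.+1%:R != 0 :> K.
Hypotheses (uA : uniq (0 :: rA)) (uB : uniq (0 :: rB)) (uC : uniq (0 :: rC)).

Implicit Types (u v w : {mpoly K[3]}) (s P : 'I_3 -> {mpoly K[3]}).

Let AB : A != B := uniq3_12 uABC.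
Let BC : B != C := uniq3_23 uABC.
Let CA : C != A := uniq3_31 uABC.

Let BA : B != A. Proof. by rewrite eq_sym. Qed.
Let CB : C != B. Proof. by rewrite eq_sym. Qed.
Let AC : A != C. Proof. by rewrite eq_sym. Qed.

Lemma ord3_triangle i : [|| i == A, i == B | i == C].
Proof.
have : i \in [:: A; B; C]; last by rewrite !inE.
suff -> : [:: A; B; C] =i enum 'I_3 by rewrite mem_enum.
apply/subset_cardP; last by apply/fintype.subsetP => j _; rewrite mem_enum.
by rewrite (card_uniqP uABC) (card_uniqP (enum_uniq _)) size_enum_ord.
Qed.

Let fA : {mpoly K[3]} := lprod B C rA.
Let fB : {mpoly K[3]} := lprod C A rB.
Let fC : {mpoly K[3]} := lprod A B rC.

(** With the cyclic choice of index pairs, the entry 0 contributes ['X_B], ['X_C] and ['X_A] in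
    turn, so every side occurs exactly once. *)
Definition triangle_poly : {mpoly K[3]} :=
  lprod B C (0 :: rA) * lprod C A (0 :: rB) * lprod A B (0 :: rC).
Let F := triangle_poly.

Lemma triangle_poly_neq0 : F != 0.
Proof. by rewrite !mulf_neq0 ?lprod_neq0. Qed.

(* Dividing the derivation [s] by the triangle ['X_A 'X_B 'X_C] and factoring
   the Euler field out turns it into a syzygy of [fA, fB, fC]. *)
Definition tri_syz s u v w : Prop := exists P, (forall i, s i = 'X_i * P i) /\
  [/\ P C - P B = u * fA, P A - P C = v * fB & P B - P A = w * fC].

Lemma tri_syz_sum s u v w : tri_syz s u v w -> u * fA + v * fB + w * fC = 0.
Proof. by case=> P [_ [<- <- <-]]; ring. Qed.

Lemma tri_syz_comb p q s t u v w u' v' w' :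
  tri_syz s u v w -> tri_syz t u' v' w' ->
  tri_syz (fun i => p * s i + q * t i)
    (p * u + q * u') (p * v + q * v') (p * w + q * w').
Proof.
move=> [P [sE [uE vE wE]]] [Q [tE [uE' vE' wE']]].
exists (fun i => p * P i + q * Q i); split=> [i|]; first by rewrite sE tE; ring.
by split; rewrite mulrDl -!mulrA -?uE -?vE -?wE -?uE' -?vE' -?wE'; ring.
Qed.

Lemma X_neq0 (i : 'I_3) : 'X_i != 0 :> {mpoly K[3]}.
Proof.
apply/eqP => /mpolyP/(_ U_(i)%MM); rewrite mcoeffXU eqxx mcoeff0 => /eqP.
by rewrite oner_eq0.
Qed.

Lemma tri_syz_fun s u v w : tri_syz s u v w -> (forall i, s i = 0) ->
  [/\ u = 0, v = 0 & w = 0].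
Proof.
move=> [P [sE [uE vE wE]]] s0.
have P0 i : P i = 0.
  by apply: (mulfI (X_neq0 i)); rewrite -sE s0 mulr0.
move: uE vE wE; rewrite !P0 subrr => /esym uE /esym vE /esym wE.
have h u0 g : g != 0 -> u0 * g = 0 -> u0 = 0 :> {mpoly K[3]}.
  by move=> g0 /eqP; rewrite mulf_eq0 (negbTE g0) orbF => /eqP.
split; [apply: h uE|apply: h vE|apply: h wE]; exact: lprod_neq0.
Qed.

Lemma tri_syz_degree d s u v w : tri_syz s u v w -> (forall i, dhomz d (s i)) ->
  [/\ dhomz (d - (size rA).+1%:Z) u, dhomz (d - (size rB).+1%:Z) v
    & dhomz (d - (size rC).+1%:Z) w].
Proof.
move=> [P [sE [uE vE wE]]] sd.
have Pd i : dhomz (d - 1) (P i).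
  apply: (dhomz_divl (X_neq0 i)); first exact/dhomz_homog/dhomog_X.
  by rewrite -sE.
have PPd i j : dhomz (d - 1) (P i - P j) by apply: dhomzD => //; apply: dhomzN.
have dE m : d - m.+1%:Z = d - 1 - m%:Z by rewrite -[m.+1]addn1 PoszD; ring.
rewrite (dE (size rA)) (dE (size rB)) (dE (size rC)); split.
- apply: (dhomz_divr (lprod_neq0 rA BC)); first exact/dhomz_homog/lprod_homog.
  by rewrite -uE.
- apply: (dhomz_divr (lprod_neq0 rB CA)); first exact/dhomz_homog/lprod_homog.
  by rewrite -vE.
- apply: (dhomz_divr (lprod_neq0 rC AB)); first exact/dhomz_homog/lprod_homog.
  by rewrite -wE.
Qed.

Lemma euler_triangle : deriv_along (fun k => 'X_k) F =
  ((size rA).+1 + (size rB).+1 + (size rC).+1)%N%:R *: F.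
Proof.
rewrite /F /triangle_poly !deriv_alongM !euler_lprod /= -!mul_mpolyC !natrD.
by rewrite !mpolyCD; ring.
Qed.

(** A zero syzygy forces all [P i] to coincide, so [s] is a multiple of the Euler field. That field
    multiplies [F] by its degree, which is nonzero in [K]; hence the multiple is zero if [s] kills
    [F]. *)
Lemma tri_syz_inj s : tri_syz s 0 0 0 -> deriv_along s F = 0 -> forall i, s i = 0.
Proof.
move=> [P [sE]]; rewrite !mul0r => -[/subr0_eq uE /subr0_eq vE _] sF.
have PE i : P i = P A.
  by case/or3P: (ord3_triangle i) => /eqP -> //; rewrite vE ?uE.
have : P A * deriv_along (fun k => 'X_k) F = 0.
  rewrite -sF mulr_sumr; apply: eq_bigr => i _.
  by rewrite sE (PE i); ring.
rewrite euler_triangle => /eqP; rewrite mulf_eq0 scaler_eq0 addnS.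
rewrite (negbTE (char0 _)) (negbTE triangle_poly_neq0) !orbF => /eqP P0 i.
by rewrite sE PE P0 mulr0.
Qed.

Lemma lf_ndvd_lprods i j k l k' l' z r r' : i != j -> k != l -> k' != l' ->
  i != k -> i != k' -> (i != l) || (j != k) -> (i != l') || (j != k') ->
  ~ mdvd (lf i j z) (lprod k l r * lprod k' l' r' : {mpoly K[3]}).
Proof.
move=> ij kl kl' ik ik' ilk ilk' /(lf_prime ij); case.
- apply: lf_ndvd_lprod => // t _ /(lf_dvd_lf ij kl)[[ikE]|[iE jE _ _]].
  + by rewrite ikE eqxx in ik.
  + by rewrite iE jE !eqxx in ilk.
- apply: lf_ndvd_lprod => // t _ /(lf_dvd_lf ij kl')[[ikE]|[iE jE _ _]].
  + by rewrite ikE eqxx in ik'.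
  + by rewrite iE jE !eqxx in ilk'.
Qed.

Lemma log_derivation_tri_syz s : deriv_along s F = 0 ->
  exists u v w, tri_syz s u v w.
Proof.
move=> sF.
have dA z : z \in 0 :: rA -> mdvd (lf B C z) (s B - z *: s C).
  move=> zr; apply: (lf_dvd_deriv BC uA zr _ (q := lprod C A (0 :: rB) * lprod A B (0 :: rC))).
    by apply: lf_ndvd_lprods; rewrite ?AB ?BC ?CA ?BA ?CB ?AC ?orbT.
  by rewrite mulrA.
have dB z : z \in 0 :: rB -> mdvd (lf C A z) (s C - z *: s A).
  move=> zr; apply: (lf_dvd_deriv CA uB zr _ (q := lprod B C (0 :: rA) * lprod A B (0 :: rC))).
    by apply: lf_ndvd_lprods; rewrite ?AB ?BC ?CA ?BA ?CB ?AC ?orbT.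
  by rewrite mulrCA mulrA.
have dC z : z \in 0 :: rC -> mdvd (lf A B z) (s A - z *: s B).
  move=> zr; apply: (lf_dvd_deriv AB uC zr _ (q := lprod B C (0 :: rA) * lprod C A (0 :: rB))).
    by apply: lf_ndvd_lprods; rewrite ?AB ?BC ?CA ?BA ?CB ?AC ?orbT.
  by rewrite mulrC.
have [P sE] : exists P, forall i, s i = 'X_i * P i.
  have [PA PAE] := dC 0 (mem_head _ _); have [PB PBE] := dA 0 (mem_head _ _).
  have [PC PCE] := dB 0 (mem_head _ _).
  exists (fun i => if i == A then PA else if i == B then PB else PC) => i.
  move: PAE PBE PCE; rewrite /lf !scale0r !subr0 => PAE PBE PCE.
  case/or3P: (ord3_triangle i) => /eqP ->; rewrite ?eqxx //.
    by rewrite eq_sym (negbTE AB).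
  by rewrite (negbTE CA) eq_sym (negbTE BC).
have n0 (r : seq K) z : uniq (0 :: r) -> z \in r -> z != 0.
  by move=> /andP[r0 _] zr; apply: contraNneq r0 => <-.
have [u uE] : mdvd fA (P C - P B).
  apply: lprod_dvd => // [|z zr]; first by case/andP: uA.
  apply: lf_dvd_diff (n0 _ _ uA zr) _ => //.
  by rewrite -!sE; apply: dA; rewrite inE zr orbT.
have [v vE] : mdvd fB (P A - P C).
  apply: lprod_dvd => // [|z zr]; first by case/andP: uB.
  apply: lf_dvd_diff (n0 _ _ uB zr) _ => //.
  by rewrite -!sE; apply: dB; rewrite inE zr orbT.
have [w wE] : mdvd fC (P B - P A).
  apply: lprod_dvd => // [|z zr]; first by case/andP: uC.
  apply: lf_dvd_diff (n0 _ _ uC zr) _ => //.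
  by rewrite -!sE; apply: dC; rewrite inE zr orbT.
by exists u, v, w, P; split=> //; rewrite uE vE wE; split; rewrite mulrC.
Qed.

(* The derivation is corrected by a multiple of the Euler field so as to kill
   [F]; this is where characteristic 0 is needed. *)
Lemma tri_syz_lift d u v w : u * fA + v * fB + w * fC = 0 ->
  dhomz (d - (size rA).+1%:Z) u -> dhomz (d - (size rB).+1%:Z) v ->
  dhomz (d - (size rC).+1%:Z) w ->
  exists s, [/\ deriv_along s F = 0, tri_syz s u v w & forall i, dhomz d (s i)].
Proof.
move=> E ud vd wd.
(* The syzygy prescribes only the differences of the [P i]; the normalization [P A = 0] fixes the
   common summand. *)
pose P i : {mpoly K[3]} := if i == A then 0 else if i == B then w * fC else w * fC + u * fA.
have PA : P A = 0 by rewrite /P eqxx.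
have PB : P B = w * fC by rewrite /P eq_sym (negbTE AB) eqxx.
have PC : P C = w * fC + u * fA by rewrite /P (negbTE CA) eq_sym (negbTE BC).
have vE : v * fB = - (w * fC + u * fA).
  by apply/eqP; rewrite -addr_eq0 -E; apply/eqP; ring.
have wfd : dhomz (d - 1) (w * fC).
  have -> : d - 1 = d - (size rC).+1%:Z + (size rC)%:Z by rewrite -[_.+1]addn1 PoszD; ring.
  by apply: dhomzM => //; apply/dhomz_homog/lprod_homog.
have ufd : dhomz (d - 1) (u * fA).
  have -> : d - 1 = d - (size rA).+1%:Z + (size rA)%:Z by rewrite -[_.+1]addn1 PoszD; ring.
  by apply: dhomzM => //; apply/dhomz_homog/lprod_homog.
have Pd i : dhomz (d - 1) (P i).
  by rewrite /P; case: ifP => _; [left|case: ifP => _ //; apply: dhomzD].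
pose s i := 'X_i * P i.
have [g gd gE] : exists2 g, dhomz (d - 1) g & deriv_along s F = F * g.
  have z_dvd i j z r m : z \in 0 :: r ->
      mdvd (lf i j z) (z *: (m * lprod i j r) : {mpoly K[3]}).
    rewrite inE => /orP[/eqP ->|/(lf_dvd_lprod i j) [k ->]].
      by rewrite scale0r; exists 0; rewrite mulr0.
    by exists (z *: (m * k)); rewrite -!mul_mpolyC; ring.
  apply: deriv_logM; first apply: deriv_logM; apply: deriv_lprod_log => z zr;
    apply: (@deriv_lf_log _ _ _ _ _ _ _ P) => //.
  - have -> : P C - P B = u * fA by rewrite PC PB; ring.
    exact: z_dvd.
  - have -> : P A - P C = v * fB by rewrite PC PA vE; ring.
    exact: z_dvd.
  - have -> : P B - P A = w * fC by rewrite PB PA; ring.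
    exact: z_dvd.
have [N NE] : exists N, deriv_along (fun k => 'X_k) F = N.+1%:R *: F.
  by rewrite euler_triangle addnS; eexists.
pose c : {mpoly K[3]} := N.+1%:R^-1 *: g.
have cN : g = N.+1%:R *: c by rewrite scalerA divff ?scale1r.
exists (fun i => 1 * s i + (- c) * 'X_i); split.
- rewrite deriv_along_comb gE NE cN -!mul_mpolyC; ring.
- exists (fun i => P i - c); split=> [i|]; first by rewrite /s; ring.
  by rewrite PA PB PC; split; [ring|rewrite vE; ring|ring].
- move=> i; rewrite mul1r; have dE : d = 1 + (d - 1) by rewrite subrKC.
  apply: dhomzD; rewrite dE; first by apply: dhomzM => //; exact/dhomz_homog/dhomog_X.
  by rewrite mulrC; apply: dhomzM; [exact/dhomz_homog/dhomog_X|apply/dhomzN/dhomzZ].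
Qed.

End TriangleSyzygies.

(** * Sections of O(k) *)

Section UnivariateRegular.
Variable K : closedFieldType.

(** Once the gcd is divided out, a root [t] of the denominator would, by the local relation
    [g h1 = g1 h], also be a root of [h1]; so the reduced denominator has no root and is
    constant. *)
Lemma dvdp_of_locally_regular (g h : {poly K}) : h != 0 ->
  (forall t, exists g1 h1 : {poly K}, h1.[t] != 0 /\ g * h1 = g1 * h) ->
  h %| g.
Proof.
move=> h0 loc; set d := gcdp g h.
have d0 : d != 0 by rewrite gcdp_eq0 negb_and h0 orbT.
have hE : h %/ d * d = h by rewrite divpK // dvdp_gcdr.
have gE : g %/ d * d = g by rewrite divpK // dvdp_gcdl.
have cop : coprimep (h %/ d) (g %/ d).
  by rewrite coprimep_sym coprimep_div_gcd // h0 orbT.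
have hd1 : size (h %/ d) == 1%N.
  apply/negPn/negP => /closed_rootP[t rt].
  have [g1 [h1 [h1t E]]] := loc t.
  have : h %/ d %| g %/ d * h1.
    apply/dvdpP; exists g1; apply: (mulIf d0).
    by rewrite -mulrA [h1 * d]mulrC mulrA gE E -mulrA hE.
  rewrite Gauss_dvdpr // => /dvdpP[q qE].
  by move: h1t; rewrite qE hornerM (rootP rt) mulr0 eqxx.
have [c c0 cE] := size_poly1P _ hd1.
by rewrite -hE cE mul_polyC dvdpZl // dvdp_gcdl.
Qed.

End UnivariateRegular.

Section LineRestriction.
Variables (n : nat) (K : closedFieldType).
Implicit Types (q : {mpoly K[n]}) (p e : 'I_n -> K).

(* Restriction of a polynomial to the line [p + t e], for a fixed and for a
   generic base point. *)
Definition line_restr p e q : {poly K} :=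
  mmap (@polyC K) (fun i => (p i)%:P + e i *: 'X) q.

HB.instance Definition _ p e := GRing.RMorphism.copy (line_restr p e)
  (mmap (@polyC K) (fun i => (p i)%:P + e i *: 'X)).

Definition gline_restr e q : {poly {mpoly K[n]}} :=
  mmap (@polyC _ \o @mpolyC n K) (fun i => ('X_i)%:P + (e i)%:MP%:P * 'X) q.

HB.instance Definition _ e := GRing.RMorphism.copy (gline_restr e)
  (mmap (@polyC _ \o @mpolyC n K) (fun i => ('X_i)%:P + (e i)%:MP%:P * 'X)).

Lemma line_restr_horner p e q t :
  (line_restr p e q).[t] = q.@[fun i => p i + t * e i].
Proof.
rewrite -[LHS]/((horner_eval t \o line_restr p e) q).
apply: mpoly_rmorph_ext => [c|i] /=.
  by rewrite mevalC /line_restr mmapC /horner_eval hornerC.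
by rewrite mevalXU /line_restr mmapX mmap1U /horner_eval hornerD hornerC hornerZ hornerX mulrC.
Qed.

Lemma gline_restr0 e q : (gline_restr e q).[0] = q.
Proof.
rewrite -[LHS]/((horner_eval 0 \o gline_restr e) q) -[RHS]/(idfun q).
apply: mpoly_rmorph_ext => [c|i] /=.
  by rewrite /gline_restr mmapC /horner_eval hornerC.
rewrite /gline_restr mmapX mmap1U /horner_eval hornerD hornerC hornerM hornerX.
by rewrite mulr0 addr0.
Qed.

Lemma map_gline_restr p e q :
  map_poly (meval p) (gline_restr e q) = line_restr p e q.
Proof.
rewrite -[LHS]/((map_poly (meval p) \o gline_restr e) q).
apply: mpoly_rmorph_ext => [c|i] /=.
  by rewrite /gline_restr /line_restr !mmapC /= map_polyC /= mevalC.
rewrite /gline_restr /line_restr !mmapX !mmap1U rmorphD rmorphM /= !map_polyC /=.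
by rewrite map_polyX mevalXU mevalC mul_polyC.
Qed.

Lemma coefM_top (R : comNzRingType) (f g : {poly R}) a b :
  (size f <= a.+1)%N -> (size g <= b.+1)%N -> (f * g)`_(a + b) = f`_a * g`_b.
Proof.
move=> sf sg; rewrite coefM.
have la : (a < (a + b).+1)%N by rewrite ltnS leq_addr.
rewrite (bigD1 (Ordinal la)) //= addKn big1 ?addr0 // => -[j jab] /=.
rewrite -val_eqE /= neq_ltn => /orP[ja|aj]; last first.
  by rewrite nth_default ?mul0r // (leq_trans sf).
rewrite [g`__]nth_default ?mulr0 // (leq_trans sg) //.
by rewrite ltn_subRL ltn_add2r.
Qed.

(** For a form [q] of degree [d], the coefficient of [t ^ d] in [q (X + t e)] is [q (e)]. A form
    with value 1 at [e] thus becomes monic in [t], and division by it is possible. *)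
Lemma gline_restr_lead e q d : q \is d.-homog ->
  (size (gline_restr e q) <= d.+1)%N /\ (gline_restr e q)`_d = (q.@[e])%:MP.
Proof.
move=> /dhomogP qd; pose T d (P : {poly {mpoly K[n]}}) c :=
  (size P <= d.+1)%N /\ P`_d = c%:MP :> {mpoly K[n]}.
have TM d1 d2 P1 P2 c1 c2 : T d1 P1 c1 -> T d2 P2 c2 -> T (d1 + d2)%N (P1 * P2) (c1 * c2).
  move=> [s1 E1] [s2 E2]; split; last by rewrite coefM_top // E1 E2 mpolyCM.
  apply: leq_trans (size_polyMleq _ _) _.
  by rewrite -subn1 leq_subLR add1n -addnS -addSn leq_add.
have T1 : T 0 1 1 by split; rewrite ?size_poly1 // coef1 mpolyC1.
have TX m : T (mdeg m) (gline_restr e 'X_[m]) (\prod_i e i ^+ m i).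
  rewrite /gline_restr mmapX mdegE /mmap1.
  have TXi i : T (m i) ((('X_i)%:P + (e i)%:MP%:P * 'X) ^+ m i) (e i ^+ m i).
    elim: (m i) => [|k IHk]; first by rewrite !expr0.
    rewrite !exprS -add1n; apply: TM => //; split.
      rewrite (leq_trans (size_polyD _ _)) // geq_max (leq_trans (size_polyC_leq1 _)) //.
      by rewrite mul_polyC (leq_trans (size_scale_leq _ _)) // size_polyX.
    by rewrite coefD coefC coefCM coefX mulr1 add0r.
  by apply: (big_rec3 T) => // i c P k _; exact: TM.
have TC c : T 0 (gline_restr e c%:MP) c.
  by rewrite /gline_restr mmapC /=; split; rewrite ?size_polyC_leq1 ?coefC.
rewrite (mpolyE q) -/(T d _ _); elim: (msupp q) qd => [_|m s IHs qd].
  by rewrite big_nil !raddf0; split; rewrite ?size_poly0 ?coef0.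
rewrite big_cons; have [IH1 IH2] := IHs (fun x xs => qd x (mem_behead (s := m :: s) xs)).
have [s1 E1] : T d (gline_restr e (q@_m *: 'X_[m])) (q@_m *: 'X_[m]).@[e].
  rewrite -(qd m (mem_head _ _)) -mul_mpolyC rmorphM mevalM mevalC mevalX.
  by apply: TM (TC _) (TX _).
have TD a b P Q : T d P a -> T d Q b -> T d (P + Q) (a + b).
  move=> [sP EP] [sQ EQ]; split; last by rewrite coefD EP EQ mpolyCD.
  by rewrite (leq_trans (size_polyD _ _)) // geq_max sP.
rewrite (rmorphD (gline_restr e)) mevalD; apply: TD; first exact: (conj s1 E1).
exact: (conj IH1 IH2).
Qed.

End LineRestriction.

Section Sections.
Variable K : closedFieldType.
Implicit Types (p q g h : {mpoly K[3]}) (k l : int) (U V : set 'rV[K]_3).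
Implicit Types (s t : 'rV[K]_3 -> K) (v w : 'rV[K]_3).

Lemma mpoly_eq0_dense h p : h != 0 ->
  (forall w, h.@[w 0] != 0 -> p.@[w 0] = 0) -> p = 0.
Proof.
move=> h0 hp; apply/eqP/negPn/negP => p0.
have [w] := mpoly_nonroot_rV (mulf_neq0 h0 p0).
by rewrite mevalM mulf_eq0 negb_or => /andP[/hp ->]; rewrite eqxx.
Qed.

Definition basic_open h : set 'rV[K]_3 := [set v : 'rV[K]_3 | v != 0 /\ h.@[v 0] != 0].

Lemma basic_open_cone (e : nat) h : h \is e.-homog -> cone_open (basic_open h).
Proof.
move=> he; exists [set h]; split; first by move=> g ->; exists e.
apply/seteqP; split=> v [v0].
  by move=> hv; split; [exact: v0|exists h].
by move=> [g -> gv].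
Qed.

Lemma cone_open_neq0 U v : cone_open U -> U v -> v != 0.
Proof. by move=> [S [_ ->]] []. Qed.

Lemma rV3_neq0 v : v != 0 -> exists i, v 0 i != 0.
Proof.
move=> v0; apply: contrapT => h; move/eqP: v0; apply; apply/rowP => i.
by rewrite mxE; apply/eqP/negPn/negP => vi; apply: h; exists i.
Qed.

Lemma cone_open_basic U v : cone_open U -> U v ->
  exists (e : nat) h, [/\ h \is e.-homog, h.@[v 0] != 0 &
    forall w, h.@[w 0] != 0 -> U w].
Proof.
move=> [S [Sh ->]] [v0 [g Sg gv]]; have [i vi] := rV3_neq0 v0.
(* The factor ['X_i] excludes the origin, where [g] need not vanish if it is constant. *)
have [d gd] := Sh g Sg; exists (d + 1)%N, (g * 'X_i); split.
- by rewrite dhomogM ?dhomog_X.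
- by rewrite mevalM mevalXU mulf_neq0.
move=> w; rewrite mevalM mevalXU mulf_eq0 negb_or => /andP[gw wi].
by split; [apply: contraNneq wi => ->; rewrite mxE|exists g].
Qed.

(* A germ of section of O(k): the quotient of two forms on the open set where
   the denominator does not vanish. *)
Definition local_quotient k U s v : Prop :=
  exists (e : nat) g h, [/\ h \is e.-homog, dhomz (e%:Z + k) g, h.@[v 0] != 0 &
    forall w, h.@[w 0] != 0 -> U w /\ s w = g.@[w 0] / h.@[w 0]].

Lemma section_OP k U s : cone_open U ->
  section_O k U s <-> (forall v, ~ U v -> s v = 0) /\
                      (forall v, U v -> local_quotient k U s v).
Proof.
move=> Uo; split=> -[s0 sl]; split=> // v Uv; have := sl v Uv.
  move=> [V [Vo Vv VU [d [e [g [h [gd he dE sE]]]]]]].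
  have [c [f [fc fv fV]]] := cone_open_basic Vo Vv.
  exists (e + c)%N, (g * f), (h * f); split.
  - exact: dhomogM.
  - have -> : (e + c)%N%:Z + k = d%:Z + c%:Z by rewrite PoszD dE; ring.
    by apply: dhomzM; exact: dhomz_homog.
  - by rewrite mevalM mulf_neq0 //; have [] := sE v Vv.
  move=> w; rewrite !mevalM mulf_eq0 negb_or => /andP[hw fw].
  split; first exact/VU/fV.
  have [_ ->] := sE w (fV w fw).
  by rewrite invfM mulrACA divff ?mulr1.
move=> [e [g [h [he gd hv sE]]]].
(* A zero numerator may come with a negative degree [e + k], while [section_O] asks for natural
   degrees; multiplying the denominator by ['X_i ^+ |k|] makes the required degree nonnegative. *)
have [g0|g0] := eqVneq g 0.
  have [i vi] := rV3_neq0 (cone_open_neq0 Uo Uv).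
  have he' : h * 'X_i ^+ `|k| \is (e + `|k|)%N.-homog.
    by rewrite dhomogM // -[X in X.-homog]mul1n dhomogMn ?dhomog_X.
  exists (basic_open (h * 'X_i ^+ `|k|)); split.
  - exact: basic_open_cone he'.
  - split; first exact: cone_open_neq0 Uv.
    by rewrite mevalM rmorphXn /= mevalXU mulf_neq0 // expf_neq0.
  - by move=> w [_]; rewrite mevalM mulf_eq0 negb_or => /andP[/sE[]].
  have : 0 <= (e + `|k|)%N%:Z + k by rewrite PoszD; lia.
  case dE : ((e + `|k|)%N%:Z + k) => [d|//] _.
  exists d, (e + `|k|)%N, 0, (h * 'X_i ^+ `|k|); split=> //; first exact: dhomog0.
  move=> w [_ hw]; split=> //; move: hw; rewrite mevalM mulf_eq0 negb_or.
  by move=> /andP[/sE[_ ->]]; rewrite g0 !meval0 !mul0r.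
case: gd => [gE|[d dE gd]]; first by rewrite gE eqxx in g0.
exists (basic_open h); split.
- exact: basic_open_cone he.
- by split=> //; exact: cone_open_neq0 Uv.
- by move=> w [_ /sE[]].
by exists d, e, g, h; split=> // w [_ hw]; split=> //; case: (sE w hw).
Qed.

Lemma section_O_zero k U s : section_O k U s -> forall v, ~ U v -> s v = 0.
Proof. by case. Qed.

Lemma section_O0 k U : cone_open U -> section_O k U (fun=> 0).
Proof.
move=> Uo; apply/section_OP => //; split=> // v Uv.
have [e [h [he hv hU]]] := cone_open_basic Uo Uv.
exists e, 0, h; split=> //; first exact: dhomz0.
by move=> w /hU; rewrite meval0 mul0r.
Qed.

Lemma section_OM k l U s t : cone_open U -> section_O k U s -> section_O l U t ->
  section_O (k + l) U (fun v => s v * t v).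
Proof.
move=> Uo /section_OP -/(_ Uo)[s0 sl] /section_OP -/(_ Uo)[t0 tl].
apply/section_OP => //; split=> [v Uv|v Uv]; first by rewrite s0 // mul0r.
have [e [g [h [he ge hv sE]]]] := sl v Uv.
have [e' [g' [h' [he' ge' hv' tE]]]] := tl v Uv.
exists (e + e')%N, (g * g'), (h * h'); split.
- exact: dhomogM.
- have -> : (e + e')%N%:Z + (k + l) = (e%:Z + k) + (e'%:Z + l) by rewrite PoszD; ring.
  exact: dhomzM.
- by rewrite mevalM mulf_neq0.
move=> w; rewrite !mevalM mulf_eq0 negb_or => /andP[/sE[Uw ->] /tE[_ ->]].
by split=> //; rewrite invfM mulrACA.
Qed.

Lemma section_OD k U s t : cone_open U -> section_O k U s -> section_O k U t ->
  section_O k U (fun v => s v + t v).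
Proof.
move=> Uo /section_OP -/(_ Uo)[s0 sl] /section_OP -/(_ Uo)[t0 tl].
apply/section_OP => //; split=> [v Uv|v Uv]; first by rewrite s0 // t0 // addr0.
have [e [g [h [he ge hv sE]]]] := sl v Uv.
have [e' [g' [h' [he' ge' hv' tE]]]] := tl v Uv.
exists (e + e')%N, (g * h' + g' * h), (h * h'); split.
- exact: dhomogM.
- apply: dhomzD.
    have -> : (e + e')%N%:Z + k = (e%:Z + k) + e'%:Z by rewrite PoszD; ring.
    by apply: dhomzM => //; exact: dhomz_homog.
  have -> : (e + e')%N%:Z + k = (e'%:Z + k) + e%:Z by rewrite PoszD; ring.
  by apply: dhomzM => //; exact: dhomz_homog.
- by rewrite mevalM mulf_neq0.
move=> w; rewrite !mevalM mulf_eq0 negb_or => /andP[hw hw'].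
have [Uw ->] := sE w hw; have [_ ->] := tE w hw'.
by split=> //; rewrite mevalD !mevalM addf_div.
Qed.

Lemma section_O_restr k U V s : cone_open U -> cone_open V -> V `<=` U ->
  section_O k U s -> section_O k V (patch (fun=> 0) V s).
Proof.
move=> Uo Vo VU /section_OP -/(_ Uo)[s0 sl]; apply/section_OP => //.
split=> [v Vv|v Vv]; first by rewrite /patch memNset.
have [e [g [h [he ge hv sE]]]] := sl v (VU v Vv).
have [e' [f [fe fv fV]]] := cone_open_basic Vo Vv.
exists (e + e')%N, (g * f), (h * f); split.
- exact: dhomogM.
- have -> : (e + e')%N%:Z + k = (e%:Z + k) + e'%:Z by rewrite PoszD; ring.
  by apply: dhomzM => //; exact: dhomz_homog.
- by rewrite mevalM mulf_neq0.
move=> w; rewrite !mevalM mulf_eq0 negb_or => /andP[hw fw].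
have Vw := fV w fw; split=> //; rewrite /patch mem_set //.
by have [_ ->] := sE w hw; rewrite invfM mulrACA divff ?mulr1.
Qed.

(* A section that is regular on all of P^2 is a form: restricted to a line
   that avoids the origin, a regular fraction [g / h] is a polynomial, so [h],
   once it is monic along some direction, divides [g]. *)
Lemma section_O_global k s : section_O k (basic_open 1) s ->
  exists t : {mpoly K[3]}, dhomz k t /\ forall v, v != 0 -> s v = t.@[v 0].
Proof.
have Do : cone_open (basic_open 1) by apply: (basic_open_cone (e := 0)); exact: dhomog1.
have D1 v : v != 0 -> basic_open 1 v by move=> v0; split; rewrite ?meval1 ?oner_neq0.
move=> /section_OP -/(_ Do)[_ sl].
pose e : 'rV[K]_3 := delta_mx 0 0.
have e0 : e != 0.
  by apply/eqP => /matrixP/(_ 0 0)/eqP; rewrite !mxE !eqxx oner_eq0.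
have [m [g [h [he ge hv sE]]]] : exists (m : nat) g h, [/\ h \is m.-homog,
    dhomz (m%:Z + k) g, h.@[e 0] = 1 &
    forall w, h.@[w 0] != 0 -> s w = g.@[w 0] / h.@[w 0]].
  have [m [g [h [he ge hv sE]]]] := sl e (D1 e e0).
  exists m, (h.@[e 0]^-1 *: g), (h.@[e 0]^-1 *: h); split.
  - by rewrite dhomogZ.
  - exact: dhomzZ.
  - by rewrite mevalZ mulVf.
  move=> w; rewrite !mevalZ mulf_eq0 negb_or => /andP[_ /sE[_ ->]].
  by rewrite -mulf_div divff ?mul1r ?invr_neq0.
have h0 : h != 0 by apply: contra_eq_neq hv => ->; rewrite meval0 eq_sym oner_neq0.
(* Two local fractions agree wherever both denominators are nonzero, a dense set, so they agree as
   fractions of polynomials. *)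
have cross v : v != 0 -> exists (e1 : nat) g1 h1,
    [/\ h1.@[v 0] != 0, s v = g1.@[v 0] / h1.@[v 0] & g * h1 = g1 * h].
  move=> v0; have [e1 [g1 [h1 [he1 ge1 hv1 sE1]]]] := sl v (D1 v v0).
  exists e1, g1, h1; split=> //; first by have [] := sE1 v hv1.
  have hh1 : h * h1 != 0.
    by rewrite mulf_neq0 //; apply: contraNneq hv1 => ->; rewrite meval0.
  apply/eqP; rewrite -subr_eq0; apply/eqP; apply: (mpoly_eq0_dense hh1) => w.
  rewrite mevalM mulf_eq0 negb_or => /andP[hw h1w].
  have := sE w hw; have [_ ->] := sE1 w h1w => /eqP.
  rewrite eqr_div // => /eqP E.
  by rewrite mevalB !mevalM E subrr.
pose G := gline_restr (e 0) g; pose H := gline_restr (e 0) h.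
have Hm : H \is monic.
  have [sH lH] := gline_restr_lead (e 0) he.
  rewrite monicE lead_coefE; suff -> : size H = m.+1 by rewrite lH hv mpolyC1.
  apply/eqP; rewrite eqn_leq sH ltnNge; apply/negP => /leq_sizeP/(_ _ (leqnn _)).
  by rewrite lH hv mpolyC1 => /eqP; rewrite oner_eq0.
have Gp (p : 'rV[K]_3) : map_poly (meval (p 0)) G = line_restr (p 0) (e 0) g.
  exact: map_gline_restr.
have Hp (p : 'rV[K]_3) : map_poly (meval (p 0)) H = line_restr (p 0) (e 0) h.
  exact: map_gline_restr.
have G0 : G.[0] = g by exact: gline_restr0.
have H0 : H.[0] = h by exact: gline_restr0.
clearbody G H.
pose Q := Pdiv.CommonRing.rdivp G H; pose R := Pdiv.CommonRing.rmodp G H.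
have GE : G = Q * H + R by exact: Pdiv.RingMonic.rdivp_eq.
(* The coefficients of the remainder are tested at base points [p] whose coordinate 1 is nonzero: as
   [e] points along coordinate 0, the line [p + t e] then misses the origin, and [s] is a local
   fraction all along it. *)
have R0 : R = 0.
  have M0 : 'X_1 != 0 :> {mpoly K[3]}.
    apply/eqP => /mpolyP/(_ U_(1)%MM); rewrite mcoeffXU eqxx mcoeff0 => /eqP.
    by rewrite oner_eq0.
  apply/polyP => i; rewrite coef0; apply: (mpoly_eq0_dense M0) => p.
  rewrite mevalXU => p1.
  have Hpm : map_poly (meval (p 0)) H \is monic by exact: monic_map.
  have dvd : map_poly (meval (p 0)) H %| map_poly (meval (p 0)) G.
    apply: dvdp_of_locally_regular; first exact: monic_neq0.
    move=> t; pose v := p + t *: e.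
    have v0 : v != 0.
      apply: contraNneq p1 => /rowP/(_ 1); rewrite !mxE /= mulr0 addr0.
      by move=> ->.
    have [e1 [g1 [h1 [h1v _ E]]]] := cross v v0.
    exists (line_restr (p 0) (e 0) g1), (line_restr (p 0) (e 0) h1); split.
      rewrite line_restr_horner (meval_eq (v2 := v 0)) // => j.
      by rewrite !mxE.
    rewrite Hp Gp.
    have M := rmorphM (line_restr (p 0) (e 0)).
    by rewrite -(M g h1) -(M g1 h) E.
  have : map_poly (meval (p 0)) R = 0.
    have : map_poly (meval (p 0)) H %| map_poly (meval (p 0)) R.
      by move: dvd; rewrite GE rmorphD rmorphM /= dvdp_addr // dvdp_mull.
    move=> /(dvdp_leq _) le; apply/eqP/negPn/negP => /le.
    apply/negP; rewrite -ltnNge; apply: (leq_ltn_trans (size_poly _ _)).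
    rewrite [X in (_ < X)%N]size_map_poly_id0 ?(monicP Hm) ?meval1 ?oner_neq0 //.
    exact: Pdiv.Ring.ltn_rmodpN0 (monic_neq0 Hm).
  by move=> /polyP/(_ i); rewrite coef_map coef0.
(* At parameter 0 the generic line is at its base point, so [G = Q * H] specializes to
   [g = t * h]. *)
pose t := Q.[0].
have gE : g = t * h.
  by rewrite -G0 GE R0 addr0 hornerM H0.
exists t; split.
  have -> : k = m%:Z + k - m%:Z by ring.
  by apply: (dhomz_divr h0) => //; [exact: dhomz_homog|rewrite -gE].
move=> v v0; have [e1 [g1 [h1 [h1v -> E]]]] := cross v v0.
have -> : g1 = t * h1.
  by apply: (mulIf h0); rewrite -E gE; ring.
by rewrite mevalM mulfK.
Qed.

End Sections.

(** * Isomorphisms of sheaves and bases of derivations *)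

Section SheafMorphisms.
Variable K : closedFieldType.
Implicit Types (U V : set 'rV[K]_3) (h p q f : {mpoly K[3]}).

Definition module_sheaf m (F : fsheaf K m) : Prop :=
  [/\ forall U, cone_open U -> F U (fun=> 0),
      forall U, cone_open U -> forall (r : 'rV[K]_3 -> K) s t,
        section_O 0 U r -> F U s -> F U t -> F U (fun v => r v *: s v + t v) &
      forall U V, cone_open U -> cone_open V -> V `<=` U ->
        forall s, F U s -> F V (patch (fun=> 0) V s)].

Definition sheaf_hom m n (F : fsheaf K m) (G : fsheaf K n) phi : Prop :=
  [/\ forall U, cone_open U -> forall s, F U s -> G U (phi U s),
      forall U, cone_open U -> forall (r : 'rV[K]_3 -> K) s t,
        section_O 0 U r -> F U s -> F U t ->
        phi U (fun v => r v *: s v + t v) =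
        (fun v => r v *: phi U s v + phi U t v) &
      forall U V, cone_open U -> cone_open V -> V `<=` U -> forall s, F U s ->
        phi V (patch (fun=> 0) V s) = patch (fun=> 0) V (phi U s)].

Lemma sum_O_module m (k : 'I_m -> int) : module_sheaf (sum_O k).
Proof.
split=> [U Uo i|U Uo r s t hr hs ht i|U V Uo Vo VU s hs i] /=.
- rewrite (_ : (fun v => _) = fun=> 0); first exact: section_O0.
  by apply/funext => v; rewrite mxE.
- rewrite (_ : (fun v => _) = fun v => r v * s v 0 i + t v 0 i).
    apply: section_OD => //; rewrite -[k i]add0r.
    exact: section_OM.
  by apply/funext => v; rewrite !mxE.
- rewrite (_ : (fun v => _) = patch (fun=> 0) V (fun v => s v 0 i)).
    exact: section_O_restr (hs i).
  by apply/funext => v; rewrite /patch; case: ifP => // _; rewrite mxE.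
Qed.

Lemma T_sheaf_module f : module_sheaf (T_sheaf f).
Proof.
have [M0 MD MR] := sum_O_module (fun _ : 'I_3 => 0).
split=> [U Uo|U Uo r s t hr [hs es] [ht et]|U V Uo Vo VU s [hs es]] /=.
- split; first exact: M0.
  by move=> v _; apply: big1 => i _; rewrite mxE mul0r.
- split; first exact: MD.
  move=> v Uv; rewrite (eq_bigr (fun i => r v * (s v 0 i * (f^`M(i)).@[v 0]) +
      t v 0 i * (f^`M(i)).@[v 0])); last by move=> i _; rewrite !mxE mulrDl mulrA.
  by rewrite big_split -mulr_sumr /= es // et // mulr0 addr0.
- split; first exact: MR hs.
  by move=> v Vv; rewrite /patch mem_set // es //; exact: VU.
Qed.

(** The inverse bijections are chosen set by set; linearity and compatibility with restrictions
    follow from the injectivity of [phi], because [F] is closed under these operations. *)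
Lemma sheaf_iso_hom m n (F : fsheaf K m) (G : fsheaf K n) :
  module_sheaf F -> sheaf_iso F G ->
  exists phi psi, [/\ sheaf_hom F G phi, sheaf_hom G F psi,
    forall U, cone_open U -> forall s, F U s -> psi U (phi U s) = s &
    forall U, cone_open U -> forall t, G U t -> phi U (psi U t) = t].
Proof.
move=> [_ FD FR] [phi [bij [lin nat]]].
have homo U s : cone_open U -> F U s -> G U (phi U s).
  by move=> Uo Fs; have [h _ _] := bij U Uo; exact: h.
have inj U s t : cone_open U -> F U s -> F U t -> phi U s = phi U t -> s = t.
  by move=> Uo Fs Ft; have [_ h _] := bij U Uo; apply: h; exact/mem_set.
have [psi psiP] : exists psi, forall U t, cone_open U -> G U t ->
    F U (psi U t) /\ phi U (psi U t) = t.
  have /choice[f fP] : forall Ut, exists s, cone_open Ut.1 -> G Ut.1 Ut.2 ->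
      F Ut.1 s /\ phi Ut.1 s = Ut.2.
    move=> [U t] /=.
    have [[Uo Gt]|no] := EM (cone_open U /\ G U t).
      have [_ _ h] := bij U Uo; have [s Fs <-] := h t Gt.
      by exists s.
    by exists (fun=> 0) => Uo Gt; case: no.
  by exists (fun U t => f (U, t)) => U t; exact: (fP (U, t)).
exists phi, psi; split.
- split=> // U Uo s; exact: homo.
- split=> [U Uo t Gt|U Uo r s t hr Gs Gt|U V Uo Vo VU s Gs].
  + by have [] := psiP U t Uo Gt.
  + have [Fs sE] := psiP U s Uo Gs; have [Ft tE] := psiP U t Uo Gt.
    have Frs := FD U Uo r _ _ hr Fs Ft.
    have E := lin U Uo r _ _ hr Fs Ft; rewrite sE tE in E.
    have G' : G U (fun v => r v *: s v + t v) by rewrite -E; exact: homo.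
    have [F' E'] := psiP U _ Uo G'.
    by apply: (inj U) => //; rewrite E'.
  + have [Fs sE] := psiP U s Uo Gs.
    have E := nat U V Uo Vo VU _ Fs; rewrite sE in E.
    have Fr := FR U V Uo Vo VU _ Fs.
    have G' : G V (patch (fun=> 0) V s) by rewrite -E; exact: homo.
    have [F' E'] := psiP V _ Vo G'.
    by apply: (inj V) => //; rewrite E'.
- move=> U Uo s Fs; have Gs := homo U s Uo Fs.
  by have [F' E'] := psiP U _ Uo Gs; apply: (inj U).
- by move=> U Uo t Gt; have [] := psiP U t Uo Gt.
Qed.

Lemma sheaf_iso_sym m n (F : fsheaf K m) (G : fsheaf K n) :
  module_sheaf F -> sheaf_iso F G -> sheaf_iso G F.
Proof.
move=> Fm /(sheaf_iso_hom Fm)[phi [psi [[h1 _ _] [h2 l2 n2] K1 K2]]].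
exists psi; split; [|by split].
move=> U Uo; split.
- by move=> t Gt; exact: h2.
- move=> s t /set_mem Gs /set_mem Gt E.
  by rewrite -(K2 U Uo s) // E K2.
- move=> s Fs; exists (phi U s); first exact: h1.
  exact: K1.
Qed.

Lemma dhomz_prod (I : finType) (e : I -> int) (F : I -> {mpoly K[3]}) (P : pred I) :
  (forall i, dhomz (e i) (F i)) -> dhomz (\sum_(i | P i) e i) (\prod_(i | P i) F i).
Proof.
move=> h; apply: (big_rec2 (fun x y => dhomz x y)).
  by right; exists 0%N => //; exact: dhomog1.
by move=> i x y _ hy; exact: dhomzM.
Qed.

Lemma sum_O_local m (k : 'I_m -> int) U s v : cone_open U -> sum_O k U s -> U v ->
  exists (e : nat) h (g : 'I_m -> {mpoly K[3]}), [/\ h \is e.-homog,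
    forall i, dhomz (e%:Z + k i) (g i), h.@[v 0] != 0 &
    forall w : 'rV[K]_3, h.@[w 0] != 0 -> U w /\ forall i, s w 0 i = (g i).@[w 0] / h.@[w 0]].
Proof.
move=> Uo hs Uv.
have [c [f [fc fv fU]]] := cone_open_basic Uo Uv.
have /choice[x xP] : forall i, exists x : nat * {mpoly K[3]} * {mpoly K[3]},
    [/\ x.2 \is (x.1.1).-homog, dhomz (x.1.1%:Z + k i) x.1.2, x.2.@[v 0] != 0 &
     forall w : 'rV[K]_3, x.2.@[w 0] != 0 -> U w /\ s w 0 i = x.1.2.@[w 0] / x.2.@[w 0]].
  move=> i; have /section_OP -/(_ Uo)[_ /(_ v Uv)] := hs i.
  by move=> [e [g [h [h1 h2 h3 h4]]]]; exists (e, g, h).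
pose E i := (x i).1.1; pose G i := (x i).1.2; pose H i := (x i).2.
pose P := \prod_i H i.
have Hd i : dhomz (E i)%:Z (H i) by apply: dhomz_homog; have [] := xP i.
have HPd : dhomz (\sum_i E i)%N%:Z P.
  by rewrite (big_morph Posz PoszD (erefl _)); exact: dhomz_prod.
exists (c + \sum_i E i)%N, (f * P), (fun i => f * (G i * \prod_(j | j != i) H j)).
split.
- by apply: dhomogM => //; exact: homog_dhomz.
- move=> i; rewrite PoszD -addrA; apply: dhomzM; first exact: dhomz_homog.
  rewrite (big_morph Posz PoszD (erefl _)) (bigD1 i) //= addrAC.
  by apply: dhomzM; [have [] := xP i|exact: dhomz_prod].
- rewrite mevalM mulf_neq0 // rmorph_prod /=; apply/prodf_neq0 => i _.
  by have [] := xP i.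
move=> w; rewrite mevalM mulf_eq0 negb_or => /andP[fw Pw]; split; first exact: fU.
move=> i; move: Pw; rewrite /P (bigD1 i) //= mevalM mulf_eq0 negb_or => /andP[Hw Pw].
have [_ _ _ /(_ w Hw)[_ ->]] := xP i.
rewrite !mevalM -mulf_div divff // mul1r -mulf_div divff ?mulr1 //.
Qed.

(** Locally a section is a quotient of a polynomial derivation by a form; the pointwise equation
    holds on a dense set, so this derivation kills [f] identically. *)
Lemma T_sheaf_local f U s v : cone_open U -> T_sheaf f U s -> U v ->
  exists (e : nat) h (g : 'I_3 -> {mpoly K[3]}), [/\ h \is e.-homog,
    forall i, dhomz e%:Z (g i), h.@[v 0] != 0,
    forall w : 'rV[K]_3, h.@[w 0] != 0 -> U w /\ forall i, s w 0 i = (g i).@[w 0] / h.@[w 0] &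
    deriv_along g f = 0].
Proof.
move=> Uo [hs es] Uv.
have [e [h [g [he gd hv sE]]]] := sum_O_local Uo hs Uv.
exists e, h, g; split=> //; first by move=> i; rewrite -[e%:Z]addr0.
have h0 : h != 0 by apply: contraNneq hv => ->; rewrite meval0.
apply: (mpoly_eq0_dense h0) => w hw; have [Uw sw] := sE w hw.
apply: (mulIf (invr_neq0 hw)); rewrite mul0r -[RHS](es w Uw) rmorph_sum mulr_suml.
by apply: eq_bigr => i _; rewrite /= mevalM sw mulrAC.
Qed.

Lemma section_O_mpoly k l U s p : cone_open U -> section_O k U s -> dhomz l p ->
  section_O (k + l) U (fun v => s v * p.@[v 0]).
Proof.
move=> Uo /section_OP -/(_ Uo)[s0 sl] pl; apply/section_OP => //.
split=> [v Uv|v Uv]; first by rewrite s0 // mul0r.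
have [e [g [h [he ge hv sE]]]] := sl v Uv.
exists e, (g * p), h; split=> //; first by rewrite addrA; exact: dhomzM.
by move=> w /sE[Uw ->]; rewrite mevalM mulrAC.
Qed.

End SheafMorphisms.

Lemma ord2P (i : 'I_2) : i = 0 \/ i = 1.
Proof. by case: i => [[|[|//]] ?]; [left|right]; apply/val_inj. Qed.

(** * From a basis of derivations to a splitting of the sheaf *)

Section FreeOfBasis.
Variables (K : closedFieldType) (f : {mpoly K[3]}) (alpha beta : int).
Variables (t1 t2 : 'I_3 -> {mpoly K[3]}).
Hypotheses (t1d : forall i, dhomz alpha (t1 i)) (t2d : forall i, dhomz beta (t2 i)).
Hypotheses (t1f : deriv_along t1 f = 0) (t2f : deriv_along t2 f = 0).
Hypothesis gen : forall s, deriv_along s f = 0 ->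
  exists k l : {mpoly K[3]}, forall i, s i = k * t1 i + l * t2 i.
Hypothesis indep : forall k l : {mpoly K[3]},
  (forall i, k * t1 i + l * t2 i = 0) -> k = 0 /\ l = 0.

Let expo (i : 'I_2) : int := if i == 0 then - alpha else - beta.

Let G := sum_O (K := K) expo.
Let F := T_sheaf f.

Let psi (U : set 'rV[K]_3) (t : 'rV[K]_3 -> 'rV[K]_2) (v : 'rV[K]_3) : 'rV[K]_3 :=
  \row_i (t v 0 0 * (t1 i).@[v 0] + t v 0 1 * (t2 i).@[v 0]).

Let gen_dhomz d s : deriv_along s f = 0 -> (forall i, dhomz d (s i)) ->
  exists k l : {mpoly K[3]}, [/\ dhomz (d - alpha) k, dhomz (d - beta) l &
    forall i, s i = k * t1 i + l * t2 i].
Proof.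
move=> /gen[k [l kl]] sd; exists (piz (d - alpha) k), (piz (d - beta) l).
split=> [||i]; try exact: piz_dhomz.
by rewrite -(piz_id (sd i)) kl pizD (pizM _ _ (t1d i)) (pizM _ _ (t2d i)).
Qed.

(** Independence of [t1] and [t2] makes the local coordinates of a section well defined as
    fractions; injectivity and gluing both rest on this. *)
Let local_unique (h k l h' k' l' : {mpoly K[3]}) : h != 0 -> h' != 0 ->
  (forall w : 'rV[K]_3, h.@[w 0] != 0 -> h'.@[w 0] != 0 -> forall i,
     (k * t1 i + l * t2 i).@[w 0] / h.@[w 0] =
     (k' * t1 i + l' * t2 i).@[w 0] / h'.@[w 0]) ->
  k * h' = k' * h /\ l * h' = l' * h.
Proof.
move=> h0 h'0 E.
suff /indep[/subr0_eq -> /subr0_eq ->] : forall i,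
  (k * h' - k' * h) * t1 i + (l * h' - l' * h) * t2 i = 0 by [].
move=> i; apply: (mpoly_eq0_dense (mulf_neq0 h0 h'0)) => w.
rewrite mevalM mulf_eq0 negb_or => /andP[hw h'w].
have /eqP := E w hw h'w i; rewrite eqr_div // => /eqP Ei.
transitivity ((k * t1 i + l * t2 i).@[w 0] * h'.@[w 0] -
              (k' * t1 i + l' * t2 i).@[w 0] * h.@[w 0]).
  by rewrite -!mevalM -mevalB; congr (_.@[_]); ring.
by rewrite Ei subrr.
Qed.

Let psi_homo U t : cone_open U -> G U t -> F U (psi U t).
Proof.
move=> Uo Gt; split=> [i|v Uv] /=.
  rewrite (_ : (fun v => _) = fun v => t v 0 0 * (t1 i).@[v 0] + t v 0 1 * (t2 i).@[v 0]).
    have h0 := Gt 0; have h1 := Gt 1.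
    apply: section_OD => //.
      by rewrite -[0](addNr alpha); apply: section_O_mpoly.
    by rewrite -[0](addNr beta); apply: section_O_mpoly.
  by apply/funext => v; rewrite mxE.
have E (s : 'I_3 -> {mpoly K[3]}) : deriv_along s f = 0 ->
    \sum_i (s i).@[v 0] * (f^`M(i)).@[v 0] = 0.
  move=> /(congr1 (meval (v 0))); rewrite meval0 rmorph_sum /= => {2}<-.
  by apply: eq_bigr => i _; rewrite mevalM.
rewrite (eq_bigr (fun i => t v 0 0 * ((t1 i).@[v 0] * (f^`M(i)).@[v 0]) +
   t v 0 1 * ((t2 i).@[v 0] * (f^`M(i)).@[v 0]))).
  by rewrite big_split -!mulr_sumr /= !E // !mulr0 addr0.
by move=> i _; rewrite mxE mulrDl !mulrA.
Qed.

Let psi_inj U s t : cone_open U -> G U s -> G U t -> psi U s = psi U t -> s = t.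
Proof.
move=> Uo Gs Gt E; apply/funext => v; apply/rowP.
have [Uv|nUv] := EM (U v); last first.
  by move=> i; rewrite (section_O_zero (Gs i)) // (section_O_zero (Gt i)).
have [e [h [g [he gd hv sE]]]] := sum_O_local Uo Gs Uv.
have [e' [h' [g' [he' gd' hv' tE]]]] := sum_O_local Uo Gt Uv.
have h0 : h != 0 by apply: contraNneq hv => ->; rewrite meval0.
have h'0 : h' != 0 by apply: contraNneq hv' => ->; rewrite meval0.
have [] := local_unique (k := g 0) (l := g 1) (k' := g' 0) (l' := g' 1) h0 h'0.
  move=> w hw h'w i; have := congr1 (fun x : 'rV[K]_3 -> 'rV[K]_3 => x w 0 i) E; rewrite !mxE.
  have [_ sw] := sE w hw; have [_ tw] := tE w h'w.
  by rewrite !sw !tw !mevalD !mevalM !mulrDl ![_ / _ * _]mulrAC.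
move=> E0 E1 i; have [_ ->] := sE v hv; have [_ ->] := tE v hv'.
apply/eqP; rewrite eqr_div // -!mevalM.
by case: (ord2P i) => ->; rewrite ?E0 ?E1.
Qed.

Let psi_surj U s : cone_open U -> F U s -> exists2 t, G U t & psi U t = s.
Proof.
move=> Uo Fs.
pose good (v : 'rV[K]_3) (x : nat * {mpoly K[3]} * {mpoly K[3]} * {mpoly K[3]}) :=
  let: (e, h, k, l) := x in
  [/\ h \is e.-homog, dhomz (e%:Z - alpha) k, dhomz (e%:Z - beta) l,
      h.@[v 0] != 0 & forall w : 'rV[K]_3, h.@[w 0] != 0 -> U w /\
        forall i, s w 0 i = (k * t1 i + l * t2 i).@[w 0] / h.@[w 0]].
have /choice[x xP] : forall v, exists x, U v -> good v x.
  move=> v; have [Uv|nUv] := EM (U v); last by exists (0%N, 0, 0, 0).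
  have [e [h [g [he gd hv sE gf]]]] := T_sheaf_local Uo Fs Uv.
  have [k [l [kd ld gE]]] := gen_dhomz gf gd.
  exists (e, h, k, l) => _; split=> // w hw.
  by have [Uw sw] := sE w hw; split=> // i; rewrite sw gE.
(* The value at [v] is read off from the fraction chosen at [v] itself; by [local_unique] any other
   fraction regular at [v] gives the same value, so [t] is locally a single fraction. *)
pose t (v : 'rV[K]_3) : 'rV[K]_2 := if pselect (U v) then
  let: (e, h, k, l) := x v in
  \row_i ((if i == 0 then k else l).@[v 0] / h.@[v 0]) else 0.
have tE v e h k l (w : 'rV[K]_3) : U v -> good v (e, h, k, l) -> h.@[w 0] != 0 -> 
    U w /\ forall i : 'I_2, t w 0 i = (if i == 0 then k else l).@[w 0] / h.@[w 0].
  move=> Uv [_ _ _ hv sE] hw; have [Uw sw] := sE w hw; split=> // i.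
  rewrite /t; case: pselect => // Uw'; have := xP w Uw.
  case: (x w) => [[[e' h'] k'] l'] [_ _ _ hw' sE'].
  have h0 : h != 0 by apply: contraNneq hv => ->; rewrite meval0.
  have h'0 : h' != 0 by apply: contraNneq hw' => ->; rewrite meval0.
  have [|E0 E1] := local_unique (k := k) (l := l) (k' := k') (l' := l') h0 h'0.
    move=> y hy h'y j; have [_ <-] := sE y hy.
    by have [_ <-] := sE' y h'y.
  rewrite mxE; apply/eqP; rewrite eqr_div // -!mevalM.
  by case: ifP => _; rewrite ?E0 ?E1.
have goodP v : U v -> exists e h k l, good v (e, h, k, l).
  move=> Uv; move: (x v) (xP v Uv) => [[[e h] k] l] gd.
  by exists e, h, k, l.
exists t.
  move=> i; apply/section_OP => //; split=> [v nUv|v Uv].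
    by rewrite /t; case: pselect => [//|nU]; rewrite mxE.
  have [e [h [k [l gd]]]] := goodP v Uv.
  have [he kd ld hv _] := gd.
  exists e, (if i == 0 then k else l), h; split=> //.
    by rewrite /expo; case: ifP.
  by move=> w hw; have [Uw ->] := tE v e h k l w Uv gd hw.
apply/funext => v; apply/rowP => i; rewrite mxE.
have [Uv|nUv] := EM (U v); last first.
  have [/(_ i) si _] := Fs; rewrite (section_O_zero si) //.
  by rewrite /t; case: pselect => [//|nU]; rewrite !mxE !mul0r addr0.
have [e [h [k [l gd]]]] := goodP v Uv.
have [_ _ _ hv sE] := gd; have [_ ->] := sE v hv.
have [_ tv] := tE v e h k l v Uv gd hv; rewrite !tv /=.
by rewrite mevalD !mevalM mulrDl ![_ / _ * _]mulrAC.
Qed.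

Lemma free_of_basis : free_with_exponents (T_sheaf f) alpha beta.
Proof.
(* The explicit map [psi] goes from the split sheaf to [T_sheaf f], opposite to the required
   direction. *)
rewrite /free_with_exponents; apply: sheaf_iso_sym.
  exact: sum_O_module.
exists psi; split; last split.
- move=> U Uo; split=> [t Gt|s t /set_mem Gs /set_mem Gt|s Fs].
  + exact: psi_homo.
  + exact: psi_inj.
  + by have [t Gt tE] := psi_surj Uo Fs; exists t.
- move=> U Uo r s t _ _ _; apply/funext => v; apply/rowP => i.
  rewrite !mxE; ring.
- move=> U V Uo Vo VU s Gs; apply/funext => v; apply/rowP => i.
  by rewrite /psi /patch /=; case: ifP => // _; rewrite !mxE !mul0r addr0.
Qed.

End FreeOfBasis.

(** * From a splitting of the sheaf to a basis of derivations *)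

Section TwistedSections.
Variable K : closedFieldType.
Implicit Types (U V : set 'rV[K]_3) (h p q f : {mpoly K[3]}) (d : int).

Lemma section_O1 U : cone_open U -> section_O 0 U (patch (fun=> 0) U (fun=> 1 : K)).
Proof.
move=> Uo; apply/section_OP => //; split=> v Uv; first by rewrite /patch memNset.
have [e [h [he hv hU]]] := cone_open_basic Uo Uv.
exists e, h, h; split=> //; first by rewrite addr0; exact: dhomz_homog.
by move=> w hw; have Uw := hU w hw; rewrite /patch mem_set // divff.
Qed.

Lemma sheaf_hom0 m n (F : fsheaf K m) (G : fsheaf K n) phi U :
  module_sheaf F -> sheaf_hom F G phi -> cone_open U ->
  forall v, U v -> phi U (fun=> 0) v = 0.
Proof.
move=> [F0 _ _] [_ lin _] Uo v Uv.
have := lin U Uo _ _ _ (section_O1 Uo) (F0 U Uo) (F0 U Uo).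
move=> /(congr1 (fun x : 'rV[K]_3 -> 'rV[K]_n => x v)).
rewrite (_ : (fun w => patch (fun=> 0) U (fun=> 1 : K) w *: 0 + 0) = fun=> 0 : 'rV[K]_m); last first.
  by apply/funext => w; rewrite scaler0 addr0.
rewrite /patch mem_set // scale1r => /eqP.
by rewrite -subr_eq0 opprD addrA subrr sub0r oppr_eq0 => /eqP.
Qed.

Definition coord_open i : set 'rV[K]_3 := basic_open 'X_i.

Lemma coord_openE i (v : 'rV[K]_3) : coord_open i v <-> v 0 i != 0.
Proof.
split; first by move=> [_]; rewrite mevalXU.
move=> vi; split; last by rewrite mevalXU.
by apply: contraNneq vi => ->; rewrite mxE.
Qed.

Lemma coord_open_cone i : cone_open (coord_open i).
Proof. exact: basic_open_cone (dhomog_X _ i). Qed.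
Local Hint Resolve coord_open_cone : core.

Definition coord_pow i d (v : 'rV[K]_3) : K := if v 0 i != 0 then v 0 i ^ d else 0.

Lemma section_coord_pow i d : section_O d (coord_open i) (coord_pow i d).
Proof.
apply/section_OP => //; split=> v.
  by move=> nv; rewrite /coord_pow; case: ifP => // vi; case: nv; exact/coord_openE.
move=> /coord_openE vi; case: d => d.
  exists 1%N, ('X_i ^+ d.+1), 'X_i; split.
  - exact: dhomog_X.
  - by rewrite -PoszD add1n; apply: dhomz_homog; rewrite -[X in X.-homog]mul1n dhomogMn ?dhomog_X.
  - by rewrite mevalXU.
  move=> w; rewrite mevalXU => wi; split; first exact/coord_openE.
  by rewrite /coord_pow wi rmorphXn /= mevalXU exprS mulrAC divff ?mul1r.
exists d.+1, 1, ('X_i ^+ d.+1); split.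
- by rewrite -[X in X.-homog]mul1n dhomogMn ?dhomog_X.
- by rewrite NegzE subrr; apply: dhomz_homog; exact: dhomog1.
- by rewrite rmorphXn /= mevalXU expf_neq0.
move=> w; rewrite rmorphXn /= mevalXU meval1 expf_eq0 /= => wi.
by split; [exact/coord_openE|rewrite /coord_pow wi NegzE -exprnN div1r].
Qed.

(* The section [s / x_i^d] over the open set [x_i != 0]. *)
Definition coord_twist m i d (s : 'I_m -> {mpoly K[3]}) (v : 'rV[K]_3) : 'rV[K]_m :=
  coord_pow i (- d) v *: \row_j (s j).@[v 0].

Lemma coord_twist_sum_O m (k : 'I_m -> int) i d (s : 'I_m -> {mpoly K[3]}) :
  (forall j, dhomz (k j + d) (s j)) -> sum_O k (coord_open i) (coord_twist i d s).
Proof.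
move=> sd j /=.
rewrite (_ : (fun v => _) = fun v => coord_pow i (- d) v * (s j).@[v 0]).
  have -> : k j = - d + (k j + d) by ring.
  by apply: section_O_mpoly => //; exact: section_coord_pow.
by apply/funext => v; rewrite !mxE.
Qed.

Lemma coord_twist_T f i d (s : 'I_3 -> {mpoly K[3]}) :
  (forall j, dhomz d (s j)) -> deriv_along s f = 0 ->
  T_sheaf f (coord_open i) (coord_twist i d s).
Proof.
move=> sd sf; split; first by apply: coord_twist_sum_O => j; rewrite add0r.
move=> v _; rewrite (eq_bigr (fun j => coord_pow i (- d) v * ((s j * f^`M(j)).@[v 0]))).
  by rewrite -mulr_sumr -rmorph_sum -/(deriv_along s f) sf rmorph0 mulr0.
by move=> j _; rewrite !mxE mevalM mulrA.
Qed.

Lemma T_coord_twist f i d (s : 'I_3 -> {mpoly K[3]}) :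
  T_sheaf f (coord_open i) (coord_twist i d s) -> deriv_along s f = 0.
Proof.
move=> [_ h]; apply: (mpoly_eq0_dense (X_neq0 K i)) => v.
rewrite mevalXU => vi; have := h v ((coord_openE i v).2 vi).
rewrite (eq_bigr (fun j => coord_pow i (- d) v * ((s j * f^`M(j)).@[v 0]))).
  rewrite -mulr_sumr -rmorph_sum -/(deriv_along s f) /coord_pow vi /=.
  by move=> /eqP; rewrite mulf_eq0 expfz_eq0 (negbTE vi) andbF => /eqP.
by move=> j _; rewrite !mxE mevalM mulrA.
Qed.

(** A vector [s] of degree [d] is a global section of the sheaf twisted by [d], here the family
    [s / x_i^d]. By linearity over functions and compatibility with restrictions, the products of
    [x_i^d] with the images agree on overlaps. They glue to global sections of O(k_j + d), which are
    forms. *)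
Lemma coord_twist_hom m n (F : fsheaf K m) (k : 'I_n -> int) phi d
    (s : 'I_m -> {mpoly K[3]}) :
  module_sheaf F -> sheaf_hom F (sum_O k) phi ->
  (forall i, F (coord_open i) (coord_twist i d s)) ->
  exists t : 'I_n -> {mpoly K[3]}, (forall j, dhomz (k j + d) (t j)) /\
    forall i, phi (coord_open i) (coord_twist i d s) = coord_twist i d t.
Proof.
move=> Fm hphi Fs; have [_ _ FR] := Fm; have [hom lin nat] := hphi.
pose S i (v : 'rV[K]_3) := v 0 i ^ d *: phi (coord_open i) (coord_twist i d s) v.
have overlap i j (v : 'rV[K]_3) : v 0 i != 0 -> v 0 j != 0 -> S i v = S j v.
  move=> vi vj; pose D := basic_open ('X_i * 'X_j : {mpoly K[3]}).
  have Do : cone_open D.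
    by apply: (basic_open_cone (e := 1 + 1)); rewrite dhomogM ?dhomog_X.
  have Dv : D v.
    split; last by rewrite mevalM !mevalXU mulf_neq0.
    by apply: contraNneq vi => ->; rewrite mxE.
  have DI : D `<=` coord_open i.
    by move=> w [_]; rewrite mevalM !mevalXU mulf_eq0 negb_or => /andP[wi _]; exact/coord_openE.
  have DJ : D `<=` coord_open j.
    by move=> w [_]; rewrite mevalM !mevalXU mulf_eq0 negb_or => /andP[_ wj]; exact/coord_openE.
  have Ei := nat _ D (coord_open_cone i) Do DI _ (Fs i).
  have Ej := nat _ D (coord_open_cone j) Do DJ _ (Fs j).
  pose r (w : 'rV[K]_3) := patch (fun=> 0) D (coord_pow j d) w *
                           patch (fun=> 0) D (coord_pow i (- d)) w.
  have hr : section_O 0 D r.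
    rewrite -[0](subrr d); apply: section_OM => //.
      by apply: section_O_restr DJ _ => //; exact: section_coord_pow.
    by apply: section_O_restr DI _ => //; exact: section_coord_pow.
  have [F0 _ _] := Fm.
  have := lin D Do r _ _ hr (FR _ _ (coord_open_cone j) Do DJ _ (Fs j)) (F0 D Do).
  rewrite (_ : (fun w => _) = patch (fun=> 0) D (coord_twist i d s)); last first.
    apply/funext => w; rewrite /r /patch; case: ifP => [/set_mem Dw|_]; last by rewrite scaler0 addr0.
    rewrite addr0 /coord_twist scalerA; congr (_ *: _).
    have /coord_openE wi := DI w Dw; have /coord_openE wj := DJ w Dw.
    by rewrite /coord_pow wi wj mulrAC -expfzDr // subrr expr0z mul1r.
  rewrite Ei Ej => /(congr1 (fun x : 'rV[K]_3 -> 'rV[K]_n => x v)).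
  rewrite (sheaf_hom0 Fm hphi Do Dv) addr0 /r /patch mem_set // /S => ->.
  rewrite scalerA; congr (_ *: _).
  by rewrite /coord_pow vi vj mulrCA -expfzDr // subrr expr0z mulr1.
have S0 i (v : 'rV[K]_3) : ~~ (v 0 i != 0) -> S i v = 0.
  move=> vi; apply/rowP => j; rewrite /S !mxE.
  rewrite (section_O_zero (hom _ (coord_open_cone i) _ (Fs i) j)) ?mulr0 //.
  by move=> /coord_openE; exact/negP.
pose idx (v : 'rV[K]_3) : 'I_3 := if [pick i | v 0 i != 0] is Some i then i else 0.
have idxP (v : 'rV[K]_3) i : v 0 i != 0 -> v 0 (idx v) != 0.
  by move=> vi; rewrite /idx; case: pickP => [//|/(_ i)]; rewrite vi.
have Dfull : cone_open (basic_open (1 : {mpoly K[3]})).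
  by apply: (basic_open_cone (e := 0)); exact: dhomog1.
have /choice[t tP] : forall j, exists t : {mpoly K[3]}, dhomz (k j + d) t /\
    forall v : 'rV[K]_3, v != 0 -> S (idx v) v 0 j = t.@[v 0].
  move=> j; apply: section_O_global.
  apply/section_OP => //; split=> v.
    move=> nv; have v0 : v = 0.
      by apply/eqP/negPn/negP => v0; apply: nv; split; rewrite ?meval1 ?oner_neq0.
    by rewrite S0 ?mxE // v0 mxE eqxx.
  move=> [v0 _]; have [i vi] := rV3_neq0 v0.
  have hs := hom _ (coord_open_cone i) _ (Fs i) j.
  have /section_OP -/(_ (coord_open_cone i))[_] :=
    section_OM (coord_open_cone i) hs (section_coord_pow i d).
  have /coord_openE vi' := vi.
  move=> /(_ v vi')[e [g [h [he gd hv sE]]]].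
  exists e, g, h; split=> // w hw; have [/coord_openE wi sw] := sE w hw.
  split.
    by split; rewrite ?meval1 ?oner_neq0 //; apply: contraNneq wi => ->; rewrite mxE.
  by rewrite (overlap _ i) // ?(idxP _ i) // -sw /S mxE mulrC /coord_pow wi.
exists t; split=> [j|i]; first by have [] := tP j.
apply/funext => v; apply/rowP => j; rewrite /coord_twist /coord_pow !mxE.
case: ifPn => vi; last first.
  rewrite mul0r (section_O_zero (hom _ (coord_open_cone i) _ (Fs i) j)) //.
  by move=> /coord_openE; exact/negP.
have v0 : v != 0 by apply: contraNneq vi => ->; rewrite mxE.
have [_ /(_ v v0) <-] := tP j.
rewrite (overlap _ i) // ?(idxP _ i) // /S mxE mulrA -expfzDr // addNr expr0z.
by rewrite mul1r.
Qed.

(** The basis is the image under [psi] of the two constant generators, of degree 0 in the twists by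
    alpha and beta. The coefficients of a derivation are the components of its image under [phi].
    Equations are checked over [x_0 != 0] only, which is dense. *)
Lemma basis_of_free f alpha beta : free_with_exponents (T_sheaf f) alpha beta ->
  exists t1 t2 : 'I_3 -> {mpoly K[3]},
  [/\ forall i, dhomz alpha (t1 i), forall i, dhomz beta (t2 i),
      deriv_along t1 f = 0, deriv_along t2 f = 0 &
      forall d s, deriv_along s f = 0 -> (forall i, dhomz d (s i)) ->
      exists k l : {mpoly K[3]}, [/\ dhomz (d - alpha) k, dhomz (d - beta) l &
        forall i, s i = k * t1 i + l * t2 i]].
Proof.
rewrite /free_with_exponents; set expo := fun i : 'I_2 => _.
move=> /(sheaf_iso_hom (T_sheaf_module f))[phi [psi [hphi hpsi K1 K2]]].
have Gm := sum_O_module K expo.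
have hpsi' : sheaf_hom (sum_O expo) (sum_O (fun _ : 'I_3 => 0)) psi.
  case: hpsi => [h1 h2 h3]; split=> // U Uo s Gs.
  by have [] := h1 U Uo s Gs.
have dhomz1 (c : bool) : dhomz 0 (c%:R : {mpoly K[3]}).
  by case: c; [right; exists 0%N => //; exact: dhomog1|left].
pose e1 (j : 'I_2) : {mpoly K[3]} := (j == 0)%:R.
pose e2 (j : 'I_2) : {mpoly K[3]} := (j != 0)%:R.
have e1d j : dhomz (expo j + alpha) (e1 j).
  rewrite /expo /e1; case: eqP => _; last by left.
  by rewrite addNr; exact: (dhomz1 true).
have e2d j : dhomz (expo j + beta) (e2 j).
  rewrite /expo /e2; case: eqP => _; first by left.
  by rewrite addNr; exact: (dhomz1 true).
have G1 i := coord_twist_sum_O i e1d; have G2 i := coord_twist_sum_O i e2d.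
have [t1 [t1d t1E]] := coord_twist_hom Gm hpsi' G1.
have [t2 [t2d t2E]] := coord_twist_hom Gm hpsi' G2.
have [h1 lin nat] := hpsi.
have Do := coord_open_cone 0.
exists t1, t2; split.
- by move=> i; rewrite -[alpha]add0r.
- by move=> i; rewrite -[beta]add0r.
- by apply: (@T_coord_twist _ 0 alpha); rewrite -t1E; apply: h1.
- by apply: (@T_coord_twist _ 0 beta); rewrite -t2E; apply: h1.
move=> d s sf sd.
have Fs i := coord_twist_T i sd sf.
have [t [td tE]] := coord_twist_hom (T_sheaf_module f) hphi Fs.
have t0d : dhomz (d - alpha) (t 0) by rewrite addrC; exact: (td 0).
have t1d' : dhomz (d - beta) (t 1) by rewrite addrC; exact: (td 1).
exists (t 0), (t 1); split=> // i.
have := K1 _ Do _ (Fs 0); rewrite tE.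
pose r0 (v : 'rV[K]_3) := coord_pow 0 (- (d - alpha)) v * (t 0).@[v 0].
pose r1 (v : 'rV[K]_3) := coord_pow 0 (- (d - beta)) v * (t 1).@[v 0].
have hr0 : section_O 0 (coord_open 0) r0.
  rewrite -[0](addNr (d - alpha)); apply: section_O_mpoly => //.
  exact: section_coord_pow.
have hr1 : section_O 0 (coord_open 0) r1.
  rewrite -[0](addNr (d - beta)); apply: section_O_mpoly => //.
  exact: section_coord_pow.
have [G0 GD _] := Gm.
have Gy := GD _ Do r1 _ _ hr1 (G2 0) (G0 _ Do).
rewrite (_ : coord_twist 0 d t = fun v => r0 v *: coord_twist 0 alpha e1 v +
    (r1 v *: coord_twist 0 beta e2 v + 0)); last first.
  apply/funext => v; apply/rowP => j; rewrite /r0 /r1 /coord_twist /coord_pow !mxE.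
  case: ifP => v0; last by rewrite !mul0r !addr0.
  have E c : v 0 0 ^ (- d) = v 0 0 ^ (- (d - c)) * v 0 0 ^ (- c).
    by rewrite -expfzDr //; congr (_ ^ _); ring.
  case: (ord2P j) => ->; rewrite /e1 /e2 /= ?mulr1n ?mulr0n meval1 meval0.
    by rewrite (E alpha) mulr0 mulr1 !mulr0 !addr0; ring.
  by rewrite (E beta) !mulr0 mulr1 add0r addr0; ring.
rewrite (lin _ Do r0 _ _ hr0 (G1 0) Gy) (lin _ Do r1 _ _ hr1 (G2 0) (G0 _ Do)).
rewrite t1E t2E => E.
apply/eqP; rewrite -subr_eq0; apply/eqP.
apply: (mpoly_eq0_dense (X_neq0 K 0)) => v; rewrite mevalXU => v0.
have v0' := (coord_openE 0 v).2 v0.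
have := congr1 (fun x : 'rV[K]_3 -> 'rV[K]_3 => x v 0 i) E.
rewrite /= (sheaf_hom0 Gm hpsi Do v0') addr0 !mxE /r0 /r1 /coord_pow v0 => Ev.
have vd : v 0 0 ^ (- d) != 0 by rewrite expfz_eq0 (negbTE v0) andbF.
apply: (mulfI vd); rewrite mulr0 mevalB mulrBr -Ev mevalD !mevalM mulrDr.
have E' c : v 0 0 ^ (- d) = v 0 0 ^ (- (d - c)) * v 0 0 ^ (- c).
  by rewrite -expfzDr //; congr (_ ^ _); ring.
by rewrite {1}(E' alpha) (E' beta); ring.
Qed.

End TwistedSections.

(** * Freeness of triangular arrangements *)

Lemma dhomz0_const n (K : idomainType) (p : {mpoly K[n]}) :
  dhomz 0 p -> exists c, p = c%:MP.
Proof.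
case=> [->|[e [<-] /dhomogP h]]; first by exists 0; rewrite mpolyC0.
exists p@_0; apply: msize1_polyC; rewrite msizeE; apply/bigmax_leqP_seq => m mp _.
by rewrite h.
Qed.

Lemma predzS m : m.+1%:Z - 1 = m%:Z.
Proof. by rewrite -addn1 PoszD addrK. Qed.

Lemma int_squeeze (x y z : int) :
  0 <= x - z -> 0 <= y - x -> y <= z -> x - z = 0.
Proof. lia. Qed.

Lemma complement_degree (m m' N : nat) : (m + m' = N)%N ->
  N%:Z + 1 - m.+1%:Z = m'%:Z.
Proof. lia. Qed.

Section TriangleFreeness.
Variables (K : closedFieldType) (A B C : 'I_3).
Hypothesis uABC : uniq [:: A; B; C].
Hypothesis char0 : forall m, m.+1%:R != 0 :> K.

Let AB : A != B := uniq3_12 uABC.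
Let BC : B != C := uniq3_23 uABC.
Let CA : C != A := uniq3_31 uABC.
Let BA : B != A. Proof. by rewrite eq_sym. Qed.
Let CB : C != B. Proof. by rewrite eq_sym. Qed.
Let AC : A != C. Proof. by rewrite eq_sym. Qed.

Let copAB r s : mcop (lprod B C r : {mpoly K[3]}) (lprod C A s).
Proof. by apply: lprod_cop_lprod; rewrite ?AB ?BC ?CA ?BA ?CB ?AC ?orbT. Qed.
Let copCA r s : mcop (lprod A B r : {mpoly K[3]}) (lprod B C s).
Proof. by apply: lprod_cop_lprod; rewrite ?AB ?BC ?CA ?BA ?CB ?AC ?orbT. Qed.

Variables (rA rB rC : seq K).
Hypotheses (uA : uniq (0 :: rA)) (uB : uniq (0 :: rB)) (uC : uniq (0 :: rC)).

Let fA : {mpoly K[3]} := lprod B C rA.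
Let fB : {mpoly K[3]} := lprod C A rB.
Let fC : {mpoly K[3]} := lprod A B rC.
Let a : int := (size rA).+1%:Z.
Let b : int := (size rB).+1%:Z.
Let c : int := (size rC).+1%:Z.
Let F := triangle_poly A B C rA rB rC.

Let fA0 : fA != 0. Proof. exact: lprod_neq0. Qed.
Let fB0 : fB != 0. Proof. exact: lprod_neq0. Qed.
Let fC0 : fC != 0. Proof. exact: lprod_neq0. Qed.
Let fAd : dhomz (a - 1) fA.
Proof. by rewrite /a predzS; apply: dhomz_homog; exact: lprod_homog. Qed.
Let fBd : dhomz (b - 1) fB.
Proof. by rewrite /b predzS; apply: dhomz_homog; exact: lprod_homog. Qed.
Let fCd : dhomz (c - 1) fC.
Proof. by rewrite /c predzS; apply: dhomz_homog; exact: lprod_homog. Qed.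

(** The two syzygies are lifted to derivations. They generate by [hilbert_burch], equality of
    syzygies being equality of derivations by [tri_syz_inj]; they are independent because their
    minor [fA] is nonzero. *)
Lemma free_of_cross alpha beta s1 s2 s3 t1 t2 t3 :
  fA = s2 * t3 - s3 * t2 -> fB = s3 * t1 - s1 * t3 -> fC = s1 * t2 - s2 * t1 ->
  dhomz (alpha - a) s1 -> dhomz (alpha - b) s2 -> dhomz (alpha - c) s3 ->
  dhomz (beta - a) t1 -> dhomz (beta - b) t2 -> dhomz (beta - c) t3 ->
  free_with_exponents (T_sheaf F) alpha beta.
Proof.
move=> EA EB EC s1d s2d s3d t1d t2d t3d.
have [|s [sF sT sd]] := tri_syz_lift uABC char0 _ s1d s2d s3d (rA := rA) (rB := rB) (rC := rC).
  by rewrite -/fA -/fB -/fC EA EB EC; ring.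
have [|t [tF tT td]] := tri_syz_lift uABC char0 _ t1d t2d t3d (rA := rA) (rB := rB) (rC := rC).
  by rewrite -/fA -/fB -/fC EA EB EC; ring.
apply: (free_of_basis sd td sF tF).
- move=> u uF; have [w1 [w2 [w3 uT]]] := log_derivation_tri_syz uABC uA uB uC uF.
  have [k [l [w1E w2E w3E]]] :=
    hilbert_burch EA EB EC fA0 (@copAB rA rB) (tri_syz_sum uT).
  exists k, l.
  have := tri_syz_comb 1 (-1) uT (tri_syz_comb k l sT tT).
  rewrite w1E w2E w3E !mulN1r !mul1r !subrr => /(tri_syz_inj uABC char0) h i.
  have D0 : deriv_along (fun i => 1 * u i + (-1) * (k * s i + l * t i)) F = 0.
    by rewrite !deriv_along_comb uF sF tF !(mulr0, addr0).
  by have := h D0 i; rewrite mul1r mulN1r => /subr0_eq.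
move=> k l kl.
have [w1 w2 w3] := tri_syz_fun uABC (tri_syz_comb k l sT tT) kl.
have kl0 : k * fA = 0 /\ l * fA = 0.
  split.
    transitivity (t3 * (k * s2 + l * t2) - t2 * (k * s3 + l * t3)); last by rewrite w2 w3; ring.
    by rewrite EA; ring.
  transitivity (s2 * (k * s3 + l * t3) - s3 * (k * s2 + l * t2)); last by rewrite w2 w3; ring.
  by rewrite EA; ring.
by case: kl0 => /eqP + /eqP; rewrite !mulf_eq0 (negbTE fA0) !orbF => /eqP -> /eqP ->.
Qed.

(** Graded by the degree [d] of the associated derivation rather than by that of the entries. *)
Let syz d (w1 w2 w3 : {mpoly K[3]}) : Prop := [/\ w1 * fA + w2 * fB + w3 * fC = 0,
  dhomz (d - a) w1, dhomz (d - b) w2 & dhomz (d - c) w3].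

Let basis_of_free_sheaf : free_sheaf (T_sheaf F) ->
  exists alpha beta s1 s2 s3 t1 t2 t3, [/\ syz alpha s1 s2 s3, syz beta t1 t2 t3 &
    forall d w1 w2 w3, syz d w1 w2 w3 -> exists k l : {mpoly K[3]},
      [/\ dhomz (d - alpha) k, dhomz (d - beta) l &
      [/\ w1 = k * s1 + l * t1, w2 = k * s2 + l * t2 & w3 = k * s3 + l * t3]]].
Proof.
move=> [alpha [beta /basis_of_free[s [t [sd td sF tF gen]]]]].
have [s1 [s2 [s3 sT]]] := log_derivation_tri_syz uABC uA uB uC sF.
have [t1 [t2 [t3 tT]]] := log_derivation_tri_syz uABC uA uB uC tF.
exists alpha, beta, s1, s2, s3, t1, t2, t3; split.
- have [h1 h2 h3] := tri_syz_degree uABC sT sd.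
  by split=> //; exact: tri_syz_sum sT.
- have [h1 h2 h3] := tri_syz_degree uABC tT td.
  by split=> //; exact: tri_syz_sum tT.
move=> d w1 w2 w3 [w0 w1d w2d w3d].
have [u [uF uT ud]] := tri_syz_lift uABC char0 w0 w1d w2d w3d.
have [k [l [kd ld uE]]] := gen d u uF ud; exists k, l; split=> //.
have := tri_syz_comb 1 (-1) uT (tri_syz_comb k l sT tT).
move=> /(tri_syz_fun uABC)[].
  by move=> i; rewrite uE mul1r mulN1r subrr.
by rewrite !mul1r !mulN1r => /subr0_eq -> /subr0_eq -> /subr0_eq ->.
Qed.

(** Koszul syzygy; the degree is explained by its first entry [fB], of degree b - 1 = (a + b - 1) -
    a. *)
Let syzAB : syz (a + b - 1) fB (- fA) 0.
Proof.
split; first by ring.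
- by have -> : a + b - 1 - a = b - 1 by ring.
- have -> : a + b - 1 - b = a - 1 by ring.
  exact: dhomzN.
- exact: dhomz0.
Qed.
Let syzAC : syz (a + c - 1) fC 0 (- fA).
Proof.
split; first by ring.
- by have -> : a + c - 1 - a = c - 1 by ring.
- exact: dhomz0.
- have -> : a + c - 1 - c = a - 1 by ring.
  exact: dhomzN.
Qed.
Let syzBC : syz (b + c - 1) 0 fC (- fB).
Proof.
split; first by ring.
- exact: dhomz0.
- by have -> : b + c - 1 - b = c - 1 by ring.
- have -> : b + c - 1 - c = b - 1 by ring.
  exact: dhomzN.
Qed.

(** The hypothesis puts [fC] in the ideal generated by [fA] and [fB]. The resulting relation, of
    degree [c], and the Koszul syzygy, of degree [a + b - 1], have cross product [(fA, fB, fC)]. *)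
Lemma free_of_grid : (forall zA zB, zA \in rA -> zB \in rB ->
    has (fun z => z * zA * zB == 1) rC) -> free_sheaf (T_sheaf F).
Proof.
move=> h; exists (a + b - 1), c.
have [||||u [v uvE]] := @grid_ideal K 3 A B C uABC rA rB fC.
- by case/andP: uA.
- by case/andP: uB.
- by case/andP: uB.
- move=> zA zB zAr zBr; apply/eqP.
  by rewrite grid_eval_lprodAB_eq0 // h.
have uvE' : fC = piz (c - a) u * fA + piz (c - b) v * fB.
  rewrite -[LHS](piz_id fCd) uvE pizD (pizM _ _ fAd) (pizM _ _ fBd).
  by congr (piz _ _ * _ + piz _ _ * _); ring.
apply: (free_of_cross (s1 := - fB) (s2 := fA) (s3 := 0) (t1 := - piz (c - a) u)
  (t2 := - piz (c - b) v) (t3 := 1)); try ring.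
- rewrite {1}uvE'; ring.
- by apply: dhomzN; have [] := syzAB.
- by rewrite -[fA]opprK; apply: dhomzN; have [] := syzAB.
- exact: dhomz0.
- by apply: dhomzN; exact: piz_dhomz.
- by apply: dhomzN; exact: piz_dhomz.
- by rewrite subrr; apply: dhomz_homog; exact: dhomog1.
Qed.

Lemma grid_of_free : a + b - 1 <= c -> free_sheaf (T_sheaf F) ->
  forall zA zB, zA \in rA -> zB \in rB -> has (fun z => z * zA * zB == 1) rC.
Proof.
move=> abc /basis_of_free_sheaf[alpha [beta [s1 [s2 [s3 [t1 [t2 [t3 [S T gen]]]]]]]]].
(* A syzygy with third entry 1 expresses [fC] through [fA] and [fB], so [fC] vanishes on the kept
   grid. *)
suff [k [l kl]] : exists k l : {mpoly K[3]}, k * s3 + l * t3 = 1.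
  move=> zA zB zAr zBr; rewrite -(grid_eval_lprodAB_eq0 uABC).
  have -> : lprod A B rC = - ((k * s1 + l * t1) * fA + (k * s2 + l * t2) * fB).
    have [S0 _ _ _] := S; have [T0 _ _ _] := T; rewrite -/fC.
    transitivity (k * (s1 * fA + s2 * fB + s3 * fC) + l * (t1 * fA + t2 * fB + t3 * fC)
       - ((k * s1 + l * t1) * fA + (k * s2 + l * t2) * fB)).
      by rewrite -[LHS]mul1r -kl; ring.
    by rewrite S0 T0 !mulr0 addr0 add0r.
  rewrite rmorphN rmorphD !rmorphM /= grid_eval_lprodBC0 // grid_eval_lprodCA0 //.
  by rewrite !mulr0 addr0 oppr0.
(* If one basis element has third entry 0, the third entry of the other divides the third entries
   [- fA] and [- fB] of two Koszul syzygies; these are coprime, so it is a unit. *)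
have const_case (t3' : {mpoly K[3]}) : (exists k, - fA = k * t3') ->
    (exists l, - fB = l * t3') -> exists k, k * t3' = 1.
  move=> [k kE] [l lE].
  have [m mE] : mdvd fA k.
    have t0 : t3' != 0.
      by apply: contraNneq fA0 => t0; rewrite -oppr_eq0 kE t0 mulr0.
    apply: (@copAB _ rB l); rewrite -/fA -/fB; apply: (mulIf t0).
    rewrite -!mulrA -kE -lE; ring.
  exists (- m); apply: (mulfI fA0); rewrite mulr1 -[RHS]opprK kE mE; ring.
have [k1 [l1 [k1d l1d [E1 E2 E3]]]] := gen _ _ _ _ syzAB.
have [k2 [l2 [_ _ [_ _ E23]]]] := gen _ _ _ _ syzAC.
have [k3 [l3 [_ _ [_ _ E33]]]] := gen _ _ _ _ syzBC.
have [s30|s30] := eqVneq s3 0.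
  have [||k kE] := const_case t3.
  - by exists l2; rewrite E23 s30 mulr0 add0r.
  - by exists l3; rewrite E33 s30 mulr0 add0r.
  by exists 0, k; rewrite mul0r add0r.
have [t30|t30] := eqVneq t3 0.
  have [||k kE] := const_case s3.
  - by exists k2; rewrite E23 t30 mulr0 addr0.
  - by exists k3; rewrite E33 t30 mulr0 addr0.
  by exists k, 0; rewrite mul0r addr0.
(* Both third entries are now nonzero, so alpha and beta are at least [c]. The Koszul syzygy of
   degree [a + b - 1 <= c] has a nonzero coordinate; the corresponding basis element has degree at
   most [a + b - 1], hence exactly [c], and its third entry is a nonzero constant. *)
have [_ _ _ s3d] := S; have [_ _ _ t3d] := T.
have alphac := dhomz_ge0 s3d s30; have betac := dhomz_ge0 t3d t30.
have unit_case (p : {mpoly K[3]}) : p != 0 -> dhomz 0 p -> exists q, q * p = 1.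
  move=> p0 /dhomz0_const[x xE]; exists (x^-1)%:MP; rewrite xE -mpolyCM mulVf //.
  by apply: contraNneq p0 => x0; rewrite xE x0.
have [k10|k10] := eqVneq k1 0; last first.
  have ge := dhomz_ge0 k1d k10.
  have [|q qE] := unit_case s3 s30; last by exists q, 0; rewrite mul0r addr0.
  by rewrite -(int_squeeze alphac ge abc).
have [l10|l10] := eqVneq l1 0.
  by move: fB0; rewrite E1 k10 l10 !mul0r addr0 eqxx.
have ge := dhomz_ge0 l1d l10.
have [|q qE] := unit_case t3 t30; last by exists 0, q; rewrite mul0r add0r.
by rewrite -(int_squeeze betac ge abc).
Qed.

Variables (N : nat) (rA' rB' rC' : seq K).
Hypotheses (uA' : uniq (0 :: rA ++ rA')) (uB' : uniq (0 :: rB ++ rB')).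
Hypotheses (sA : (size rA + size rA' = N)%N) (sB : (size rB + size rB' = N)%N).
Hypothesis sC : (size rC + size rC' = N)%N.

Let p : {mpoly K[3]} := lprod B C rA'.
Let q : {mpoly K[3]} := lprod C A rB'.
Let r : {mpoly K[3]} := lprod A B rC'.
Hypothesis pqr : p * fA + q * fB + r * fC = 0.

Let p0 : p != 0. Proof. exact: lprod_neq0. Qed.
Let pd : dhomz (N%:Z + 1 - a) p.
Proof.
rewrite /a (complement_degree sA).
exact/dhomz_homog/lprod_homog.
Qed.
Let qd : dhomz (N%:Z + 1 - b) q.
Proof.
rewrite /b (complement_degree sB).
exact/dhomz_homog/lprod_homog.
Qed.
Let rd : dhomz (N%:Z + 1 - c) r.
Proof.
rewrite /c (complement_degree sC).
exact/dhomz_homog/lprod_homog.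
Qed.

Lemma free_of_no_triple : (forall zA zB, zA \in rA' -> zB \in rB' ->
    ~~ has (fun z => z * zA * zB == 1) rC') -> free_sheaf (T_sheaf F).
Proof.
(* [N + 1] is the degree of the derivation attached to [(p, q, r)]; the other exponent completes it
   to [a + b + c - 1], as a cross product equal to [(fA, fB, fC)] requires. *)
move=> h; exists (N%:Z + 1), (a + b + c - N%:Z - 2).
have uB'' : uniq (0 :: rB').
  move: uB'; rewrite /= mem_cat negb_or cat_uniq => /andP[/andP[_ ->]].
  by case/and3P.
have [||||u [v uvE]] := @grid_ideal K 3 A B C uABC rA' rB' fC.
- by move: uA'; rewrite /= cat_uniq => /and4P[].
- by case/andP: uB''.
- by case/andP: uB''.
- move=> zA zB zAr zBr; apply/eqP.
  have := congr1 (grid_eval A B C zA zB) pqr.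
  rewrite !rmorphD !rmorphM /= rmorph0 [grid_eval _ _ _ _ _ p]grid_eval_lprodBC0 //.
  rewrite [grid_eval _ _ _ _ _ q]grid_eval_lprodCA0 // !mul0r !add0r => /eqP.
  rewrite mulf_eq0 => /orP[|//].
  by rewrite grid_eval_lprodAB_eq0 // (negbTE (h _ _ zAr zBr)).
have EC : fC = p * u + q * v by rewrite uvE mulrC [v * _]mulrC.
have [t1 [t2 [t3 [EA EB EC']]]] := syzygy_cofactor p0 (@copAB rA' rB') pqr EC.
set beta := a + b + c - N%:Z - 2.
(* The cofactors need not be homogeneous; their components in the right degrees satisfy the same
   identities. *)
apply: (free_of_cross (s1 := p) (s2 := q) (s3 := r) (t1 := piz (beta - a) t1)
  (t2 := piz (beta - b) t2) (t3 := piz (beta - c) t3)) => //;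
  try exact: piz_dhomz.
- rewrite -[LHS](piz_id fAd) EA pizD -mulNr [q * _]mulrC [- r * _]mulrC.
  rewrite (pizM _ _ qd) (pizM _ _ (dhomzN rd)).
  rewrite [piz _ _ * q]mulrC [piz _ _ * - r]mulrC mulNr.
  by congr (_ * piz _ _ - _ * piz _ _); rewrite /beta; ring.
- rewrite -[LHS](piz_id fBd) EB pizD -mulNr [r * _]mulrC [- p * _]mulrC.
  rewrite (pizM _ _ rd) (pizM _ _ (dhomzN pd)).
  rewrite [piz _ _ * r]mulrC [piz _ _ * - p]mulrC mulNr.
  by congr (_ * piz _ _ - _ * piz _ _); rewrite /beta; ring.
- rewrite -[LHS](piz_id fCd) EC' pizD -mulNr [p * _]mulrC [- q * _]mulrC.
  rewrite (pizM _ _ pd) (pizM _ _ (dhomzN qd)).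
  rewrite [piz _ _ * p]mulrC [piz _ _ * - q]mulrC mulNr.
  by congr (_ * piz _ _ - _ * piz _ _); rewrite /beta; ring.
Qed.

Let notin_kept (r1 r2 : seq K) z : uniq (0 :: r1 ++ r2) -> z \in r2 -> z \notin r1.
Proof.
rewrite /= cat_uniq => /and4P[_ _ /hasPn h _] zr; exact: h.
Qed.

Lemma no_triple_of_free : 2 * N%:Z + 2 <= a + b + c -> free_sheaf (T_sheaf F) ->
  forall zA zB, zA \in rA' -> zB \in rB' -> ~~ has (fun z => z * zA * zB == 1) rC'.
Proof.
move=> Nabc /basis_of_free_sheaf[alpha [beta [s1 [s2 [s3 [t1 [t2 [t3 [S T gen]]]]]]]]].
move=> zA zB zAr zBr; apply/negP => /[dup] hC /hasP[zC zCr /eqP zABC].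
have zB0 : zB != 0 by apply: contra_eq_neq zABC => ->; rewrite mulr0 eq_sym oner_neq0.
have zA0 : zA != 0 by apply: contra_eq_neq zABC => ->; rewrite mulr0 mul0r eq_sym oner_neq0.
pose E := grid_eval A B C zA zB.
have EfA : E fA != 0 by rewrite grid_eval_lprodBC_eq0 // (notin_kept uA').
have Ep : E p = 0 by exact: grid_eval_lprodBC0.
have Eq : E q = 0 by exact: grid_eval_lprodCA0.
have Er : E r = 0 by apply/eqP; rewrite grid_eval_lprodAB_eq0.
have ED x y : E (x + y) = E x + E y by exact: rmorphD.
have EM x y : E (x * y) = E x * E y by exact: rmorphM.
have E0 : E 0 = 0 by exact: rmorph0.
have E1 : E 1 = 1 by exact: rmorph1.
have EC x : E x%:MP = x%:MP by rewrite /E /grid_eval !msubstC.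
clearbody E.
(* This minor is nonzero at the triple point: the corresponding minor of two Koszul syzygies is
   [fA * fA], a multiple of [XA], and no kept inner line through A contains the point. *)
pose XA := s2 * t3 - s3 * t2.
have EXA : E XA != 0.
  have [k1 [l1 [_ _ [_ E12 E13]]]] := gen _ _ _ _ syzAB.
  have [k2 [l2 [_ _ [_ E22 E23]]]] := gen _ _ _ _ syzAC.
  have XE : fA * fA = (k1 * l2 - k2 * l1) * XA.
    transitivity (- fA * - fA - 0 * 0); first by ring.
    by rewrite {1}E12 E23 {1}E13 E22 /XA; ring.
  apply/negP => /eqP X0; have := congr1 E XE; rewrite !EM X0 mulr0 => /eqP.
  by rewrite mulf_eq0 (negbTE EfA).
have syzN : syz (N%:Z + 1) p q r by split.
have [k [l [kd ld [pE qE rE]]]] := gen _ _ _ _ syzN.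
(* By Cramer's rule, [k * XA] and [l * XA] are combinations of [q] and [r], which vanish at the
   point. *)
have EXA_cancel x y z : x * XA = y * q + z * r -> E x = 0.
  move=> H; have : E x * E XA = 0.
    by rewrite -EM H ED (EM y) (EM z) Eq Er !mulr0 addr0.
  by move=> /eqP; rewrite mulf_eq0 (negbTE EXA) orbF => /eqP.
have Ek : E k = 0 by apply: (EXA_cancel k t3 (- t2)); rewrite qE rE /XA; ring.
have El : E l = 0 by apply: (EXA_cancel l (- s3) s2); rewrite qE rE /XA; ring.
(* A common factor of the coprime [p] and [q] is a unit, so it cannot vanish at the point; this
   excludes [k = 0] and [l = 0]. *)
have prim (x y1 y2 : {mpoly K[3]}) : E x = 0 -> p = x * y1 -> q = x * y2 -> False.
  move=> Ex pE' qE'; have x0 : x != 0.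
    by apply: contraNneq p0 => x0; rewrite pE' x0 mul0r.
  have [m mE] : mdvd p y1.
    apply: (@copAB _ rB' y2); rewrite -/p -/q pE' qE'; ring.
  have : 1 = x * m :> {mpoly K[3]}.
    by apply: (mulfI p0); rewrite mulr1 {1}pE' mE; ring.
  move=> /(congr1 E); rewrite EM Ex mul0r => /eqP.
  by rewrite E1 oner_eq0.
have deg_pos (x : {mpoly K[3]}) d : E x = 0 -> x != 0 -> dhomz d x -> 1 <= d.
  move=> Ex x0 xd; have := dhomz_ge0 xd x0; rewrite le_eqVlt => /orP[/eqP d0|//].
  rewrite -d0 in xd; have [y yE] := dhomz0_const xd.
  move: Ex x0; rewrite yE EC => ->.
  by rewrite eqxx.
have k0 : k != 0.
  apply/eqP => k0; apply: (prim l t1 t2) => //.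
    by rewrite pE k0 mul0r add0r.
  by rewrite qE k0 mul0r add0r.
have l0 : l != 0.
  apply/eqP => l0; apply: (prim k s1 s2) => //.
    by rewrite pE l0 mul0r addr0.
  by rewrite qE l0 mul0r addr0.
have alphaN := deg_pos _ _ Ek k0 kd; have betaN := deg_pos _ _ El l0 ld.
(* Two minors are compared: [fC * XA = fA * XC], so [fC] divides the nonzero [XC], and degrees give
   [c - 1 <= alpha + beta - a - b]. *)
pose XC := s1 * t2 - s2 * t1.
have [S0 s1d s2d _] := S; have [T0 t1d t2d _] := T.
have XAC : fC * XA = fA * XC.
  apply/eqP; rewrite -subr_eq0; apply/eqP.
  transitivity (s2 * (t1 * fA + t2 * fB + t3 * fC) - t2 * (s1 * fA + s2 * fB + s3 * fC)).
    by rewrite /XA /XC; ring.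
  by rewrite S0 T0 !mulr0 subr0.
have [m mE] : mdvd fC XC by apply: (@copCA _ rA) XAC.
have XC0 : XC != 0.
  apply/eqP => X0; move/eqP: XAC; rewrite X0 mulr0 mulf_eq0 (negbTE fC0) => /eqP XA0.
  by move: EXA; rewrite XA0 E0 eqxx.
have m0 : m != 0 by apply: contraNneq XC0 => m0; rewrite mE m0 mulr0.
have XCd : dhomz (alpha + beta - a - b) XC.
  apply: dhomzD.
    have -> : alpha + beta - a - b = (alpha - a) + (beta - b) by ring.
    exact: dhomzM.
  apply: dhomzN.
  have -> : alpha + beta - a - b = (alpha - b) + (beta - a) by ring.
  exact: dhomzM.
rewrite mE in XCd; have := dhomz_ge0 (dhomz_divl fC0 fCd XCd) m0.
by move: Nabc alphaN betaN; clear; lia.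
Qed.

End TriangleFreeness.

(** * Roots of unity *)

Lemma lprod_unity_roots n (K : idomainType) (i j : 'I_n) (mu : seq K) N :
  i != j -> uniq mu -> size mu = N -> (forall z, z \in mu -> z ^+ N = 1) ->
  (0 < N)%N -> lprod i j mu = 'X_i ^+ N - 'X_j ^+ N :> {mpoly K[n]}.
Proof.
move=> ij umu smu muN N0.
have [k kE] : mdvd (lprod i j mu) ('X_i ^+ N - 'X_j ^+ N : {mpoly K[n]}).
  apply: lprod_dvd => // z /muN zN; apply/lf_dvdP => //.
  rewrite rmorphB !rmorphXn /= !msubstX eqxx eq_sym (negbTE ij).
  by rewrite exprZn zN scale1r subrr.
have XN l : 'X_l ^+ N \is [in K[n], N.-homog].
  by rewrite -[X in X.-homog]mul1n dhomogMn ?dhomog_X.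
have kd : dhomz 0 k.
  rewrite -(subrr N%:Z); apply: (dhomz_divl (lprod_neq0 mu ij)).
    by rewrite -smu; apply/dhomz_homog/lprod_homog.
  by rewrite -kE; apply/dhomz_homog; rewrite rpredB.
have [c cE] := dhomz0_const kd.
suff c1 : c = 1 by rewrite kE cE c1 mpolyC1 mulr1.
(* At [X_j = 0] both products become ['X_i ^+ N], which identifies the constant. *)
have := congr1 (msubst j 0) kE.
rewrite rmorphM rmorphB !rmorphXn /= !msubstX eqxx (negbTE ij) expr0n eqn0Ngt N0.
rewrite subr0 cE msubstC /lprod rmorph_prod /=.
rewrite (eq_bigr (fun _ => 'X_i)); last first.
  by move=> z _; rewrite rmorphB /= msubstZ !msubstX eqxx (negbTE ij) scaler0 subr0.
rewrite big_const_seq count_predT smu iter_mulr_1 mpolyXn.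
move=> /mpolyP/(_ (U_(i) *+ N)%MM); rewrite mulrC mcoeffCM !mcoeffX eqxx mulr1.
exact: esym.
Qed.

Lemma unity_roots (K : closedFieldType) N : (0 < N)%N -> N%:R != 0 :> K ->
  exists mu : seq K, [/\ uniq mu, size mu = N & forall z, (z \in mu) = (z ^+ N == 1)].
Proof.
move=> N0 NK; have [mu muE] := closed_field_poly_normal ('X^N - 1 : {poly K}).
have mon : 'X^N - 1 \is @monic K by exact: monicXnsubC.
rewrite (monicP mon) scale1r in muE.
exists mu; split.
- by rewrite -separable_prod_XsubC -muE separable_Xn_sub_1.
- by have := congr1 (fun p : {poly K} => size p) muE; rewrite size_XnsubC // size_prod_XsubC => -[].
move=> z; rewrite -root_prod_XsubC -muE rootE !hornerE subr_eq0.
by [].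
Qed.

(** * Counting triple points among roots of unity *)

Section Counting.
Variables (K : fieldType) (N : nat) (mu : seq K).
Hypotheses (N0 : (0 < N)%N) (umu : uniq mu).
Hypothesis muE : forall z, (z \in mu) = (z ^+ N == 1).

Lemma unity_root_neq0 z : z \in mu -> z != 0.
Proof.
rewrite muE; apply: contraTneq => ->.
by rewrite expr0n eqn0Ngt N0 eq_sym oner_eq0.
Qed.

Let inv_in x z : x \in mu -> z \in mu -> (z * x)^-1 \in mu.
Proof. by rewrite !muE exprVn exprMn => /eqP -> /eqP ->; rewrite mulr1 invr1. Qed.

Variables (rA rA' rB rB' rC rC' : seq K).
Hypotheses (pA : perm_eq (rA ++ rA') mu) (pB : perm_eq (rB ++ rB') mu).
Hypothesis pC : perm_eq (rC ++ rC') mu.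

Let sub_mu (r r' : seq K) : perm_eq (r ++ r') mu ->
  [/\ uniq r, uniq r', {subset r <= mu}, {subset r' <= mu} &
      forall z, z \in mu -> (z \in r) = (z \notin r')].
Proof.
move=> p; have := umu; rewrite -(perm_uniq p) cat_uniq => /and3P[ur /hasPn d ur'].
split=> // z; rewrite -(perm_mem p) mem_cat.
- by move=> ->.
- by move=> ->; rewrite orbT.
- by case/orP => zr; [rewrite zr; apply/esym; apply: contraL zr; exact: d|rewrite zr (negbTE (d z zr))].
Qed.

(** A pair (x, y) stands for the intersection of the removed lines with parameters [x] through A and
    [y] through B; the test says that it lies on the line [z] through C. *)
Definition on_line z := [seq xy <- allpairs pair rA' rB' | z * xy.1 * xy.2 == 1].
Definition triples := [seq xy <- allpairs pair rA' rB' |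
  has (fun z => z * xy.1 * xy.2 == 1) rC'].

Let eq_inv (z x y : K) : z * x != 0 -> (z * x * y == 1) = (y == (z * x)^-1).
Proof. by move=> zx0; rewrite -(inj_eq (mulfI zx0) y) divff. Qed.

Let size_on_line z : z \in mu ->
  size (on_line z) = count (fun x => (z * x)^-1 \in rB') rA'.
Proof.
have [_ uB' _ _ _] := sub_mu pB; have [_ _ _ sA' _] := sub_mu pA.
move=> zmu; rewrite size_filter.
elim: rA' sA' => //= x r IHr sr.
rewrite count_cat IHr; last by move=> y yr; apply: sr; rewrite in_cons yr orbT.
congr addn; rewrite count_map /=.
rewrite (eq_count (a2 := pred1 (z * x)^-1)).
  by rewrite count_uniq_mem.
move=> y /=; apply: eq_inv; rewrite mulf_neq0 // unity_root_neq0 //.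
by apply: sr; rewrite mem_head.
Qed.

(* [z * x * y = 1] determines [y], hence the count of the [x] whose [y] is
   kept and of those whose [y] is removed complement each other. *)
Lemma size_on_lineE z : z \in mu ->
  (size (on_line z) + size rA =
   size rB' + count (fun x => (z * x)^-1 \in rB) rA)%N.
Proof.
move=> zmu; rewrite size_on_line //.
have [_ uB' _ sB' dB] := sub_mu pB; have [_ _ sA _ _] := sub_mu pA.
have zinv y : (z * (z * y)^-1)^-1 = y.
  by rewrite invfM invrK mulKf // unity_root_neq0.
have -> : size rB' = count (fun x => (z * x)^-1 \in rB') mu.
  rewrite -[RHS]size_filter -(size_map (fun y => (z * y)^-1) rB').
  apply: perm_size; apply: uniq_perm.
  - rewrite map_inj_in_uniq // => x y _ _ /invr_inj/(mulfI _); apply.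
    exact: unity_root_neq0.
  - exact: filter_uniq.
  move=> x; rewrite mem_filter; apply/mapP/andP => [[y yB ->]|[xB xmu]].
    by rewrite zinv; split=> //; apply: inv_in => //; exact: sB'.
  by exists (z * x)^-1.
have -> : count (fun x => (z * x)^-1 \in rB') mu =
  (count (fun x => (z * x)^-1 \in rB') rA + count (fun x => (z * x)^-1 \in rB') rA')%N.
  by rewrite -count_cat; apply/permP; rewrite perm_sym.
have cE : count (fun x => (z * x)^-1 \in rB') rA =
    count (predC (fun x => (z * x)^-1 \in rB)) rA.
  apply: eq_in_count => x xr /=; rewrite dB ?negbK //.
  by apply: inv_in => //; exact: sA.
have := count_predC (fun x => (z * x)^-1 \in rB) rA; rewrite cE => <-.
by rewrite (addnC (count _ rA)) addnA (addnC (count _ rA')).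
Qed.

(** Given [x] and [y], only one [z] satisfies [z x y = 1]: every triple point is counted on exactly
    one line through C. *)
Lemma size_triples : size triples = \sum_(z <- rC') size (on_line z).
Proof.
have [_ uC' _ _ _] := sub_mu pC; have [_ _ _ sA' _] := sub_mu pA.
have [_ _ _ sB' _] := sub_mu pB.
rewrite /triples /on_line size_filter -sum1_count big_mkcond /=.
rewrite [RHS](eq_bigr (fun z => (\sum_(xy <- allpairs pair rA' rB')
    if (z * xy.1 * xy.2 == 1)%R then 1 else 0)%N)); last first.
  by move=> z _; rewrite size_filter -sum1_count big_mkcond.
rewrite exchange_big /= big_seq [RHS]big_seq; apply: eq_bigr => xy.
case/allpairsP=> [[x y] [xA yB ->]] /=; rewrite -big_mkcond /= sum1_count.
have xy0 : x * y != 0.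
  by apply: mulf_neq0; apply: unity_root_neq0; [exact: sA'|exact: sB'].
have eqz z : (z * x * y == 1) = (z == (x * y)^-1).
  by rewrite -mulrA -(inj_eq (mulIf xy0) z) mulVf.
rewrite (eq_count (a2 := pred1 (x * y)^-1)) // count_uniq_mem //.
rewrite (eq_has (a2 := pred1 (x * y)^-1)) // has_pred1.
by case: (_ \in _).
Qed.

Let kept_grid := forall x y, x \in rA -> y \in rB -> has (fun z => z * x * y == 1) rC.

(** Number of points of the line [z] through C that lie on a kept line through A and a kept line
    through B. *)
Let defect z := count (fun x => (z * x)^-1 \in rB) rA.

(** The point of two kept lines lies on the line [(x y)^-1] through C, which is either kept or
    removed; the removed case is what a nonzero defect detects. *)
Let defect0P : kept_grid <-> forall z, z \in rC' -> defect z = 0%N.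
Proof.
have [_ _ sA _ _] := sub_mu pA; have [_ _ sB _ _] := sub_mu pB.
have [_ _ sC sC' dC] := sub_mu pC.
have x0 x : x \in rA -> x != 0 by move=> /sA; exact: unity_root_neq0.
have y0 y : y \in rB -> y != 0 by move=> /sB; exact: unity_root_neq0.
split=> [kept z zC|h x y xA yB].
  apply/eqP; rewrite -leqn0 leqNgt -has_count; apply/hasPn => x xA; apply/negP => yB.
  have /hasP[t tC] := kept _ _ xA yB.
  move=> /eqP/divr1_eq/(mulIf (x0 x xA)) tz.
  by move: zC; rewrite -tz; apply/negP; rewrite -dC // sC.
have xy : (x * y)^-1 \in mu by apply: inv_in; [exact: sB|exact: sA].
apply/hasP; exists (x * y)^-1; last first.
  by rewrite /= -mulrA mulVf //; apply: mulf_neq0; [exact: x0|exact: y0].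
rewrite dC //; apply/negP => /h/eqP; rewrite -leqn0 leqNgt -has_count; apply/negP.
rewrite negbK; apply/hasP; exists x => //.
by rewrite invfM invrK mulrAC divff ?mul1r // x0.
Qed.

(** Summing [size_on_lineE] over the removed lines through C, the number of triple points differs
    from the stated product by the sum of the defects, and these are nonnegative. *)
Lemma triples_count : kept_grid <->
  (size triples)%:Z = (size rC')%:Z * ((size rB')%:Z - (size rA)%:Z).
Proof.
have [_ _ _ sC' _] := sub_mu pC.
have : (\sum_(z <- rC') (size (on_line z) + size rA) =
    \sum_(z <- rC') (size rB' + defect z))%N.
  rewrite big_seq [RHS]big_seq; apply: eq_bigr => z /sC'; exact: size_on_lineE.
rewrite !big_split /= !big_const_seq !count_predT !iter_addn_0 -size_triples => E.
have -> : kept_grid <-> (\sum_(z <- rC') defect z = 0)%N.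
  rewrite defect0P; split=> [h|/eqP]; first by rewrite big_seq big1.
  by rewrite sum_nat_seq_eq0 => /allP h z zC; apply/eqP; exact: h.
move: E; rewrite mulrBr -!PoszM ![(size rC' * _)%N]mulnC.
move: (size triples) (_ * _)%N (_ * _)%N (\sum_(_ <- _) _)%N => t x y s; lia.
Qed.

Lemma on_line_count z : kept_grid -> z \in rC' ->
  (size (on_line z))%:Z = (size rB')%:Z - (size rA)%:Z.
Proof.
move=> /defect0P h zC; have [_ _ _ sC' _] := sub_mu pC.
have := size_on_lineE (sC' _ zC); rewrite -/(defect z) h //; lia.
Qed.


End Counting.

(** * Lines of the monomial arrangement *)

Section Lines.
Variable K : closedFieldType.
Implicit Types (i j k : 'I_3) (z : K) (l : P2line K) (v w : 'rV[K]_3).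

Definition line_vspace i j z : {vspace 'rV[K]_3} :=
  lker (linfun (mulmxr (delta_mx i 0 - z *: delta_mx j 0 : 'cV[K]_3))).

Lemma mem_line_vspace i j z v : (v \in line_vspace i j z) = (v 0 i == z * v 0 j).
Proof.
rewrite memv_ker lfunE /= mulmxBr -scalemxAr -!colE -[RHS]subr_eq0.
apply/eqP/eqP => [/matrixP/(_ 0 0)|h]; first by rewrite !mxE.
by apply/matrixP => x y; rewrite !ord1 !mxE.
Qed.

Lemma dim_line_vspace i j z : i != j -> \dim (line_vspace i j z) == 2%N.
Proof.
move=> ij; rewrite /line_vspace; set f := linfun _.
have := limg_ker_dim f fullv; rewrite capfv dimvf (_ : dim 'rV[K]_3 = 3%N) //.
have le1 : (\dim (limg f) <= 1)%N.
  by apply: leq_trans (dimvS (subvf _)) _; rewrite dimvf.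
have ge1 : limg f != 0%VS.
  apply/eqP => f0; have : delta_mx 0 i \in line_vspace i j z.
    rewrite memv_ker -memv0 -f0; exact: memv_img (memvf _).
  rewrite mem_line_vspace !mxE !eqxx [j == i]eq_sym (negbTE ij) mulr0.
  by rewrite oner_eq0.
rewrite -dimv_eq0 in ge1.
by case: (\dim (limg f)) le1 ge1 => [//|[|//]] _ _; rewrite addn1 => -[->].
Qed.

Definition lineof i j (ij : i != j) z : P2line K :=
  exist _ (line_vspace i j z) (dim_line_vspace z ij).

Lemma mem_lineof i j (ij : i != j) z v :
  (v \in val (lineof ij z)) = (v 0 i == z * v 0 j).
Proof. exact: mem_line_vspace. Qed.

Lemma eq_lineof i j (ij : i != j) z l :
  (forall v, v \in val l -> v 0 i = z * v 0 j) -> l = lineof ij z.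
Proof.
move=> h; apply/val_inj/eqP; rewrite eqEdim; apply/andP; split.
  by apply/subvP => v /h vE; rewrite mem_lineof vE.
by rewrite (eqP (valP l)) (eqP (valP (lineof ij z))).
Qed.

Lemma incident_coord i l : incident (coord_point K i) l = (delta_mx 0 i \in val l).
Proof. by rewrite /incident /= -memvE. Qed.

Lemma incident_lineof k i j (ij : i != j) z :
  incident (coord_point K k) (lineof ij z) = (k != i) && ((k != j) || (z == 0)).
Proof.
rewrite incident_coord mem_lineof !mxE eqxx /= ![_ == k]eq_sym.
case: (eqVneq k i) => [->|ki] /=.
  by rewrite (negbTE ij) mulr0 oner_eq0.
by case: (eqVneq k j) => _ /=; rewrite ?mulr1 ?mulr0 ?eqxx // eq_sym.
Qed.

Lemma lineof_inj i j (ij : i != j) : injective (lineof ij).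
Proof.
move=> z t E; pose v : 'rV[K]_3 := \row_k (if k == i then z else (k == j)%:R).
have : v \in val (lineof ij z).
  by rewrite mem_lineof !mxE !eqxx [j == i]eq_sym (negbTE ij) mulr1.
by rewrite E mem_lineof !mxE !eqxx [j == i]eq_sym (negbTE ij) mulr1 => /eqP.
Qed.

Lemma meval_lf i j z v : (lf i j z).@[v 0] = v 0 i - z * v 0 j.
Proof. by rewrite mevalB mevalZ !mevalXU. Qed.

Lemma equation_of_lineof i j (ij : i != j) z g : equation_of_line (lineof ij z) g ->
  exists2 c, c != 0 & g = c *: lf i j z.
Proof.
move=> [g1 g0 gl].
have [k kE] : mdvd (lf i j z) g.
  apply/lf_dvdP => //; apply/eqP/negPn/negP => /mpoly_nonroot_rV[v].
  rewrite /msubst comp_mpoly_meval.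
  pose w : 'rV[K]_3 := \row_k (if k == i then z * v 0 j else v 0 k).
  rewrite (meval_eq (v2 := w 0)) ?gl ?eqxx //.
    by rewrite mem_lineof !mxE eqxx [j == i]eq_sym (negbTE ij).
  move=> k; rewrite tnth_mktuple mxE; case: ifP => _; rewrite ?mevalXU //.
  by rewrite mevalZ mevalXU.
have kd : dhomz 0 k.
  rewrite -(subrr 1); apply: (dhomz_divl (lf_neq0 z ij)).
    exact/dhomz_homog/lf_homog.
  by rewrite -kE; exact: dhomz_homog.
have [c cE] := dhomz0_const kd.
exists c; last by rewrite kE cE mulrC mul_mpolyC.
by apply: contraNneq g0 => c0; rewrite kE cE c0 mpolyC0 mulr0.
Qed.

(* A line is an irreducible curve: it lies in a union of lines only if it lies
   in one of them. *)
Lemma line_sub_prod (S : seq {mpoly K[3]}) l :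
  (forall v, v \in val l -> (\prod_(p <- S) p).@[v 0] = 0) ->
  exists2 p, p \in S & forall v, v \in val l -> p.@[v 0] = 0.
Proof.
move=> Sl; pose d := \dim (val l); pose X := vbasis (val l).
(* Parametrization of the line by coordinates in a basis. Pulling back along it lands in a domain,
   where a product vanishes only if a factor does. *)
pose lq := [tuple \sum_(m < d) (X`_m 0 k) *: 'X_m | k < 3] : 3.-tuple {mpoly K[d]}.
have ev (p : {mpoly K[3]}) (w : 'I_d -> K) :
    (p \mPo lq).@[w] = p.@[(\sum_(m < d) w m *: X`_m : 'rV[K]_3) 0].
  rewrite comp_mpoly_meval; apply: meval_eq => k.
  rewrite tnth_mktuple rmorph_sum summxE; apply: eq_bigr => m _.
  by rewrite /= mevalZ mevalXU !mxE mulrC.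
have zero (p : {mpoly K[3]}) : (forall v, v \in val l -> p.@[v 0] = 0) <->
    p \mPo lq = 0.
  split=> [h|h v vl].
    apply/eqP/negPn/negP => /mpoly_nonroot[w]; rewrite ev h ?eqxx //.
    apply: memv_suml => m _; apply: memvZ; apply: vbasis_mem.
    by apply: mem_nth; rewrite size_tuple.
  by rewrite {1}(coord_vbasis vl) -ev h meval0.
have /eqP := (zero _).1 Sl; rewrite rmorph_prod /= prodf_seq_eq0 => /hasP[p pS /eqP p0].
by exists p => //; exact/zero.
Qed.

End Lines.

Section Arrangement.
Variables (K : closedFieldType) (N : nat) (mu : seq K) (iA iB iC : 'I_3).
Hypotheses (N0 : (0 < N)%N) (umu : uniq mu) (smu : size mu = N).
Hypothesis muE : forall z, (z \in mu) = (z ^+ N == 1).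
Hypothesis uABC : uniq [:: iA; iB; iC].

Let AB : iA != iB := uniq3_12 uABC.
Let BC : iB != iC := uniq3_23 uABC.
Let CA : iC != iA := uniq3_31 uABC.
Let BA : iB != iA. Proof. by rewrite eq_sym. Qed.
Let CB : iC != iB. Proof. by rewrite eq_sym. Qed.
Let AC : iA != iC. Proof. by rewrite eq_sym. Qed.

Let A := coord_point K iA.
Let B := coord_point K iB.
Let C := coord_point K iC.
Let lA : K -> P2line K := lineof BC.
Let lB : K -> P2line K := lineof CA.
Let lC : K -> P2line K := lineof AB.

Definition tri_lines (rA rB rC : seq K) : seq (P2line K) :=
  map lA (0 :: rA) ++ map lB (0 :: rB) ++ map lC (0 :: rC).

Lemma tri_linesP rA rB rC l : (l \in tri_lines rA rB rC) <->
  [\/ exists2 z, z \in 0 :: rA & l = lA z, exists2 z, z \in 0 :: rB & l = lB z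
    | exists2 z, z \in 0 :: rC & l = lC z].
Proof.
rewrite !mem_cat; split.
  by case/or3P => /mapP[z zr ->]; [apply: Or31|apply: Or32|apply: Or33]; exists z.
by case=> -[z zr ->]; rewrite map_f // ?orbT.
Qed.

Let incA : (forall z, incident A (lA z)) /\ (forall z, incident A (lB z) = (z == 0)) /\
  (forall z, incident A (lC z) = false).
Proof.
by split; [|split] => z; rewrite incident_lineof ?eqxx ?AB ?AC /= ?eqxx //= .
Qed.
Let incB : (forall z, incident B (lB z)) /\ (forall z, incident B (lC z) = (z == 0)) /\
  (forall z, incident B (lA z) = false).
Proof.
by split; [|split] => z; rewrite incident_lineof ?eqxx ?BC ?BA /= ?eqxx //= .
Qed.
Let incC : (forall z, incident C (lC z)) /\ (forall z, incident C (lA z) = (z == 0)) /\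
  (forall z, incident C (lB z) = false).
Proof.
by split; [|split] => z; rewrite incident_lineof ?eqxx ?CB ?CA /= ?eqxx //= .
Qed.

Lemma tri_lines_uniq rA rB rC : uniq (0 :: rA) -> uniq (0 :: rB) -> uniq (0 :: rC) ->
  uniq (tri_lines rA rB rC).
Proof.
move=> uA uB uC; have [A1 [A2 A3]] := incA; have [B1 [B2 B3]] := incB.
have [C1 [C2 C3]] := incC.
have uX i j (ij : i != j) r : uniq r -> uniq (map (lineof ij : K -> P2line K) r).
  by move=> ur; rewrite map_inj_uniq //; exact: lineof_inj.
rewrite /tri_lines cat_uniq (uX _ _ BC) // cat_uniq (uX _ _ CA) // (uX _ _ AB) //.
rewrite has_cat negb_or !andTb andbT -andbA; apply/and3P; split.
- apply/hasPn => l /mapP[z _ ->]; apply/negP => /mapP[t _ E].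
  by have := B1 z; rewrite E B3.
- apply/hasPn => l /mapP[z _ ->]; apply/negP => /mapP[t _ E].
  by have := A1 t; rewrite -E A3.
- apply/hasPn => l /mapP[z _ ->]; apply/negP => /mapP[t _ E].
  by have := C1 z; rewrite E C3.
Qed.

(** The sign depends on the labelling of the vertices: the triangle form uses cyclic differences,
    whereas [monomial_poly] contains [x ^+ N - z ^+ N]. *)
Lemma monomial_triangle : let M := triangle_poly iA iB iC mu mu mu in
  M = monomial_poly K N \/ M = - monomial_poly K N.
Proof.
have root i j : i != j -> lprod i j (0 :: mu) = 'X_i * ('X_i ^+ N - 'X_j ^+ N) :> {mpoly K[3]}.
  move=> ij; rewrite lprod_cons /lf scale0r subr0 (lprod_unity_roots ij umu smu) //.
  by move=> z; rewrite muE => /eqP.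
rewrite /triangle_poly !root // /monomial_poly /=.
have ordE (i : 'I_3) : [\/ i = 0, i = 1 | i = 2%:R].
  by case: i => [[|[|[|//]]] h]; [apply: Or31|apply: Or32|apply: Or33]; apply/val_inj.
move: uABC; rewrite /= !inE !andbT; case: (ordE iA) => ->; case: (ordE iB) => ->;
case: (ordE iC) => -> //= _;
move: ('X_(0 : 'I_3)) ('X_(1 : 'I_3)) ('X_(2%:R : 'I_3)) => x y z;
first [left; ring|right; ring].
Qed.

Lemma full_monomialP l : full_monomial N l <-> l \in tri_lines mu mu mu.
Proof.
pose M := triangle_poly iA iB iC mu mu mu.
have ME v : (monomial_poly K N).@[v] = 0 <-> M.@[v] = 0.
  rewrite /M; case: monomial_triangle => -> //; rewrite mevalN.
  by split=> [->|/eqP]; rewrite ?oppr0 // oppr_eq0 => /eqP.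
pose S : seq {mpoly K[3]} := map (lf iB iC) (0 :: mu) ++ map (lf iC iA) (0 :: mu) ++
  map (lf iA iB) (0 :: mu).
have MS : M = \prod_(p <- S) p.
  by rewrite /S !big_cat /= -!map_cons !big_map mulrA.
have lf_line i j (ij : i != j) z :
    (forall v : 'rV[K]_3, v \in val l -> (lf i j z).@[v 0] = 0) -> l = lineof ij z.
  move=> h; apply: eq_lineof => v /h; rewrite meval_lf => /eqP.
  by rewrite subr_eq0 => /eqP.
have line_lf i j (ij : i != j) z (v : 'rV[K]_3) : v \in val (lineof ij z) ->
    (lf i j z).@[v 0] = 0.
  by rewrite mem_lineof meval_lf => /eqP ->; rewrite subrr.
split=> [h|].
  have [p pS ph] : exists2 p, p \in S & forall v : 'rV[K]_3, v \in val l -> p.@[v 0] = 0.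
    by apply: line_sub_prod => v /h /ME; rewrite MS.
  rewrite !mem_cat in pS; case/or3P: pS => /mapP[z zr pE]; rewrite pE in ph;
    apply/tri_linesP.
  - by apply: Or31; exists z => //; exact: lf_line.
  - by apply: Or32; exists z => //; exact: lf_line.
  - by apply: Or33; exists z => //; exact: lf_line.
have dvd i j z r (v : 'rV[K]_3) : z \in r -> (lf i j z).@[v 0] = 0 -> (lprod i j r).@[v 0] = 0.
  by move=> /(lf_dvd_lprod i j)[k ->] h; rewrite mevalM h mul0r.
move=> /tri_linesP[] [z zr ->] v /line_lf h; apply/ME; rewrite /M /triangle_poly !mevalM.
- by rewrite (dvd _ _ _ _ _ zr h) !mul0r.
- by rewrite (dvd _ _ _ _ _ zr h) mulr0 mul0r.
- by rewrite (dvd _ _ _ _ _ zr h) mulr0.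
Qed.

Lemma side_vspace i j k (jk : j != k) : i != j -> k != i ->
  val (lineof jk 0 : P2line K) = (val (coord_point K i) + val (coord_point K k))%VS.
Proof.
move=> ij ki; apply/vspaceP => v; rewrite mem_lineof mul0r.
apply/eqP/idP => [vj|/memv_addP[x /vlineP[s ->] [y /vlineP[t ->] ->]]]; last first.
  by rewrite !mxE [j == i]eq_sym (negbTE ij) (negbTE jk) !mulr0 addr0.
apply/memv_addP; exists (v 0 i *: delta_mx 0 i); first by apply/vlineP; eexists.
exists (v 0 k *: delta_mx 0 k); first by apply/vlineP; eexists.
have ijk : uniq [:: i; j; k] by rewrite /= !inE negb_or ij eq_sym ki jk.
apply/rowP => x; rewrite !mxE /=.
case/or3P: (ord3_triangle ijk x) => /eqP ->; rewrite ?eqxx ?(negbTE jk) ?(negbTE ki).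
- by rewrite [i == k]eq_sym (negbTE ki) mulr1 mulr0 addr0.
- by rewrite [j == i]eq_sym (negbTE ij) vj !mulr0 addr0.
- by rewrite mulr0 mulr1 add0r.
Qed.

Lemma sides : [/\ is_side A B C (lA 0), is_side A B C (lB 0) & is_side A B C (lC 0)].
Proof.
split; apply/or3P.
- by apply: Or32; apply/eqP; exact: side_vspace.
- by apply: Or31; rewrite addvC; apply/eqP; exact: side_vspace.
- by apply: Or33; rewrite addvC; apply/eqP; exact: side_vspace.
Qed.

End Arrangement.

(** * Deletions of the monomial arrangement *)

Lemma T_sheaf_scale (K : closedFieldType) (c : K) (f : {mpoly K[3]}) : c != 0 ->
  T_sheaf (c *: f) = T_sheaf f.
Proof.
move=> c0; apply/funext => U.
have E (x v : 'rV[K]_3) : \sum_(i < 3) x 0 i * ((c *: f)^`M(i)).@[v 0] =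
    c * \sum_(i < 3) x 0 i * (f^`M(i)).@[v 0].
  by rewrite mulr_sumr; apply: eq_bigr => i _; rewrite mderivZ mevalZ mulrCA.
apply/seteqP; split=> s [h1 h2]; split=> // v Uv; have := h2 v Uv.
  by rewrite E => /eqP; rewrite mulf_eq0 (negbTE c0) => /eqP.
by rewrite E => ->; rewrite mulr0.
Qed.

Lemma finite_card_image (T : eqType) (S : choiceType) (g : T -> S) (s : seq T)
    (X : set S) : uniq s -> {in s &, injective g} ->
  (forall p, X p <-> exists2 x, x \in s & p = g x) -> finite_card X = size s.
Proof.
move=> us gi XE; rewrite /finite_card.
have -> : X = [set` [fset y in map g s]%fset].
  apply/seteqP; split=> p /=.
    by move=> /XE[x xs ->]; rewrite inE /= map_f.
  by rewrite inE /= => /mapP[x xs ->]; apply/XE; exists x.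
by rewrite set_fsetK card_fseq undup_id ?size_map // map_inj_in_uniq.
Qed.

Lemma removed_count (m m' N c : nat) : (m + m' = N)%N -> m.+1 = c ->
  m'%:Z = N%:Z - c%:Z + 1.
Proof. lia. Qed.

Lemma removed_excess (m n n' N a b : nat) : (n + n' = N)%N -> m.+1 = a -> n.+1 = b ->
  n'%:Z - m%:Z = N%:Z - a%:Z - b%:Z + 2.
Proof. lia. Qed.

Lemma slack_le (N a b c : nat) : 2 * N%:Z - a%:Z - b%:Z - c%:Z + 2 <= 0 ->
  2 * N%:Z + 2 <= a%:Z + b%:Z + c%:Z.
Proof. lia. Qed.

Section DeletedArrangement.
Variables (K : closedFieldType) (N : nat) (iA iB iC : 'I_3).
Hypothesis char0 : forall m, m.+1%:R != 0 :> K.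
Hypothesis N0 : (0 < N)%N.
Hypothesis uABC : uniq [:: iA; iB; iC].
Variable mu : seq K.
Hypotheses (umu : uniq mu) (smu : size mu = N).
Hypothesis muE : forall z, (z \in mu) = (z ^+ N == 1).

Let AB : iA != iB := uniq3_12 uABC.
Let BC : iB != iC := uniq3_23 uABC.
Let CA : iC != iA := uniq3_31 uABC.
Let BA : iB != iA. Proof. by rewrite eq_sym. Qed.
Let CB : iC != iB. Proof. by rewrite eq_sym. Qed.
Let AC : iA != iC. Proof. by rewrite eq_sym. Qed.

Let A := coord_point K iA.
Let B := coord_point K iB.
Let C := coord_point K iC.
Let lA : K -> P2line K := lineof BC.
Let lB : K -> P2line K := lineof CA.
Let lC : K -> P2line K := lineof AB.

Variables (arr Ac : {fset P2line K}).
Hypothesis side_arr : forall l, is_side A B C l -> l \in arr.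
Hypothesis del : obtained_by_deleting A B C N Ac arr.

Let rA := [seq z <- mu | lA z \in arr].
Let rB := [seq z <- mu | lB z \in arr].
Let rC := [seq z <- mu | lC z \in arr].
Let rA' := [seq z <- mu | lA z \in Ac].
Let rB' := [seq z <- mu | lB z \in Ac].
Let rC' := [seq z <- mu | lC z \in Ac].

Let fullP l : full_monomial N l <-> l \in tri_lines uABC mu mu mu.
Proof. exact: full_monomialP. Qed.

Let arrE l : (l \in arr) = (l \in tri_lines uABC mu mu mu) && (l \notin Ac).
Proof.
have [_ _ /(congr1 (fun S : set (P2line K) => S l)) E] := del.
have {}E : (l \in arr) = (full_monomial N l /\ ~ (l \in Ac)) :> Prop by exact: E.
apply/idP/andP; first by rewrite [is_true _]E => -[/fullP -> /negP].
by move=> [/fullP h /negP h']; rewrite [is_true _]E.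
Qed.

Let Ac_tri l : l \in Ac -> l \in tri_lines uABC mu mu mu.
Proof. by have [h _ _] := del; move=> /h /fullP. Qed.

Let mu0 z : z \in mu -> z != 0. Proof. exact: (unity_root_neq0 N0 muE). Qed.

Let perm_kept i j (ij : i != j) :
  (forall z, z \in mu -> lineof ij z \in tri_lines uABC mu mu mu) ->
  perm_eq ([seq z <- mu | lineof ij z \in arr] ++ [seq z <- mu | lineof ij z \in Ac]) mu.
Proof.
move=> h; rewrite (eq_in_filter (a1 := fun z => lineof ij z \in Ac)
  (a2 := predC (fun z => lineof ij z \in arr))); first exact/permPl/perm_filterC.
by move=> z zmu /=; rewrite arrE h // negbK.
Qed.

Let tri_mem r1 r2 r3 z : [/\ z \in 0 :: r1 -> lA z \in tri_lines uABC r1 r2 r3,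
  z \in 0 :: r2 -> lB z \in tri_lines uABC r1 r2 r3 &
  z \in 0 :: r3 -> lC z \in tri_lines uABC r1 r2 r3].
Proof.
split=> zr; apply/tri_linesP.
- by apply: Or31; exists z.
- by apply: Or32; exists z.
- by apply: Or33; exists z.
Qed.

Let pA : perm_eq (rA ++ rA') mu.
Proof.
apply: perm_kept => z zmu; have [h _ _] := tri_mem mu mu mu z.
by apply: h; rewrite inE zmu orbT.
Qed.
Let pB : perm_eq (rB ++ rB') mu.
Proof.
apply: perm_kept => z zmu; have [_ h _] := tri_mem mu mu mu z.
by apply: h; rewrite inE zmu orbT.
Qed.
Let pC : perm_eq (rC ++ rC') mu.
Proof.
apply: perm_kept => z zmu; have [_ _ h] := tri_mem mu mu mu z.
by apply: h; rewrite inE zmu orbT.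
Qed.

Let uniq0 r r' : perm_eq (r ++ r') mu -> uniq (0 :: r ++ r').
Proof.
move=> p; rewrite cons_uniq (perm_uniq p) umu andbT (perm_mem p).
by apply/negP => /mu0; rewrite eqxx.
Qed.

Let uniq0l r r' : perm_eq (r ++ r') mu -> uniq (0 :: r).
Proof.
by move=> /uniq0; rewrite /= mem_cat negb_or cat_uniq => /andP[/andP[-> _] /and3P[->]].
Qed.

Let size_mu r r' : perm_eq (r ++ r') mu -> (size r + size r' = N)%N.
Proof. by move=> /perm_size; rewrite size_cat smu. Qed.

Let lines0 : [/\ lA 0 \in arr, lB 0 \in arr & lC 0 \in arr].
Proof.
have [h1 h2 h3] := sides K uABC.
by split; apply: side_arr.
Qed.

Let arr_perm : perm_eq arr (tri_lines uABC rA rB rC).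
Proof.
apply: uniq_perm => [||l]; first exact: fset_uniq.
  by apply: tri_lines_uniq; [exact: uniq0l pA|exact: uniq0l pB|exact: uniq0l pC].
have [h1 h2 h3] := lines0.
apply/idP/idP => [la|/tri_linesP[] [z]]; last first.
- by rewrite inE mem_filter => /orP[/eqP -> ->|/andP[h _] ->].
- by rewrite inE mem_filter => /orP[/eqP -> ->|/andP[h _] ->].
- by rewrite inE mem_filter => /orP[/eqP -> ->|/andP[h _] ->].
move: (la); rewrite arrE => /andP[/tri_linesP lt _]; apply/tri_linesP.
case: lt => -[z zr lE]; [apply: Or31|apply: Or32|apply: Or33]; exists z => //;
  move: zr; rewrite !inE mem_filter => /orP[->//|zmu]; apply/orP; right;
  by rewrite zmu andbT; move: la; rewrite lE.
Qed.

Let incident_arr i : #|` [fset l in arr | incident (coord_point K i) l]%fset| =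
  count (incident (coord_point K i)) (tri_lines uABC rA rB rC).
Proof.
rewrite -size_filter; apply/perm_size/uniq_perm; first exact: fset_uniq.
  by rewrite filter_uniq // -(perm_uniq arr_perm) fset_uniq.
by move=> l; rewrite mem_filter -(perm_mem arr_perm) !inE andbC.
Qed.

Let count_zero (r : seq K) : uniq (0 :: r) -> count (pred1 0) (0 :: r) = 1%N.
Proof. by move=> u0; rewrite count_uniq_mem // mem_head. Qed.

(** Besides the inner lines, the two sides [lA 0] and [lB 0] pass through A; thus [a] is
    [(size rA).+1]. *)
Let incident_A : #|` [fset l in arr | incident A l]%fset| = (size rA).+2.
Proof.
rewrite incident_arr /tri_lines !count_cat !count_map.
have EA z : incident A (lA z) = predT z by rewrite incident_lineof AB AC.
have EB z : incident A (lB z) = (pred1 0) z by rewrite incident_lineof AC eqxx.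
have EC z : incident A (lC z) = pred0 z by rewrite incident_lineof eqxx.
rewrite (eq_count EA) (eq_count EB) (eq_count EC).
by rewrite count_predT count_pred0 (count_zero (uniq0l pB)) addn0 addn1.
Qed.

Let incident_B : #|` [fset l in arr | incident B l]%fset| = (size rB).+2.
Proof.
rewrite incident_arr /tri_lines !count_cat !count_map.
have EA z : incident B (lA z) = pred0 z by rewrite incident_lineof eqxx.
have EB z : incident B (lB z) = predT z by rewrite incident_lineof BA BC.
have EC z : incident B (lC z) = (pred1 0) z by rewrite incident_lineof BA eqxx.
rewrite (eq_count EA) (eq_count EB) (eq_count EC).
by rewrite count_predT count_pred0 (count_zero (uniq0l pC)) add0n addn1.
Qed.

Let incident_C : #|` [fset l in arr | incident C l]%fset| = (size rC).+2.
Proof.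
rewrite incident_arr /tri_lines !count_cat !count_map.
have EA z : incident C (lA z) = (pred1 0) z by rewrite incident_lineof CB eqxx.
have EB z : incident C (lB z) = pred0 z by rewrite incident_lineof eqxx.
have EC z : incident C (lC z) = predT z by rewrite incident_lineof CA CB.
rewrite (eq_count EA) (eq_count EB) (eq_count EC).
by rewrite count_predT count_pred0 (count_zero (uniq0l pA)) add0n add1n.
Qed.

Let defining_triangle f : defining_equation arr f ->
  exists2 c, c != 0 & f = c *: triangle_poly iA iB iC rA rB rC.
Proof.
case=> g gE ->; rewrite (perm_big _ arr_perm) /= /tri_lines.
rewrite !big_cat /=.
have part i j (ij : i != j) r : {subset [seq lineof ij z | z <- r] <= arr} ->
    exists2 c, c != 0 & \prod_(l <- [seq lineof ij z | z <- r]) g l = c *: lprod i j r.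
  elim: r => [_|z r IHr h].
    by exists 1; rewrite ?oner_neq0 // /lprod !big_nil scale1r.
  have [c c0 cE] := IHr (fun l lr => h l (mem_behead (s := _ :: _) lr)).
  have [d d0 dE] := equation_of_lineof (gE _ (h _ (mem_head _ _))).
  exists (d * c); first exact: mulf_neq0.
  by rewrite /= big_cons cE dE lprod_cons -scalerAl -scalerAr scalerA.
have sub s : {subset s <= tri_lines uABC rA rB rC} -> {subset s <= arr}.
  by move=> h l /h; rewrite -(perm_mem arr_perm).
have [|c1 c10 E1] := part _ _ BC (0 :: rA).
  by apply: sub => l /mapP[z zr ->]; have [h _ _] := tri_mem rA rB rC z; exact: h.
have [|c2 c20 E2] := part _ _ CA (0 :: rB).
  by apply: sub => l /mapP[z zr ->]; have [_ h _] := tri_mem rA rB rC z; exact: h.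
have [|c3 c30 E3] := part _ _ AB (0 :: rC).
  by apply: sub => l /mapP[z zr ->]; have [_ _ h] := tri_mem rA rB rC z; exact: h.
exists (c1 * c2 * c3); first by rewrite !mulf_neq0.
rewrite mulrA.
transitivity ((c1 *: lprod iB iC (0 :: rA)) * (c2 *: lprod iC iA (0 :: rB)) *
   (c3 *: lprod iA iB (0 :: rC))); first by rewrite -E1 -E2 -E3.
by rewrite /triangle_poly -!mul_mpolyC !mpolyCM; ring.
Qed.

Let pqr : lprod iB iC rA' * lprod iB iC rA + lprod iC iA rB' * lprod iC iA rB +
  lprod iA iB rC' * lprod iA iB rC = 0 :> {mpoly K[3]}.
Proof.
have whole i j (ij : i != j) r r' : perm_eq (r ++ r') mu ->
    lprod i j r' * lprod i j r = 'X_i ^+ N - 'X_j ^+ N :> {mpoly K[3]}.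
  move=> p; rewrite mulrC /lprod -big_cat (perm_big _ p) /=.
  by apply: (lprod_unity_roots ij umu smu) => // z; rewrite muE => /eqP.
by rewrite (whole _ _ BC _ _ pA) (whole _ _ CA _ _ pB) (whole _ _ AB _ _ pC); ring.
Qed.

Let Ac_not_side : [/\ lA 0 \notin Ac, lB 0 \notin Ac & lC 0 \notin Ac].
Proof.
have [_ h _] := del; have [h1 h2 h3] := sides K uABC.
by split; apply/negP => /h; rewrite ?h1 ?h2 ?h3.
Qed.

(** A vertex lies on lines of its own family and on one side of another family; a removed line is
    not a side, so the vertex determines its family. *)
Let removed_A l : l \in Ac -> incident A l -> exists2 z, z \in rA' & l = lA z.
Proof.
have [hA hB hC] := Ac_not_side.
move=> lAc; case/tri_linesP: (Ac_tri lAc) => -[z zr lE]; rewrite lE in lAc *.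
- move=> _; exists z => //; rewrite mem_filter lAc /=.
  by move: zr; rewrite inE => /orP[/eqP z0|//]; rewrite z0 (negbTE hA) in lAc.
- rewrite incident_lineof AC eqxx /= => /eqP z0.
  by rewrite z0 (negbTE hB) in lAc.
- by rewrite incident_lineof eqxx.
Qed.
Let removed_B l : l \in Ac -> incident B l -> exists2 z, z \in rB' & l = lB z.
Proof.
have [hA hB hC] := Ac_not_side.
move=> lAc; case/tri_linesP: (Ac_tri lAc) => -[z zr lE]; rewrite lE in lAc *.
- by rewrite incident_lineof eqxx.
- move=> _; exists z => //; rewrite mem_filter lAc /=.
  by move: zr; rewrite inE => /orP[/eqP z0|//]; rewrite z0 (negbTE hB) in lAc.
- rewrite incident_lineof BA eqxx /= => /eqP z0.
  by rewrite z0 (negbTE hC) in lAc.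
Qed.
Let removed_C l : l \in Ac -> incident C l -> exists2 z, z \in rC' & l = lC z.
Proof.
have [hA hB hC] := Ac_not_side.
move=> lAc; case/tri_linesP: (Ac_tri lAc) => -[z zr lE]; rewrite lE in lAc *.
- rewrite incident_lineof CB eqxx /= => /eqP z0.
  by rewrite z0 (negbTE hA) in lAc.
- by rewrite incident_lineof eqxx.
- move=> _; exists z => //; rewrite mem_filter lAc /=.
  by move: zr; rewrite inE => /orP[/eqP z0|//]; rewrite z0 (negbTE hC) in lAc.
Qed.

(** Intersection of [X_B = x X_C] and [X_C = y X_A], normalized by [X_A = 1]. *)
Let pt_vec (x y : K) : 'rV[K]_3 :=
  \row_k (if k == iA then 1 else if k == iB then x * y else y).

Let pt_vecE x y : [/\ pt_vec x y 0 iA = 1, pt_vec x y 0 iB = x * y & pt_vec x y 0 iC = y].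
Proof. by rewrite !mxE eqxx (negbTE BA) eqxx (negbTE CA) (negbTE CB). Qed.

Let pt_subproof x y : \dim <[pt_vec x y]>%VS == 1%N.
Proof.
rewrite dim_vline; suff -> : pt_vec x y != 0 by [].
apply/eqP => /rowP/(_ iA); have [-> _ _] := pt_vecE x y.
by rewrite mxE => /eqP; rewrite oner_eq0.
Qed.

Let pt x y : P2point K := exist _ <[pt_vec x y]>%VS (pt_subproof x y).

Let incident_pt x y l : incident (pt x y) l = (pt_vec x y \in val l).
Proof. by rewrite /incident /= -memvE. Qed.

Let pt_inj x y x' y' : y != 0 -> pt x y = pt x' y' -> (x, y) = (x', y').
Proof.
move=> y0 /(congr1 val) /= E.
have : pt_vec x y \in <[pt_vec x' y']>%VS by rewrite -E memv_line.
case/vlineP => k kE; have [h1 h2 h3] := pt_vecE x y; have [h1' h2' h3'] := pt_vecE x' y'.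
have k1 : k = 1.
  by have := congr1 (fun v : 'rV[K]_3 => v 0 iA) kE; rewrite /= h1 mxE h1' mulr1.
rewrite k1 scale1r in kE; rewrite kE in h2 h3.
rewrite -h3 h3' in y0 *; rewrite h2' -h3 h3' in h2.
by rewrite (mulIf y0 h2).
Qed.

Let Trem := inner_triple_points A B C Ac.
Let T := triples rA' rB' rC'.

Let Trem_incident p : Trem p -> exists x y, [/\ (x, y) \in T, p = pt x y &
  forall z, incident p (lC z) = (z * x * y == 1)].
Proof.
case=> l1 [l2 [l3 [[/removed_A h1 /h1[x xr ->] px] [[/removed_B h2 /h2[y yr ->] py]]]]].
case=> /removed_C h3 /h3[z zr ->] pz {h1 h2 h3 l1 l2 l3}.
case: p px py pz => U /= U1; rewrite /incident /= => px py pz.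
have [u uU u0] : exists2 u, u \in U & u != 0.
  by exists (vpick U); rewrite ?memv_pick // vpick0 -dimv_eq0 (eqP U1).
have Bu := subvP px _ uU; have Cu := subvP py _ uU; have Au := subvP pz _ uU.
rewrite !mem_line_vspace in Bu Cu Au.
(* The equations of the first two lines propagate a zero coordinate A to C and then to B, so the
   normalization [X_A = 1] is possible. *)
have uA0 : u 0 iA != 0.
  apply: contraNneq u0 => uA; apply/eqP/rowP => k; rewrite mxE.
  move: Cu Bu; rewrite uA mulr0 => /eqP uC; rewrite uC mulr0 => /eqP uB.
  by case/or3P: (ord3_triangle uABC k) => /eqP ->.
have uE : u = u 0 iA *: pt_vec x y.
  have [e1 e2 e3] := pt_vecE x y; apply/rowP => k; rewrite mxE.
  case/or3P: (ord3_triangle uABC k) => /eqP ->.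
  - by rewrite e1 mulr1.
  - by rewrite e2 (eqP Bu) (eqP Cu); ring.
  - by rewrite e3 (eqP Cu) mulrC.
have UE : U = <[pt_vec x y]>%VS.
  apply/eqP; rewrite eq_sym eqEdim (eqP U1) (eqP (pt_subproof x y)) leqnn andbT -memvE.
  have -> : pt_vec x y = (u 0 iA)^-1 *: u by rewrite {2}uE scalerA mulVf // scale1r.
  exact: memvZ.
exists x, y; split.
- rewrite mem_filter; apply/andP; split; last by apply/allpairsP; exists (x, y).
  apply/hasP; exists z => //=; apply/eqP; apply: (mulIf uA0).
  by rewrite mul1r {2}(eqP Au) (eqP Bu) (eqP Cu); ring.
- exact/val_inj.
move=> t; rewrite UE -memvE mem_line_vspace; have [-> -> _] := pt_vecE x y.
by rewrite mulrA eq_sym.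
Qed.

Let Trem_pt x y : (x, y) \in T -> Trem (pt x y).
Proof.
rewrite mem_filter => /andP[/hasP[z zr /= /eqP zxy] /allpairsP[[x' y'] [/= xr yr []]]].
move=> ? ?; subst x' y'; have [h1 h2 h3] := pt_vecE x y.
exists (lA x), (lB y), (lC z); rewrite !incident_pt !mem_lineof h1 h2 h3.
rewrite !incident_lineof AB AC BC BA CA CB /= mulrA zxy mulr1 !eqxx.
by move: xr yr zr; rewrite !mem_filter => /andP[-> _] /andP[-> _] /andP[-> _].
Qed.

Let uniq_mu r r' : perm_eq (r ++ r') mu -> uniq r'.
Proof. by move=> p; move: umu; rewrite -(perm_uniq p) cat_uniq => /and3P[]. Qed.

Let uniq_pairs : uniq (allpairs pair rA' rB').
Proof.
apply: allpairs_uniq; [exact: uniq_mu pA|exact: uniq_mu pB|].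
by move=> [x y] [x' y'] _ _ /= ->.
Qed.

Let pairs_inj (s : seq (K * K)) : {subset s <= allpairs pair rA' rB'} ->
  {in s &, injective (fun xy => pt xy.1 xy.2)}.
Proof.
move=> sub [x y] [x' y'] /sub/allpairsP[[x1 y1] [/= _ + [_ ->]]] _ /=.
by rewrite mem_filter => /andP[_ /mu0 y0] /(pt_inj y0).
Qed.

Let card_Trem : finite_card Trem = size T.
Proof.
apply: (@finite_card_image _ _ (fun xy : K * K => pt xy.1 xy.2)).
- by rewrite filter_uniq // uniq_pairs.
- by apply: pairs_inj => xy; rewrite mem_filter => /andP[].
move=> p; split; last by case=> -[x y] xyT ->; exact: Trem_pt.
by move=> /Trem_incident[x [y [xyT -> _]]]; exists (x, y).
Qed.

Let card_Trem_line z : z \in rC' ->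
  finite_card [set p | Trem p /\ incident p (lC z)] = size (on_line rA' rB' z).
Proof.
move=> zr; apply: (@finite_card_image _ _ (fun xy : K * K => pt xy.1 xy.2)).
- by rewrite filter_uniq // uniq_pairs.
- by apply: pairs_inj => xy; rewrite mem_filter => /andP[].
move=> p; split.
  case=> /Trem_incident[x [y [xyT -> h]]]; rewrite h => zxy.
  by exists (x, y) => //; move: xyT; rewrite !mem_filter /= zxy => /andP[].
case=> -[x y]; rewrite mem_filter /= => /andP[zxy xyr] ->.
have xyT : (x, y) \in T.
  by rewrite mem_filter xyr andbT; apply/hasP; exists z.
split; first exact: Trem_pt.
rewrite incident_pt mem_lineof; have [-> -> _] := pt_vecE x y.
by rewrite mulrA eq_sym.
Qed.

Let Trem0P : Trem = set0 <->
  forall x y, x \in rA' -> y \in rB' -> ~~ has (fun z => z * x * y == 1) rC'.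
Proof.
split=> [T0 x y xr yr|h].
  apply/negP => hz; have : Trem (pt x y).
    by apply: Trem_pt; rewrite mem_filter hz; apply/allpairsP; exists (x, y).
  by rewrite T0.
apply/seteqP; split=> // p /Trem_incident[x [y [+ _ _]]].
rewrite mem_filter => /andP[/= hz /allpairsP[[x' y'] [/= xr yr [ex ey]]]].
by have := h _ _ xr yr; rewrite -ex -ey hz.
Qed.

Lemma deleted_monomial_freeness (a b c : nat) (f : {mpoly K[3]}) :
  [/\ #|` [fset l in arr | incident A l]%fset| = a.+1,
      #|` [fset l in arr | incident B l]%fset| = b.+1 &
      #|` [fset l in arr | incident C l]%fset| = c.+1] ->
  defining_equation arr f ->
  (Trem = set0 -> free_sheaf (T_sheaf f)) /\
  (2 * N%:Z - a%:Z - b%:Z - c%:Z + 2 <= 0 ->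
     (Trem = set0 <-> free_sheaf (T_sheaf f))) /\
  (c%:Z >= a%:Z + b%:Z - 1 ->
     (free_sheaf (T_sheaf f) <->
        (finite_card Trem)%:Z = (N%:Z - c%:Z + 1) * (N%:Z - a%:Z - b%:Z + 2)) /\
     (free_sheaf (T_sheaf f) ->
        forall l : P2line K, l \in Ac -> incident C l ->
          (finite_card [set p | Trem p /\ incident p l])%:Z =
          N%:Z - a%:Z - b%:Z + 2)).
Proof.
rewrite incident_A incident_B incident_C => -[[aE] [bE] [cE]].
case/defining_triangle => k k0 ->; rewrite T_sheaf_scale //.
have uA := uniq0l pA; have uB := uniq0l pB; have uC := uniq0l pC.
have sA := size_mu pA; have sB := size_mu pB; have sC := size_mu pC.
have free0 : Trem = set0 -> free_sheaf (T_sheaf (triangle_poly iA iB iC rA rB rC)).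
  move=> /Trem0P h; apply: (free_of_no_triple uABC char0 uA uB uC
    (uniq0 pA) (uniq0 pB) sA sB sC pqr h).
split=> //; split=> [le|le].
  split=> // hf; apply/Trem0P.
  apply: (no_triple_of_free uABC char0 uA uB uC (uniq0 pA) sA sB sC pqr _ hf).
  by rewrite aE bE cE; exact: slack_le.
have grid : free_sheaf (T_sheaf (triangle_poly iA iB iC rA rB rC)) <->
    forall x y, x \in rA -> y \in rB -> has (fun z => z * x * y == 1) rC.
  split=> [hf|]; last exact: free_of_grid.
  by apply: (grid_of_free uABC char0 uA uB uC _ hf); rewrite aE bE cE.
have degC : (size rC')%:Z = N%:Z - c%:Z + 1 := removed_count sC cE.
(* This is (N - b + 1) - (a - 1): removed lines through B minus kept inner lines through A. *)
have degB : (size rB')%:Z - (size rA)%:Z = N%:Z - a%:Z - b%:Z + 2 :=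
  removed_excess sB aE bE.
rewrite -degC -degB; split.
  by rewrite grid card_Trem; exact: (triples_count N0 umu muE pA pB pC).
move=> /grid h l lAc Cl; have [z zr ->] := removed_C lAc Cl.
by rewrite card_Trem_line // (on_line_count N0 umu muE pA pB pC h zr).
Qed.

End DeletedArrangement.

Theorem theorem4p1 (R : realType) (N : nat) (iA iB iC : 'I_3) (a b c : nat)
    (arr Ac : {fset P2line R[i]}) (f : {mpoly R[i][3]}) :
  let A := coord_point R[i] iA in
  let B := coord_point R[i] iB in
  let C := coord_point R[i] iC in
  let Trem := inner_triple_points A B C Ac in
  (1 <= N)%N ->
  uniq [:: iA; iB; iC] ->
  Tr A B C a b c arr ->
  obtained_by_deleting A B C N Ac arr ->
  defining_equation arr f ->
  (Trem = set0 -> free_sheaf (T_sheaf f)) /\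
  (2 * N%:Z - a%:Z - b%:Z - c%:Z + 2 <= 0 ->
     (Trem = set0 <-> free_sheaf (T_sheaf f))) /\
  (c%:Z >= a%:Z + b%:Z - 1 ->
     (free_sheaf (T_sheaf f) <->
        (finite_card Trem)%:Z = (N%:Z - c%:Z + 1) * (N%:Z - a%:Z - b%:Z + 2)) /\
     (free_sheaf (T_sheaf f) ->
        forall l : P2line R[i], l \in Ac -> incident C l ->
          (finite_card [set p | Trem p /\ incident p l])%:Z = N%:Z - a%:Z - b%:Z + 2)).
Proof.
move=> A B C Trem N0 uABC [_ [_ [_ [side_arr sizes]]]] del deff.
have char0 m : m.+1%:R != 0 :> R[i] by rewrite pnatr_eq0.
have [mu [umu smu muE]] : exists mu : seq R[i],
    [/\ uniq mu, size mu = N & forall z, (z \in mu) = (z ^+ N == 1)].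
  by apply: unity_roots => //; case: N N0 {del} => // n _; exact: char0.
exact: (deleted_monomial_freeness char0 N0 uABC umu smu muE side_arr del sizes deff).
Qed.
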